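(* Let $\overline\theta$ be the static Néel wall phase, and let $\mathcal L,\mathcal L_\infty$ be the operators on $L^2$ with common domain $H^2$ given by $$\mathcal L u=-\partial_x^2u+\sin\overline\theta\,(1+(-\Delta)^{1/2})(u\sin\overline\theta)-c_\theta u,\qquad \mathcal L_\infty u=-\partial_x^2u+(1+(-\Delta)^{1/2})u,$$ where $c_\theta=\cos\overline\theta\,(1+(-\Delta)^{1/2})\cos\overline\theta$. Then the linear operator $\mathcal L_\infty-\mathcal L:H^2\to L^2$ is continuous and compact.
   Context: $L^2$ and $H^k$ denote $L^2(\mathbb R,\mathbb C)$ and $H^k(\mathbb R,\mathbb C)$. The half-Laplacian is $(-\Delta)^{1/2}u=(|\xi|\hat u)^\vee$ and $\|u\|_{\dot H^{1/2}}=\||\xi|^{1/2}\hat u\|_{L^2}$ (unitary Fourier transform). The static Néel wall phase $\overline\theta:\mathbb R\to(-\pi/2,\pi/2)$ is the minimizer of $\mathcal E(\theta)=\frac12\big(\|\theta'\|_{L^2}^2+\|\cos\theta\|_{\dot H^{1/2}}^2+\|\cos\theta\|_{L^2}^2\big)$ among $\theta:\mathbb R\to(-\pi/2,\pi/2)$ with $\theta(\pm\infty)=\pm\pi/2$, normalized by $\overline\theta(0)=0$. It is known (earlier work) that $\overline\theta$ exists, that minimizers are unique up to translation, that $\overline\theta$ is smooth, $\partial_x\overline\theta>0$ on $\mathbb R$, $\partial_x\overline\theta\in H^2$, and $\partial_x^2\overline\theta+\sin\overline\theta\,(1+(-\Delta)^{1/2})\cos\overline\theta=0$. *)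

(* Defs.v *)
From mathcomp Require Import all_boot all_order all_algebra.
From mathcomp Require Import complex.
From mathcomp Require Import all_classical all_reals all_analysis.

Set Implicit Arguments.
Unset Strict Implicit.
Unset Printing Implicit Defensive.

Import Order.TTheory GRing.Theory Num.Theory.
Import numFieldNormedType.Exports.

Local Open Scope classical_set_scope.
Local Open Scope ring_scope.
Local Open Scope complex_scope.

(* Elements of L^2 and H^k are handled through (Borel measurable)
   representatives: a function space is a set of functions R -> R[i], and its
   norm is a seminorm whose kernel is almost-everywhere equality.  Norms take
   values in \bar R, so that no convention is hidden in them for functions
   outside the space. *)

Local Notation Re := complex.Re.
Local Notation Im := complex.Im.

Section FunctionSpaces.
Context {R : realType}.
Local Notation C := R[i].
Local Notation mu := (@lebesgue_measure R).
Implicit Types (f g phi : R -> R) (u v w : R -> C).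

Definition cplx f : R -> C := fun x => (f x)%:C.

Definition cintegral (D : set R) u : C :=
  (\int[mu]_(x in D) Re (u x)) +i* (\int[mu]_(x in D) Im (u x)).

Definition L2 : set (R -> C) :=
  [set u | (fun x => Re (u x)) \in Lfun mu 2%:E /\
           (fun x => Im (u x)) \in Lfun mu 2%:E].

Definition L2norm u : \bar R :=
  Lnorm mu 2%:E (fun x => (Normc.normc (u x))%:E).

Definition test_function phi : Prop :=
  (forall (n : nat) (x : R), derivable (derive1n n phi) x 1) /\
  (exists M : R, forall x : R, M < `|x| -> phi x = 0).

Definition is_weak_derivative_real f g : Prop :=
  [/\ locally_integrable setT f, locally_integrable setT g &
   forall phi, test_function phi ->
     \int[mu]_x (f x * derive1 phi x) = - \int[mu]_x (g x * phi x)].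

Definition is_weak_derivative u v : Prop :=
  is_weak_derivative_real (fun x => Re (u x)) (fun x => Re (v x)) /\
  is_weak_derivative_real (fun x => Im (u x)) (fun x => Im (v x)).

(* The weak derivative is determined almost everywhere; a representative is
   chosen.  The value 0 is used when there is no weak derivative. *)
Definition wderiv u : R -> C := xget (fun=> 0) [set v | is_weak_derivative u v].

Fixpoint sobolev (k : nat) : set (R -> C) :=
  match k with
  | 0 => L2
  | j.+1 => [set u | L2 u /\ exists2 v, is_weak_derivative u v & sobolev j v]
  end.

Definition sobolev_norm (k : nat) u : \bar R :=
  sqrte (\sum_(j < k.+1) L2norm (iter j wderiv u) ^+ 2)%E.

(* Integral of e^{i s x xi} u(x) / sqrt(2 pi) over [-n, n]. *)
Definition fourier_trunc (s : R) (n : nat) u : R -> C := fun xi =>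
  ((Num.sqrt (2 * pi))^-1)%:C *
  cintegral `[- n%:R, n%:R]
    (fun x => (cos (s * x * xi) +i* sin (s * x * xi)) * u x).

(* The unitary Fourier transform (s = -1) and its inverse (s = 1) on L^2, as
   the limit in L^2 of the truncated integrals (Plancherel). *)
Definition is_fourier (s : R) u v : Prop :=
  [/\ L2 u, L2 v &
   L2norm (fun xi => fourier_trunc s n u xi - v xi) @[n --> \oo] --> 0%E].

(* Representatives, with the value 0 outside L^2. *)
Definition fourier u : R -> C := xget (fun=> 0) [set v | is_fourier (-1) u v].
Definition inv_fourier u : R -> C := xget (fun=> 0) [set v | is_fourier 1 u v].

Definition half_laplacian u : R -> C :=
  inv_fourier (fun xi => (`|xi|)%:C * fourier u xi).

Definition Hdot_half_norm u : \bar R :=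
  L2norm (fun xi => (Num.sqrt `|xi|)%:C * fourier u xi).

Definition one_plus_half_laplacian u : R -> C :=
  fun x => u x + half_laplacian u x.

End FunctionSpaces.

Section Operators.
Context {R : realType}.
Local Notation C := R[i].
Local Notation mu := (@lebesgue_measure R).
Variables (X Y : set (R -> C)) (normX normY : (R -> C) -> \bar R).
Variable T : (R -> C) -> (R -> C).

(* T maps X to Y, induces a map between almost-everywhere classes, and this
   map is C-linear. *)
Definition linear_operator : Prop :=
  [/\ forall u, X u -> Y (T u),
      forall u v, X u -> X v -> u = v %[ae mu] -> T u = T v %[ae mu] &
      forall (a : C) (u v : R -> C), X u -> X v ->
        T (fun x => a * u x + v x) = (fun x => a * T u x + T v x) %[ae mu]].

Definition continuous_operator : Prop :=
  forall u, X u -> forall e : R, 0 < e -> exists2 d : R, 0 < d &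
    forall v, X v -> (normX (fun x => v x - u x)%R < d%:E)%E ->
      (normY (fun x => T v x - T u x)%R < e%:E)%E.

(* The image of every bounded sequence has a convergent subsequence. *)
Definition compact_operator : Prop :=
  forall (u : nat -> R -> C) (M : R),
    (forall n, X (u n) /\ (normX (u n) <= M%:E)%E) ->
    exists (k : nat -> nat) (v : R -> C),
      [/\ {homo k : m n / (m < n)%N}, Y v &
       normY (fun x => T (u (k n)) x - v x) @[n --> \oo] --> 0%E].

End Operators.

Section NeelWall.
Context {R : realType}.
Local Notation C := R[i].
Implicit Types (theta eta : R -> R) (u : R -> C).

Definition cos_phase theta : R -> C := cplx (fun x => cos (theta x)).
Definition sin_phase theta : R -> C := cplx (fun x => sin (theta x)).

Definition energy theta : \bar R :=
  ((2^-1)%:E * (L2norm (wderiv (cplx theta)) ^+ 2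
                + Hdot_half_norm (cos_phase theta) ^+ 2
                + L2norm (cos_phase theta) ^+ 2))%E.

(* The phases on which the energy is defined and finite, each taken in its
   continuous representative (theta' in L^2), so that theta(0) and
   theta(+-oo) make sense.  Finiteness of the homogeneous H^{1/2} term is
   automatic, since cos theta is then in H^1. *)
Definition admissible_phase theta : Prop :=
  [/\ continuous theta,
      forall x, - (pi / 2) < theta x < pi / 2,
      theta x @[x --> +oo] --> pi / 2 &
      theta x @[x --> -oo] --> - (pi / 2)] /\
  (exists2 v, is_weak_derivative (cplx theta) v & L2 v) /\
  L2 (cos_phase theta).

Definition neel_wall_phase theta : Prop :=
  [/\ admissible_phase theta,
      forall eta, admissible_phase eta -> (energy theta <= energy eta)%E &
      theta 0 = 0].

Definition c_coef theta : R -> C := fun x =>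
  cos_phase theta x * one_plus_half_laplacian (cos_phase theta) x.

Definition calL theta u : R -> C := fun x =>
  - wderiv (wderiv u) x
  + sin_phase theta x *
      one_plus_half_laplacian (fun y => u y * sin_phase theta y) x
  - c_coef theta x * u x.

Definition calL_infty u : R -> C := fun x =>
  - wderiv (wderiv u) x + one_plus_half_laplacian u x.

End NeelWall.

(* Main.v *)
Require Import Defs.
From mathcomp Require Import all_boot all_order all_algebra.
From mathcomp Require Import complex.
From mathcomp Require Import all_classical all_reals all_analysis.
From mathcomp Require Import measurable_realfun.
From mathcomp Require Import ring lra.

(** Write s and c for the sine and the cosine of theta, Lambda for the
    half-Laplacian, and u^ for the Fourier transform of u.  In the difference T
    of the two operators the second derivatives cancel, and s^2 + c^2 = 1 turns
    the rest into

      T u = (2 c^2 + c Lambda c) u + c^2 Lambda u - s [Lambda, s] u,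

    where [Lambda, s] u = Lambda (s u) - s Lambda u ([diffopE]).  Each of the
    three terms is an integral operator of Hilbert-Schmidt type applied to
    w = (1 + xi^2) u^, a square integrable function whose norm is controlled by
    the H^2 norm of u ([weighted_fourier_le]).

    - u(x) and Lambda u(x) are inverse Fourier integrals, that is, pairings of w
      with e^{i x xi} / (1 + xi^2) and with |xi| e^{i x xi} / (1 + xi^2).  The
      norms of these kernels do not depend on x, while the coefficients
      2 c^2 + c Lambda c and c^2 are square integrable, because c is bounded
      and square integrable.

    - On the Fourier side the commutator pairs u^ with
      (|xi| - |eta|) s^(xi - eta).  Since | |xi| - |eta| | <= |xi - eta|, this
      is a(xi, eta) g^(xi - eta) for a symbol a bounded by 1 and for
      g = s' = c theta', which is square integrable ([commutator_formula]).
      Hence the kernel a(xi, eta) g^(xi - eta) / (1 + eta^2) is square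
      integrable in (xi, eta), although s itself is not square integrable.

    So each term is x |-> m(x) <K_x, w> with |m(x)| ||K_x|| square integrable in
    x.  This bounds the operator ([kernel_operator_bound]).  Moreover K_x
    depends continuously on x in the mean, so a diagonal extraction over the
    rational points x gives, from a bounded sequence w_n, a subsequence for
    which <K_x, w_n> converges for every x ([weak_subsequence]), and dominated
    convergence makes the images converge in the mean
    ([kernel_operator_compact]).

    The commutator formula is first proved with s replaced by sin(chi theta),
    chi a smooth cut-off at scale n: both this function and its derivative are
    square integrable, and the derivative tends to g since chi' = O(1/n).  The
    analytic basis is Plancherel's theorem ([plancherel_supp], [fourier_norm],
    [fourier_inv]), obtained from the Poisson kernel by Abel summation, and the
    fact that a weak derivative becomes multiplication by i xi
    ([weak_fourier]). *)

Set Implicit Arguments.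
Unset Strict Implicit.
Unset Printing Implicit Defensive.

Import Order.TTheory GRing.Theory Num.Theory.
Import numFieldNormedType.Exports.

Local Open Scope classical_set_scope.
Local Open Scope ring_scope.
Local Open Scope complex_scope.

Local Notation Re := complex.Re.
Local Notation Im := complex.Im.
Local Notation normc := Normc.normc.
Local Notation "z ^*" := (conjc z) : ring_scope.

(** * Complex modulus and characters *)

Section ComplexModulus.
Context {R : realType}.
Local Notation C := R[i].
Implicit Types (z w : C).

Definition expi (t : R) : C := cos t +i* sin t.

Lemma ReDE z w : Re (z + w) = Re z + Re w.
Proof. by case: z w => [a b] [c d]. Qed.
Lemma ImDE z w : Im (z + w) = Im z + Im w.
Proof. by case: z w => [a b] [c d]. Qed.
Lemma ReNE z : Re (- z) = - Re z.
Proof. by case: z. Qed.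
Lemma ImNE z : Im (- z) = - Im z.
Proof. by case: z. Qed.
Lemma ReME z w : Re (z * w) = Re z * Re w - Im z * Im w.
Proof. by case: z w => [a b] [c d]. Qed.
Lemma ImME z w : Im (z * w) = Re z * Im w + Im z * Re w.
Proof. by case: z w => [a b] [c d]. Qed.
Lemma ReJE z : Re z^* = Re z.
Proof. by case: z. Qed.
Lemma ImJE z : Im z^* = - Im z.
Proof. by case: z. Qed.
Lemma complex_ext z w : Re z = Re w -> Im z = Im w -> z = w.
Proof. by case: z w => [a b] [c d] /= -> ->. Qed.

Lemma normc_ge0 z : 0 <= normc z.
Proof. by case: z => a b; exact: sqrtr_ge0. Qed.

Lemma normc_sq z : normc z ^+ 2 = Re z ^+ 2 + Im z ^+ 2.
Proof. by case: z => a b; rewrite sqr_sqrtr// addr_ge0// sqr_ge0. Qed.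

Lemma normc_sqrt z : normc z = Num.sqrt (Re z ^+ 2 + Im z ^+ 2).
Proof. by case: z. Qed.

Lemma normcD z w : normc (z + w) <= normc z + normc w.
Proof.
have := lec_normD z w.
by rewrite /= => /andP[].
Qed.

Lemma normcN z : normc (- z) = normc z.
Proof. by case: z => a b /=; rewrite !sqrrN. Qed.

Lemma normcBC z w : normc (z - w) = normc (w - z).
Proof. by rewrite -opprB normcN. Qed.

Lemma normc_triangle z w y : normc (z - w) <= normc (z - y) + normc (y - w).
Proof. by apply: le_trans (normcD _ _); rewrite addrA subrK. Qed.

Lemma normc_conj z : normc z^* = normc z.
Proof. by case: z => a b /=; rewrite sqrrN. Qed.

Lemma normc_real (a : R) : normc a%:C = `|a|.
Proof. by rewrite /= expr0n/= addr0 sqrtr_sqr. Qed.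

Lemma normc_eq0 z : normc z = 0 -> z = 0.
Proof. exact: Normc.eq0_normc. Qed.

Lemma normc0 : normc (0 : C) = 0.
Proof. exact: Normc.normc0. Qed.

Lemma normc1 : normc (1 : C) = 1.
Proof. exact: Normc.normc1. Qed.

Lemma normcM z w : normc (z * w) = normc z * normc w.
Proof. exact: Normc.normcM. Qed.

Lemma normc_sub_dist z w : `|normc z - normc w| <= normc (z - w).
Proof.
rewrite ler_norml; apply/andP; split.
  rewrite lerNl opprB lerBlDr normcBC.
  by rewrite -[X in normc X <= _](subrK z) normcD.
by rewrite lerBlDr -[X in normc X <= _](subrK w) normcD.
Qed.

Lemma normRe_le z : `|Re z| <= normc z.
Proof.
rewrite -ler_sqr ?nnegrE ?normc_ge0// normc_sq real_normK ?num_real//.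
by rewrite lerDl sqr_ge0.
Qed.

Lemma normIm_le z : `|Im z| <= normc z.
Proof.
rewrite -ler_sqr ?nnegrE ?normc_ge0// normc_sq real_normK ?num_real//.
by rewrite lerDr sqr_ge0.
Qed.

Lemma normc_le_ReIm z : normc z <= `|Re z| + `|Im z|.
Proof.
rewrite -ler_sqr ?nnegrE ?normc_ge0 ?addr_ge0// normc_sq sqrrD.
rewrite !real_normK ?num_real// [leRHS]addrAC lerDl.
by rewrite mulrn_wge0// mulr_ge0.
Qed.

Lemma normcB_sq z w :
  normc (z - w) ^+ 2 = normc z ^+ 2 + normc w ^+ 2 - 2 * Re (z * w^*).
Proof.
rewrite !normc_sq ReDE ImDE ReNE ImNE ReME ReJE ImJE; ring.
Qed.

Lemma normc_expi t : normc (expi t) = 1.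
Proof. by rewrite /expi /= cos2Dsin2 sqrtr1. Qed.

Lemma expiD s t : expi (s + t) = expi s * expi t.
Proof.
by rewrite /expi; apply: complex_ext; rewrite ?ReME ?ImME /= ?cosD ?sinD//;
  rewrite addrC.
Qed.

Lemma expiN t : expi (- t) = (expi t)^*.
Proof. by rewrite /expi cosN sinN. Qed.

Lemma expi0 : expi 0 = 1.
Proof. by rewrite /expi cos0 sin0. Qed.

End ComplexModulus.

(** * Measurability and integration of complex functions *)

Section ComplexMeasurable.
Context d (T : measurableType d) {R : realType}.
Local Notation C := R[i].
Implicit Types (u v : T -> C) (f : T -> R).

Definition cmeas u : Prop :=
  measurable_fun setT (fun x => Re (u x)) /\
  measurable_fun setT (fun x => Im (u x)).

Lemma cmeas_cst (c : C) : cmeas (fun=> c).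
Proof. by split; exact: measurable_cst. Qed.

Lemma cmeas_real f : measurable_fun setT f -> cmeas (fun x => (f x)%:C).
Proof. by move=> mf; split => //; exact: measurable_cst. Qed.

Lemma cmeasD u v : cmeas u -> cmeas v -> cmeas (fun x => u x + v x).
Proof.
move=> [u1 u2] [v1 v2]; split.
  by under eq_fun do rewrite ReDE; exact: measurable_funD.
by under eq_fun do rewrite ImDE; exact: measurable_funD.
Qed.

Lemma cmeasN u : cmeas u -> cmeas (fun x => - u x).
Proof.
move=> [u1 u2]; split.
  by under eq_fun do rewrite ReNE; exact: measurableT_comp.
by under eq_fun do rewrite ImNE; exact: measurableT_comp.
Qed.

Lemma cmeasB u v : cmeas u -> cmeas v -> cmeas (fun x => u x - v x).
Proof. by move=> mu mv; apply: cmeasD => //; exact: cmeasN. Qed.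

Lemma cmeasM u v : cmeas u -> cmeas v -> cmeas (fun x => u x * v x).
Proof.
move=> [u1 u2] [v1 v2]; split.
  under eq_fun do rewrite ReME.
  by apply: measurable_funB; exact: measurable_funM.
under eq_fun do rewrite ImME.
by apply: measurable_funD; exact: measurable_funM.
Qed.

Lemma cmeasZ (c : C) u : cmeas u -> cmeas (fun x => c * u x).
Proof. by apply: cmeasM; exact: cmeas_cst. Qed.

Lemma cmeas_conj u : cmeas u -> cmeas (fun x => (u x)^*).
Proof.
move=> [u1 u2]; split.
  by under eq_fun do rewrite ReJE.
by under eq_fun do rewrite ImJE; exact: measurableT_comp.
Qed.

Lemma cmeas_expi f : measurable_fun setT f -> cmeas (fun x => expi (f x)).
Proof.
move=> mf; split; apply: (measurableT_comp _ mf);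
  apply: continuous_measurable_fun; [exact: continuous_cos|exact: continuous_sin].
Qed.

Lemma meas_normc u : cmeas u -> measurable_fun setT (fun x => normc (u x)).
Proof.
move=> [u1 u2]; under eq_fun do rewrite normc_sqrt.
apply: (@measurableT_comp _ _ _ _ _ _ (@Num.sqrt R)).
  by apply: continuous_measurable_fun; exact: sqrt_continuous.
by apply: measurable_funD; exact: measurable_funX.
Qed.

Lemma cmeas_if (A : set T) u v : measurable A -> cmeas u -> cmeas v ->
  cmeas (fun x => if x \in A then u x else v x).
Proof.
move=> mA [u1 u2] [v1 v2]; have mb : measurable_fun setT (fun x => x \in A).
  apply: (measurable_fun_bool true).
  rewrite setTI (_ : _ @^-1` _ = A)//; apply/seteqP; split => x /=.
    by move/set_mem.
  by move/mem_set.
split.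
  rewrite (_ : (fun x => _) =
    (fun x => if x \in A then Re (u x) else Re (v x))); last first.
    by apply/funext => x; case: ifP.
  exact: measurable_fun_ifT.
rewrite (_ : (fun x => _) =
  (fun x => if x \in A then Im (u x) else Im (v x))); last first.
  by apply/funext => x; case: ifP.
exact: measurable_fun_ifT.
Qed.

End ComplexMeasurable.

Lemma cmeas_comp d d' (T : measurableType d) (T' : measurableType d')
    (R : realType) (u : T -> R[i]) (phi : T' -> T) :
  measurable_fun setT phi -> cmeas u -> cmeas (fun x => u (phi x)).
Proof.
move=> mphi [u1 u2]; split.
  exact: (measurableT_comp u1).
exact: (measurableT_comp u2).
Qed.

Section ComplexIntegral.
Context {R : realType}.
Local Notation C := R[i].
Local Notation mu := (@lebesgue_measure R).
Local Notation Li f := (mu.-integrable setT (EFin \o f)).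
Implicit Types (f g : R -> R) (u v : R -> C).

Lemma ae_mono (P Q : R -> Prop) : {ae mu, forall x, P x} ->
  (forall x, P x -> Q x) -> {ae mu, forall x, Q x}.
Proof. by move=> aP PQ; exact: (filterS (F := almost_everywhere mu) PQ aP). Qed.

Lemma ae_and (P Q : R -> Prop) : {ae mu, forall x, P x} ->
  {ae mu, forall x, Q x} -> {ae mu, forall x, P x /\ Q x}.
Proof. by move=> aP aQ; exact: (filterI (F := almost_everywhere mu) aP aQ). Qed.

Lemma ae_all (P : R -> Prop) : (forall x, P x) -> {ae mu, forall x, P x}.
Proof. by move=> aP; apply: aeW. Qed.

Lemma Li_meas f : Li f -> measurable_fun setT f.
Proof. by case/integrableP => /measurable_EFinP. Qed.

Lemma Li_le f g : measurable_fun setT f -> Li g ->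
  (forall x, `|f x| <= g x) -> Li f.
Proof.
move=> mf ig fg; apply: le_integrable ig => //; first exact/measurable_EFinP.
move=> x _ /=; rewrite lee_fin.
by rewrite (le_trans (fg x))// ler_norm.
Qed.

Lemma LiD f g : Li f -> Li g -> Li (fun x => f x + g x).
Proof. by move=> fi gi; exact: (integrableD measurableT fi gi). Qed.

Lemma LiB f g : Li f -> Li g -> Li (fun x => f x - g x).
Proof. by move=> fi gi; exact: (integrableB measurableT fi gi). Qed.

Lemma LiZ (k : R) f : Li f -> Li (fun x => k * f x).
Proof. by move=> fi; exact: (integrableZl measurableT k fi). Qed.

Lemma Li_ae f g : measurable_fun setT g -> {ae mu, forall x, f x = g x} ->
  Li f -> Li g.
Proof.
move=> mg fg fi; apply/integrableP; split; first exact/measurable_EFinP.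
have /integrableP[mf] := fi.
congr (_ < _)%E; apply: ae_eq_integral => //.
- by apply: measurableT_comp.
- by apply: measurableT_comp => //; exact/measurable_EFinP.
- by apply: (ae_mono fg) => x /= ->.
Qed.

Lemma LiP f : measurable_fun setT f -> (forall x, 0 <= f x) ->
  (\int[mu]_x (f x)%:E < +oo)%E -> Li f.
Proof.
move=> mf f0 fy; apply/integrableP; split; first exact/measurable_EFinP.
by under eq_integral do rewrite /= ger0_norm//.
Qed.

Lemma Li_lty f : Li f -> (\int[mu]_x (`|f x|)%:E < +oo)%E.
Proof. by case/integrableP. Qed.

Lemma Rint_EFin f : Li f -> (\int[mu]_x f x)%:E = (\int[mu]_x (f x)%:E)%E.
Proof.
by move=> fi; rewrite /Rintegral fineK//; exact: (integrable_fin_num _ fi).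
Qed.

Lemma eqRint f g : (forall x, f x = g x) -> \int[mu]_x f x = \int[mu]_x g x.
Proof. by move=> fg; congr Rintegral; apply/funext. Qed.

Lemma ae_eq_Rint f g : measurable_fun setT f -> measurable_fun setT g ->
  {ae mu, forall x, f x = g x} -> \int[mu]_x f x = \int[mu]_x g x.
Proof.
move=> mf mg fg; congr fine; apply: ae_eq_integral => //.
- exact/measurable_EFinP.
- exact/measurable_EFinP.
- by apply: (ae_mono fg) => x ->.
Qed.

Lemma Rint_ge0 f : (forall x, 0 <= f x) -> 0 <= \int[mu]_x f x.
Proof. by move=> f0; exact: Rintegral_ge0. Qed.

Lemma le_Rint f g : Li f -> Li g -> (forall x, f x <= g x) ->
  \int[mu]_x f x <= \int[mu]_x g x.
Proof. by move=> fi gi fg; exact: le_Rintegral. Qed.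

Lemma Rint_eq0 f : Li f -> (forall x, 0 <= f x) -> \int[mu]_x f x = 0 ->
  {ae mu, forall x, f x = 0}.
Proof.
move=> fi f0 int0.
have mf : measurable_fun setT (EFin \o f) by apply/measurable_EFinP; exact: Li_meas fi.
have := (ae_eq_integral_abs mu measurableT mf).1.
have -> : (\int[mu]_x `|(EFin \o f) x| = 0)%E.
  under eq_integral do rewrite /= ger0_norm//.
  by rewrite -(Rint_EFin fi) int0.
move=> /(_ erefl) h.
by apply: (ae_mono h) => x /= /(_ I) [].
Qed.

Definition cintegrable u : Prop :=
  Li (fun x => Re (u x)) /\ Li (fun x => Im (u x)).

Definition cint u : C := cintegral setT u.

Lemma cintE u : cint u = (\int[mu]_x Re (u x)) +i* (\int[mu]_x Im (u x)).
Proof. by []. Qed.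

Lemma cintegrable_meas u : cintegrable u -> cmeas u.
Proof. by move=> [/Li_meas ? /Li_meas]. Qed.

Lemma cintegrable_normc u : cintegrable u -> Li (fun x => normc (u x)).
Proof.
move=> iu; have mu_ := cintegrable_meas iu; case: iu => i1 i2.
apply: (@Li_le _ (fun x => `|Re (u x)| + `|Im (u x)|)).
- exact: meas_normc.
- by apply: LiD; exact: integrable_norm.
- by move=> x; rewrite ger0_norm ?normc_ge0// normc_le_ReIm.
Qed.

Lemma cintegrable_le u g : cmeas u -> Li g -> (forall x, normc (u x) <= g x) ->
  cintegrable u.
Proof.
move=> [m1 m2] ig ug; split; apply: Li_le ig _ => // x;
  by apply: le_trans (ug x); rewrite ?normRe_le ?normIm_le.
Qed.

Lemma cintegrableP u : cmeas u -> Li (fun x => normc (u x)) -> cintegrable u.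
Proof. by move=> mu_ iu; exact: cintegrable_le iu _. Qed.

Lemma cintegrableD u v : cintegrable u -> cintegrable v ->
  cintegrable (fun x => u x + v x).
Proof.
move=> [u1 u2] [v1 v2]; split.
  by under [X in mu.-integrable _ (_ \o X)]eq_fun do rewrite ReDE; exact: LiD.
by under [X in mu.-integrable _ (_ \o X)]eq_fun do rewrite ImDE; exact: LiD.
Qed.

Lemma cintegrableZ (c : C) u : cintegrable u -> cintegrable (fun x => c * u x).
Proof.
move=> iu; apply: (@cintegrable_le _ (fun x => normc c * normc (u x))).
- by apply: cmeasZ; exact: cintegrable_meas.
- by apply: LiZ; exact: cintegrable_normc.
- by move=> x; rewrite normcM.
Qed.

Lemma cintegrableB u v : cintegrable u -> cintegrable v ->
  cintegrable (fun x => u x - v x).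
Proof.
move=> iu iv; apply: cintegrableD => //.
rewrite (_ : (fun x => - v x) = (fun x => (- 1) * v x)).
  exact: cintegrableZ.
by apply/funext => x; rewrite mulN1r.
Qed.

Lemma cintD u v : cintegrable u -> cintegrable v ->
  cint (fun x => u x + v x) = cint u + cint v.
Proof.
move=> [u1 u2] [v1 v2]; rewrite !cintE; apply: complex_ext => /=.
  by under eq_Rintegral do rewrite ReDE; rewrite RintegralD.
by under eq_Rintegral do rewrite ImDE; rewrite RintegralD.
Qed.

Lemma cintZ (c : C) u : cintegrable u ->
  cint (fun x => c * u x) = c * cint u.
Proof.
move=> [u1 u2]; rewrite !cintE; apply: complex_ext; rewrite ?ReME ?ImME/=.
  under eq_Rintegral do rewrite ReME.
  by rewrite RintegralB ?RintegralZl//; exact: LiZ.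
under eq_Rintegral do rewrite ImME.
by rewrite RintegralD ?RintegralZl//; exact: LiZ.
Qed.

Lemma cintN u : cintegrable u -> cint (fun x => - u x) = - cint u.
Proof.
move=> iu; rewrite -mulN1r -cintZ//; congr cint.
by apply/funext => x; rewrite mulN1r.
Qed.

Lemma cintB u v : cintegrable u -> cintegrable v ->
  cint (fun x => u x - v x) = cint u - cint v.
Proof.
move=> iu iv; rewrite -cintN// -cintD//.
rewrite (_ : (fun x => - v x) = (fun x => (- 1) * v x)).
  exact: cintegrableZ.
by apply/funext => x; rewrite mulN1r.
Qed.

(** Rotating the integrand by the conjugate of the integral makes the integral
    real, which reduces the bound to the real case. *)
Lemma le_normc_cint u : cintegrable u ->
  normc (cint u) <= \int[mu]_x normc (u x).
Proof.
move=> iu; have [->|z0] := eqVneq (normc (cint u)) 0.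
  by apply: Rint_ge0 => x; exact: normc_ge0.
set z := cint u; set r := normc z in z0 *.
have r0 : 0 < r by rewrite lt_neqAle eq_sym z0 normc_ge0.
have zz : Re (z^* * z) = r ^+ 2 by rewrite /r normc_sq ReME ReJE ImJE; ring.
rewrite -(ler_pM2l r0) -expr2 -zz -cintZ//.
have -> : Re (cint (fun x => z^* * u x)) = \int[mu]_x Re (z^* * u x) by [].
rewrite -RintegralZl//; last exact: cintegrable_normc.
apply: le_Rint.
- by case: (cintegrableZ z^* iu).
- by apply: LiZ; exact: cintegrable_normc.
- move=> x; apply: (le_trans (ler_norm _)).
  by rewrite (le_trans (normRe_le _))// normcM normc_conj.
Qed.

Lemma eq_cint u v : (forall x, u x = v x) -> cint u = cint v.
Proof. by move=> uv; congr cint; apply/funext. Qed.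

Lemma ae_eq_cint u v : cmeas u -> cmeas v -> {ae mu, forall x, u x = v x} ->
  cint u = cint v.
Proof.
move=> [u1 u2] [v1 v2] uv; rewrite !cintE; congr (_ +i* _);
  by apply: ae_eq_Rint => //; apply: (ae_mono uv) => x ->.
Qed.

Lemma dct0 (f_ : nat -> R -> R) g : (forall n, measurable_fun setT (f_ n)) ->
  Li g -> {ae mu, forall x, forall n, `|f_ n x| <= g x} ->
  {ae mu, forall x, f_ n x @[n --> \oo] --> (0 : R)} ->
  \int[mu]_x `|f_ n x| @[n --> \oo] --> (0 : R).
Proof.
move=> mf ig fg f0.
have [] := @dominated_convergence _ _ R mu setT measurableT
   (fun n => EFin \o f_ n) (cst 0%E) (EFin \o g) _ _ _ ig _.
- by move=> n; apply/measurable_EFinP; exact: mf.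
- exact: measurable_cst.
- apply: (ae_mono f0) => x fx _; apply/fine_cvgP; split; first exact: nearW.
  exact: fx.
- by apply: (ae_mono fg) => x fx n _ /=; rewrite lee_fin; exact: fx.
move=> _ h _.
rewrite (_ : (fun n => _) =
    (fun n => fine (\int[mu]_x `|(EFin \o f_ n) x - cst 0%E x|)%E)); last first.
  apply/funext => n; congr fine; apply: eq_integral => x _.
  by rewrite /= subr0.
exact: (fine_cvg h).
Qed.

End ComplexIntegral.

(** * Convergence of complex sequences *)

Section Sequences.
Context {R : realType}.
Local Notation C := R[i].
Implicit Types (a : nat -> R) (z : nat -> C).

Lemma homo_geq_id (k : nat -> nat) n : {homo k : m n / (m < n)%N} ->
  (n <= k n)%N.
Proof.
move=> hk; elim: n => // n IH; exact: leq_ltn_trans IH (hk _ _ (ltnSn n)).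
Qed.

Lemma cvg0P a : (forall n, 0 <= a n) ->
  (a n @[n --> \oo] --> (0 : R)) <->
  (forall e, 0 < e -> exists N, forall n, (N <= n)%N -> a n < e).
Proof.
move=> a0; split.
  move=> /cvgrPdist_lt h e e0; have [N _ hN] := h e e0.
  exists N => n Nn; have := hN n Nn.
  by rewrite /= sub0r normrN ger0_norm.
move=> h; apply/cvgrPdist_lt => e e0; have [N hN] := h e e0.
exists N => // n Nn /=; rewrite sub0r normrN ger0_norm//.
exact: hN.
Qed.

Lemma cvg_dist0 a (l : R) : (a n @[n --> \oo] --> l) <->
  (`|a n - l| @[n --> \oo] --> (0 : R)).
Proof.
split => /cvgrPdist_lt h; apply/cvgrPdist_lt => e /h [N _ hN]; exists N => // n
  /hN /=; first by rewrite sub0r normrN normr_id distrC.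
by rewrite sub0r normrN normr_id distrC.
Qed.

Lemma cvg0_le a (b : nat -> R) : (forall n, 0 <= a n) ->
  (forall n, a n <= b n) -> b n @[n --> \oo] --> (0 : R) ->
  a n @[n --> \oo] --> (0 : R).
Proof.
move=> a0 ab b0; apply: (@squeeze_cvgr _ _ _ _ (fun=> 0) b) => //.
  by apply: nearW => n; rewrite a0 ab.
exact: cvg_cst.
Qed.

Lemma cvg0D a (b : nat -> R) : a n @[n --> \oo] --> (0 : R) ->
  b n @[n --> \oo] --> (0 : R) -> a n + b n @[n --> \oo] --> (0 : R).
Proof. by move=> a0 b0; rewrite -[X in _ --> X](addr0 0); exact: cvgD. Qed.

Lemma cvg0Z (k : R) a : a n @[n --> \oo] --> (0 : R) ->
  k * a n @[n --> \oo] --> (0 : R).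
Proof. by move=> a0; rewrite -[X in _ --> X](mulr0 k); exact: cvgMr. Qed.

(** Convergence in C is expressed by the modulus, so that all estimates stay real. *)
Definition ccvg z (w : C) : Prop := normc (z n - w) @[n --> \oo] --> (0 : R).

Lemma ccvgP z w : ccvg z w <->
  (Re (z n) @[n --> \oo] --> Re w) /\ (Im (z n) @[n --> \oo] --> Im w).
Proof.
split.
  move=> zw; split; apply/cvgrPdist_le => e e0;
    have /cvgrPdist_le/(_ _ e0) [N _ hN] := zw; exists N => // n /hN /=;
    rewrite sub0r normrN ger0_norm ?normc_ge0// => h; apply: le_trans h;
    rewrite distrC.
  by rewrite -ReNE -ReDE normRe_le.
  by rewrite -ImNE -ImDE normIm_le.
move=> [h1 h2].
apply: (@cvg0_le _ (fun n => `|Re (z n) - Re w| + `|Im (z n) - Im w|)).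
- by move=> n; exact: normc_ge0.
- by move=> n; rewrite (le_trans (normc_le_ReIm _))// ReDE ReNE ImDE ImNE.
by apply: cvg0D; [exact: (cvg_dist0 _ _).1 h1|exact: (cvg_dist0 _ _).1 h2].
Qed.

Lemma ccvg_cst (w : C) : ccvg (fun=> w) w.
Proof. by rewrite /ccvg subrr normc0; exact: cvg_cst. Qed.

Lemma ccvgD z1 z2 w1 w2 : ccvg z1 w1 -> ccvg z2 w2 ->
  ccvg (fun n => z1 n + z2 n) (w1 + w2).
Proof.
move=> h1 h2; apply: (cvg0_le _ _ (cvg0D h1 h2)) => n; first exact: normc_ge0.
by apply: le_trans (normcD _ _); rewrite opprD addrACA.
Qed.

Lemma ccvgZ (c : C) z w : ccvg z w -> ccvg (fun n => c * z n) (c * w).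
Proof.
move=> h; apply: (cvg0_le _ _ (cvg0Z (normc c) h)) => n; first exact: normc_ge0.
by rewrite -mulrBr normcM.
Qed.

Lemma ccvg_unique z w1 w2 : ccvg z w1 -> ccvg z w2 -> w1 = w2.
Proof.
move=> /ccvgP[a1 b1] /ccvgP[a2 b2]; apply: complex_ext.
  exact: (cvg_unique _ a1 a2).
exact: (cvg_unique _ b1 b2).
Qed.

Lemma ccvg_sub (z : nat -> C) w (k : nat -> nat) :
  {homo k : m n / (m < n)%N} -> ccvg z w -> ccvg (fun n => z (k n)) w.
Proof.
move=> hk /(cvg0P (fun n => normc_ge0 _)) h.
apply/(cvg0P (fun n => normc_ge0 _)) => e /h [N hN]; exists N => n Nn.
by apply: hN; rewrite (leq_trans Nn)// homo_geq_id.
Qed.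

Lemma normc_ccvg z w : ccvg z w -> normc (z n) @[n --> \oo] --> normc w.
Proof.
move=> h; apply/cvg_dist0; apply: (cvg0_le _ _ h) => n //.
exact: normc_sub_dist.
Qed.

Definition ccauchy z : Prop := forall e : R, 0 < e ->
  exists N, forall m n, (N <= m)%N -> (N <= n)%N -> normc (z m - z n) < e.

Lemma cauchy_real_cvg a : (forall e : R, 0 < e -> exists N,
    forall m n, (N <= m)%N -> (N <= n)%N -> `|a m - a n| < e) ->
  cvgn a.
Proof.
move=> h; apply/cauchy_cvgP; apply: cauchy_exP => e e0.
have [N hN] := h e e0; exists (a N); exists N => // n Nn.
exact: hN.
Qed.

(** A total limit, measurable in parameters: unlike [lim] it is built from upper
    limits of the real and imaginary parts. *)
Definition clim z : C :=
  (fine (limn_esup (fun n => (Re (z n))%:E))) +i*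
  (fine (limn_esup (fun n => (Im (z n))%:E))).

Lemma fine_limsup a (l : R) : a n @[n --> \oo] --> l ->
  fine (limn_esup (fun n => (a n)%:E)) = l.
Proof.
move=> al; rewrite (@is_cvg_limn_esupE _ (fun n => (a n)%:E)); last first.
  by apply/cvg_ex; exists l%:E; apply/fine_cvgP; split => //; exact: nearW.
rewrite (_ : limn _ = l%:E)//; apply/cvg_lim => //.
by apply/fine_cvgP; split => //; exact: nearW.
Qed.

Lemma ccvg_clim z w : ccvg z w -> clim z = w.
Proof.
move=> /ccvgP[h1 h2]; rewrite /clim (fine_limsup h1) (fine_limsup h2).
by apply: complex_ext.
Qed.

Lemma ccauchy_cvg z : ccauchy z -> ccvg z (clim z).
Proof.
move=> hz.
have h1 : cvgn (fun n => Re (z n)).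
  apply: cauchy_real_cvg => e /hz [N hN]; exists N => m n Nm Nn.
  by apply: le_lt_trans (hN m n Nm Nn); rewrite -ReNE -ReDE normRe_le.
have h2 : cvgn (fun n => Im (z n)).
  apply: cauchy_real_cvg => e /hz [N hN]; exists N => m n Nm Nn.
  by apply: le_lt_trans (hN m n Nm Nn); rewrite -ImNE -ImDE normIm_le.
have h : ccvg z (limn (fun n => Re (z n)) +i* limn (fun n => Im (z n))).
  by apply/ccvgP.
by rewrite (ccvg_clim h).
Qed.

Lemma ccvg_cauchy z w : ccvg z w -> ccauchy z.
Proof.
move=> zw e e0; have e20 : 0 < e / 2 by rewrite divr_gt0.
have := (@cvg0P (fun n => normc (z n - w)) (fun n => normc_ge0 _)).1 zw _ e20.
move=> [N hN]; exists N => m n Nm Nn.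
rewrite (le_lt_trans (normc_triangle _ _ w))// [X in _ < X]splitr.
by rewrite ltrD ?hN// normcBC hN.
Qed.

(** The tails are controlled by the geometric series. *)
Lemma geo_cauchy (z : nat -> C) (B : R) :
  (forall k, normc (z k.+1 - z k) <= B * 2^-1 ^+ k) -> ccauchy z.
Proof.
move=> h.
have B0 : 0 <= B by have := le_trans (normc_ge0 _) (h 0%N); rewrite expr0 mulr1.
have key m n : normc (z (m + n)%N - z m) <= B * 2 * (2^-1 ^+ m - 2^-1 ^+ (m + n)).
  elim: n => [|n IH]; first by rewrite addn0 !subrr normc0 mulr0.
  apply: le_trans (normc_triangle _ _ (z (m + n)%N)) _.
  rewrite addnS; apply: le_trans (lerD (h _) IH) _.
  by rewrite exprS; lra.
have key2 m n : (m <= n)%N -> normc (z n - z m) <= B * 2 * 2^-1 ^+ m.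
  move=> mn; rewrite -(subnKC mn); apply: le_trans (key _ _) _.
  by rewrite ler_wpM2l ?mulr_ge0// gerBl exprn_ge0.
have c0 : B * 2 * 2 ^-1 ^+ n @[n --> \oo] --> (0 : R).
  by apply: cvg0Z; apply: cvg_expr; rewrite ger0_norm// invf_lt1// ltr1n.
move=> e e0; have e20 : 0 < e / 2 by rewrite divr_gt0.
have [|N hN] := (@cvg0P (fun n => B * 2 * 2 ^-1 ^+ n) _).1 c0 _ e20.
  by move=> n; rewrite !mulr_ge0// exprn_ge0.
exists N => m n Nm Nn.
rewrite (le_lt_trans (normc_triangle _ _ (z N)))// [X in _ < X]splitr.
rewrite ltrD//; first by rewrite (le_lt_trans (key2 _ _ Nm))// hN.
by rewrite normcBC (le_lt_trans (key2 _ _ Nn))// hN.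
Qed.

End Sequences.

(** * The space L2 *)

Section SquareIntegrable.
Context {R : realType}.
Local Notation C := R[i].
Local Notation mu := (@lebesgue_measure R).
Local Notation Li f := (mu.-integrable setT (EFin \o f)).
Implicit Types (f g : R -> R) (u v : R -> C).

(** The real-valued L2 norm; it agrees with [L2norm] on [L2] only. *)
Definition nr u : R := Num.sqrt (\int[mu]_x (normc (u x) ^+ 2)).

Lemma nr_ge0 u : 0 <= nr u.
Proof. exact: sqrtr_ge0. Qed.

Lemma nr_sq u : nr u ^+ 2 = \int[mu]_x (normc (u x) ^+ 2).
Proof. by rewrite sqr_sqrtr// Rint_ge0// => x; rewrite sqr_ge0. Qed.

Lemma Lnorm2 (f : R -> R) :
  Lnorm mu 2%:E (EFin \o f) = sqrte (\int[mu]_x (f x ^+ 2)%:E).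
Proof.
rewrite unlock poweR12_sqrt.
  congr sqrte; apply: eq_integral => x _.
  by rewrite /= powR_mulrn// real_normK ?num_real.
by apply: integral_ge0 => x _; exact: poweR_ge0.
Qed.

Lemma Li_sqE f : measurable_fun setT f ->
  Li (fun x => f x ^+ 2) <-> (Lnorm mu 2%:E (EFin \o f) < +oo)%E.
Proof.
move=> mf; rewrite Lnorm2; split.
  by move=> h; rewrite -(Rint_EFin h); exact: ltry.
move=> h; apply: LiP.
- exact: measurable_funX.
- by move=> x; exact: sqr_ge0.
- by rewrite ltey; apply/negP => /eqP E; move: h; rewrite E.
Qed.

Lemma Lfun2P f : f \in Lfun mu 2%:E <->
  measurable_fun setT f /\ Li (fun x => f x ^+ 2).
Proof.
split.
  rewrite inE => /andP[/[!inE]/= mf h]; split => //.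
  by apply/Li_sqE.
move=> [mf h]; rewrite inE; apply/andP; split; rewrite inE//=.
by apply/Li_sqE.
Qed.

(** Square integrability of the modulus replaces that of the two components. *)
Lemma L2P u : L2 u <-> cmeas u /\ Li (fun x => normc (u x) ^+ 2).
Proof.
split.
  move=> [/Lfun2P[m1 i1] /Lfun2P[m2 i2]]; split => //.
  by under [X in mu.-integrable _ (_ \o X)]eq_fun do rewrite normc_sq; exact: LiD.
move=> [mu_ iu]; have [m1 m2] := mu_.
split; apply/Lfun2P; split => //; apply: (Li_le _ iu).
- exact: measurable_funX.
- by move=> x; rewrite ger0_norm ?sqr_ge0// normc_sq lerDl sqr_ge0.
- exact: measurable_funX.
- by move=> x; rewrite ger0_norm ?sqr_ge0// normc_sq lerDr sqr_ge0.
Qed.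

Lemma L2_meas u : L2 u -> cmeas u.
Proof. by case/L2P. Qed.

Lemma L2_sq u : L2 u -> Li (fun x => normc (u x) ^+ 2).
Proof. by case/L2P. Qed.

Lemma L2normE u : L2 u -> L2norm u = (nr u)%:E.
Proof.
move=> /L2P[_ iu]; rewrite /L2norm (Lnorm2 (fun x => normc (u x))).
by rewrite -Rint_EFin.
Qed.

Lemma L2norm_lty u : cmeas u -> (L2norm u < +oo)%E -> L2 u.
Proof.
by move=> mu_ h; apply/L2P; split => //; apply/Li_sqE => //; exact: meas_normc.
Qed.

Lemma L2norm_cvg0 (u : nat -> R -> C) : (forall n, L2 (u n)) ->
  (L2norm (u n) @[n --> \oo] --> 0%E) <-> (nr (u n) @[n --> \oo] --> (0 : R)).
Proof.
move=> hu; rewrite (_ : (fun n => L2norm (u n)) = EFin \o (fun n => nr (u n))).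
  split; first by case/fine_cvgP.
  by move=> h; apply/fine_cvgP; split => //; exact: nearW.
by apply/funext => n; rewrite /= L2normE.
Qed.

Lemma L2_le u v : cmeas u -> L2 v -> (forall x, normc (u x) <= normc (v x)) ->
  L2 u.
Proof.
move=> mu_ /L2P[mv iv] uv; apply/L2P; split => //; apply: Li_le iv _.
  by apply: measurable_funX; exact: meas_normc.
move=> x; rewrite ger0_norm ?sqr_ge0// ler_sqr ?nnegrE ?normc_ge0//.
Qed.

Lemma nr_le u v : L2 u -> L2 v -> (forall x, normc (u x) <= normc (v x)) ->
  nr u <= nr v.
Proof.
move=> /L2P[mu_ iu] /L2P[mv iv] uv.
rewrite ler_wsqrtr// le_Rint// => x.
by rewrite ler_sqr ?nnegrE ?normc_ge0//.
Qed.

Lemma L2Z (c : C) u : L2 u -> L2 (fun x => c * u x).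
Proof.
move=> /L2P[mu_ iu]; apply/L2P; split; first exact: cmeasZ.
under [X in mu.-integrable _ (_ \o X)]eq_fun do rewrite normcM exprMn.
exact: LiZ.
Qed.

Lemma nrZ (c : C) u : L2 u -> nr (fun x => c * u x) = normc c * nr u.
Proof.
move=> /L2P[mu_ iu]; rewrite /nr.
under eq_Rintegral do rewrite normcM exprMn.
rewrite RintegralZl// sqrtrM ?sqr_ge0// sqrtr_sqr ger0_norm//.
exact: normc_ge0.
Qed.

Lemma L2M_bounded (K : R) (m u : R -> C) : cmeas m -> L2 u ->
  (forall x, normc (m x) <= K) -> L2 (fun x => m x * u x).
Proof.
move=> mm hu mK; have K0 : 0 <= K by apply: le_trans (mK 0); exact: normc_ge0.
apply: (L2_le _ (L2Z K%:C hu)).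
  by apply: cmeasM => //; exact: L2_meas.
move=> x; rewrite !normcM normc_real ger0_norm//.
by rewrite ler_wpM2r ?normc_ge0.
Qed.

Lemma nrM_bounded (K : R) (m u : R -> C) : cmeas m -> L2 u ->
  (forall x, normc (m x) <= K) -> nr (fun x => m x * u x) <= K * nr u.
Proof.
move=> mm hu mK; have K0 : 0 <= K by apply: le_trans (mK 0); exact: normc_ge0.
rewrite -[X in X * _](ger0_norm K0) -normc_real -nrZ//.
apply: nr_le.
- exact: L2M_bounded mK.
- exact: L2Z.
- move=> x; rewrite !normcM normc_real ger0_norm//.
  by rewrite ler_wpM2r ?normc_ge0.
Qed.

Lemma mul_le_sq (a b : R) : 0 <= a -> 0 <= b -> a * b <= a ^+ 2 + b ^+ 2.
Proof. by move=> a0 b0; have := sqr_ge0 (a - b); have := sqr_ge0 a; nra. Qed.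

Lemma L2_mul_Li u v : L2 u -> L2 v -> Li (fun x => normc (u x) * normc (v x)).
Proof.
move=> /L2P[mu_ iu] /L2P[mv iv]; apply: (Li_le _ (LiD iu iv)).
  by apply: measurable_funM; exact: meas_normc.
by move=> x; rewrite ger0_norm ?mulr_ge0 ?normc_ge0// mul_le_sq ?normc_ge0.
Qed.

(** The quadratic polynomial t |-> || |u| - t |v| ||^2 is nonnegative; the optimal
    t is <|u|, |v|> / ||v||^2, and for ||v|| = 0 positivity for all t forces
    <|u|, |v|> = 0. *)
Lemma cauchy_schwarz u v : L2 u -> L2 v ->
  \int[mu]_x (normc (u x) * normc (v x)) <= nr u * nr v.
Proof.
move=> hu hv; have iuv := L2_mul_Li hu hv.
have iu := L2_sq hu; have iv := L2_sq hv.
set c := \int[mu]_x _.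
have c0 : 0 <= c by apply: Rint_ge0 => x; rewrite mulr_ge0 ?normc_ge0.
have key t : 0 <= nr u ^+ 2 - 2 * t * c + t ^+ 2 * nr v ^+ 2.
  have -> : nr u ^+ 2 - 2 * t * c + t ^+ 2 * nr v ^+ 2 =
      \int[mu]_x ((normc (u x) - t * normc (v x)) ^+ 2).
    rewrite !nr_sq /c -RintegralZl// -RintegralZl//.
    rewrite -RintegralB//; last exact: LiZ.
    rewrite -RintegralD//; [|exact: (LiB iu (LiZ _ iuv))|exact: LiZ].
    by apply: eqRint => x; ring.
  by apply: Rint_ge0 => x; rewrite sqr_ge0.
have [nv0|nv0] := eqVneq (nr v) 0.
  rewrite nv0 mulr0; rewrite leNgt; apply/negP => cpos.
  (* The linear polynomial takes the value -1 at this t. *)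
have := key ((nr u ^+ 2 + 1) / (2 * c)).
  rewrite nv0 expr0n /= mulr0 addr0.
  rewrite (_ : 2 * _ * c = nr u ^+ 2 + 1); last by field; rewrite gt_eqF.
  by lra.
have nvp : 0 < nr v by rewrite lt_neqAle eq_sym nv0 nr_ge0.
have := key (c / nr v ^+ 2).
rewrite (_ : _ + _ = nr u ^+ 2 - (c / nr v) ^+ 2); last by field.
rewrite subr_ge0 ler_sqr ?nnegrE ?nr_ge0 ?divr_ge0 ?nr_ge0//.
by rewrite ler_pdivrMr.
Qed.

Lemma L2_cintegrable u v : L2 u -> L2 v -> cintegrable (fun x => u x * v x).
Proof.
move=> hu hv; apply: (@cintegrable_le _ _ (fun x => normc (u x) * normc (v x))).
- by apply: cmeasM; exact: L2_meas.
- exact: L2_mul_Li.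
- by move=> x; rewrite normcM.
Qed.

Lemma normc_cint_L2 u v : L2 u -> L2 v ->
  normc (cint (fun x => u x * v x)) <= nr u * nr v.
Proof.
move=> hu hv; apply: le_trans (le_normc_cint (L2_cintegrable hu hv)) _.
under eq_Rintegral do rewrite normcM.
exact: cauchy_schwarz.
Qed.

Lemma L2D u v : L2 u -> L2 v -> L2 (fun x => u x + v x).
Proof.
move=> hu hv; have /L2P[mu_ iu] := hu; have /L2P[mv iv] := hv.
apply/L2P; split; first exact: cmeasD.
apply: (Li_le _ (LiZ 2 (LiD iu iv))).
  by apply: measurable_funX; apply: meas_normc; exact: cmeasD.
move=> x; rewrite ger0_norm ?sqr_ge0//.
have := normcD (u x) (v x); have := normc_ge0 (u x + v x).
have := sqr_ge0 (normc (u x) - normc (v x)).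
by set a := normc (u x); set b := normc (v x); set c := normc _; nra.
Qed.

Lemma L2B u v : L2 u -> L2 v -> L2 (fun x => u x - v x).
Proof.
move=> hu hv; have := L2D hu (L2Z (- 1) hv).
by under eq_fun do rewrite mulN1r.
Qed.

Lemma nrD u v : L2 u -> L2 v -> nr (fun x => u x + v x) <= nr u + nr v.
Proof.
move=> hu hv.
rewrite -ler_sqr ?nnegrE ?addr_ge0 ?nr_ge0//.
have -> : (nr u + nr v) ^+ 2 = nr u ^+ 2 + 2 * (nr u * nr v) + nr v ^+ 2 by ring.
have iu := L2_sq hu; have iv := L2_sq hv; have iuv := L2_mul_Li hu hv.
apply: (@le_trans _ _ (\int[mu]_x (normc (u x) ^+ 2 +
    2 * (normc (u x) * normc (v x)) + normc (v x) ^+ 2))); last first.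
  rewrite RintegralD//; last exact: (LiD iu (LiZ 2 iuv)).
  rewrite RintegralD//; last exact: LiZ.
  rewrite -!nr_sq RintegralZl// lerD2r lerD2l ler_pM2l//.
  exact: cauchy_schwarz.
rewrite nr_sq; apply: le_Rint.
- by apply: L2_sq; exact: L2D.
- exact: (LiD (LiD iu (LiZ 2 iuv)) iv).
move=> x; have := normcD (u x) (v x); have := normc_ge0 (u x + v x).
by set a := normc (u x); set b := normc (v x); set c := normc _; nra.
Qed.

Lemma nrN u : nr (fun x => - u x) = nr u.
Proof. by congr Num.sqrt; apply: eqRint => x; rewrite normcN. Qed.

Lemma L2N u : L2 u -> L2 (fun x => - u x).
Proof.
move=> hu; have := L2Z (- 1) hu.
by under eq_fun do rewrite mulN1r.
Qed.

Lemma nrB u v : L2 u -> L2 v -> nr (fun x => u x - v x) <= nr u + nr v.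
Proof. by move=> hu hv; rewrite -(nrN v); apply: nrD => //; exact: L2N. Qed.

Lemma nr_subC u v : nr (fun x => u x - v x) = nr (fun x => v x - u x).
Proof. by congr Num.sqrt; apply: eqRint => x; rewrite normcBC. Qed.

Lemma nr_triangle u v w : L2 u -> L2 v -> L2 w ->
  nr (fun x => u x - w x) <= nr (fun x => u x - v x) + nr (fun x => v x - w x).
Proof.
move=> hu hv hw; have := nrD (L2B hu hv) (L2B hv hw).
by under eq_fun do rewrite addrA subrK.
Qed.

Lemma nr_sub_dist u v : L2 u -> L2 v ->
  `|nr u - nr v| <= nr (fun x => u x - v x).
Proof.
move=> hu hv; rewrite ler_norml; apply/andP; split.
  rewrite lerNl opprB lerBlDr nr_subC.
  have := nrD (L2B hv hu) hu.
  by under eq_fun do rewrite subrK.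
rewrite lerBlDr; have := nrD (L2B hu hv) hv.
by under eq_fun do rewrite subrK.
Qed.

Lemma nr_ae u v : cmeas u -> cmeas v -> {ae mu, forall x, u x = v x} ->
  nr u = nr v.
Proof.
move=> m1 m2 uv; congr Num.sqrt; apply: ae_eq_Rint.
- by apply: measurable_funX; exact: meas_normc.
- by apply: measurable_funX; exact: meas_normc.
- by apply: (ae_mono uv) => x ->.
Qed.

Lemma L2_ae u v : cmeas v -> L2 u -> {ae mu, forall x, u x = v x} -> L2 v.
Proof.
move=> mv /L2P[mu_ iu] uv; apply/L2P; split => //.
apply: Li_ae iu; first by apply: measurable_funX; exact: meas_normc.
by apply: (ae_mono uv) => x ->.
Qed.

Lemma nr_eq0 u : L2 u -> nr u = 0 -> {ae mu, forall x, u x = 0}.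
Proof.
move=> /L2P[mu_ iu] h.
have := Rint_eq0 iu (fun x => sqr_ge0 _); rewrite -nr_sq h expr0n/=.
move=> /(_ erefl) {}h; apply: (ae_mono h) => x /eqP.
by rewrite sqrf_eq0 => /eqP /normc_eq0.
Qed.

Lemma L2_0 : L2 (fun=> 0 : C).
Proof.
apply/L2P; split; first exact: cmeas_cst.
rewrite (_ : _ \o _ = cst 0%E); first exact: integrable0.
by apply/funext => x; rewrite /comp normc0 expr0n.
Qed.

(** A series of nonnegative functions whose integrals are summable has a finite
    sum almost everywhere, which bounds every term. *)
Lemma ae_bounded_series (k : nat -> R -> R) (B : R) :
  (forall n, measurable_fun setT (k n)) -> (forall n x, 0 <= k n x) ->
  (forall n, (\int[mu]_x (k n x)%:E <= (B * 2^-1 ^+ n)%:E)%E) ->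
  {ae mu, forall x, exists M, forall n, k n x <= M}.
Proof.
move=> mk k0 kB.
have B0 : 0 <= B.
  have := kB 0%N; rewrite expr0 mulr1 => /(le_trans _).
  by rewrite -lee_fin; apply; apply: integral_ge0 => x _; rewrite lee_fin.
pose S x := (\sum_(n <oo) (k n x)%:E)%E.
have mS : measurable_fun setT S.
  apply: ge0_emeasurable_sum => [n x _ _|n _]; first by rewrite lee_fin.
  apply/measurable_EFinP; exact: mk.
have iS : mu.-integrable setT S.
  apply/integrableP; split => //.
  have S0 x : (0 <= S x)%E by apply: nneseries_ge0 => n _ _; rewrite lee_fin.
  have -> : (\int[mu]_x `|S x| = \int[mu]_x S x)%E.
    by apply: eq_integral => x _; rewrite gee0_abs.
  rewrite integral_nneseries//; last 2 first.
    by move=> n; apply/measurable_EFinP; exact: mk.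
    by move=> n x _; rewrite lee_fin.
  apply: (@le_lt_trans _ _ (\sum_(n <oo) (B * 2^-1 ^+ n)%:E)%E).
    by apply: lee_nneseries => // n _ _; apply: integral_ge0 => x _; rewrite lee_fin.
  apply: (@le_lt_trans _ _ (B * 2)%:E); last by rewrite ltry.
  apply: lime_le.
    by apply: is_cvg_nneseries => n _ _; rewrite lee_fin mulr_ge0// exprn_ge0.
  apply: nearW => n; rewrite sumEFin lee_fin.
  rewrite (_ : \sum_(_ <= _ < _) _ = B * 2 * (1 - 2^-1 ^+ n)).
    by rewrite ler_piMr ?mulr_ge0// gerBl exprn_ge0.
  elim: n => [|n IH]; first by rewrite big_geq// subrr mulr0.
  by rewrite big_nat_recr//= IH exprS; lra.
have h := integrable_ae measurableT iS; apply: (ae_mono h) => x /(_ I) fS.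
exists (fine (S x)) => n; rewrite -lee_fin fineK//.
have : (\sum_(0 <= i < n.+1) (k i x)%:E <= S x)%E.
  by apply: nneseries_lim_ge => i _ _; rewrite lee_fin.
apply: le_trans; rewrite big_nat_recr//= leeDr//.
by apply: sume_ge0 => i _; rewrite lee_fin.
Qed.

End SquareIntegrable.

(** * Mean convergence against almost everywhere convergence *)

Section MeanConvergence.
Context {R : realType}.
Local Notation C := R[i].
Local Notation mu := (@lebesgue_measure R).
Local Notation Li f := (mu.-integrable setT (EFin \o f)).
Implicit Types (f g : R -> R) (u v : R -> C).

Lemma Li_le_ae f g : measurable_fun setT f -> Li g ->
  {ae mu, forall x, `|f x| <= g x} -> Li f.
Proof.
move=> mf ig fg; apply/integrableP; split; first exact/measurable_EFinP.
have ig' := integrable_norm ig.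
apply: (@le_lt_trans _ _ (\int[mu]_x `|g x|%:E)%E); last exact: Li_lty ig.
apply: ae_ge0_le_integral => //.
- by apply: measurableT_comp => //; apply/measurable_EFinP.
- by apply/measurable_EFinP; exact: (Li_meas ig').
- by apply: (ae_mono fg) => x h _; rewrite /= lee_fin (le_trans h)// ler_norm.
Qed.

Lemma le_Rint_ae f g : Li f -> Li g -> (forall x, 0 <= f x) ->
  {ae mu, forall x, f x <= g x} -> \int[mu]_x f x <= \int[mu]_x g x.
Proof.
move=> fi gi f0 fg.
have gn := integrable_norm gi.
have -> : \int[mu]_x g x = \int[mu]_x `|g x|.
  apply: ae_eq_Rint.
  - exact: Li_meas gi.
  - exact: (Li_meas gn).
  - by apply: (ae_mono fg) => x h; rewrite ger0_norm// (le_trans _ h).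
rewrite -lee_fin !Rint_EFin//; apply: ae_ge0_le_integral => //.
- by move=> x _; rewrite lee_fin.
- by apply/measurable_EFinP; exact: Li_meas fi.
- by apply/measurable_EFinP; exact: (Li_meas gn).
- by apply: (ae_mono fg) => x h _; rewrite lee_fin (le_trans h)// ler_norm.
Qed.

(** Functions whose norms decrease like 4^-n decrease pointwise like 2^-n almost
    everywhere: apply the bounded series argument to 4^n |d_n|^2. *)
Lemma ae_geo (d : nat -> R -> C) : (forall n, L2 (d n)) ->
  (forall n, nr (d n) <= 4^-1 ^+ n) ->
  {ae mu, forall x, exists M, forall n, normc (d n x) <= M * 2^-1 ^+ n}.
Proof.
move=> hd dB; pose k n x := 4 ^+ n * normc (d n x) ^+ 2.
have ik n : Li (k n) by apply: LiZ; exact: L2_sq.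
have k0 n x : 0 <= k n x by rewrite mulr_ge0 ?sqr_ge0 ?exprn_ge0.
have := @ae_bounded_series _ k 1 (fun n => Li_meas (ik n)) k0.
move=> h; apply: (ae_mono (h _)) => [n|x [M hM]].
  rewrite -Rint_EFin// lee_fin mul1r RintegralZl//; last exact: L2_sq.
  rewrite -nr_sq; apply: (@le_trans _ _ (4 ^+ n * (4^-1 ^+ n) ^+ 2)).
    by rewrite ler_pM2l ?exprn_gt0// ler_sqr ?nnegrE ?nr_ge0 ?exprn_ge0.
  rewrite expr2 mulrA -exprMn divff// expr1n mul1r.
  by apply: lerXn2r; rewrite ?nnegrE// lef_pV2 ?posrE// ler_nat.
have M0 : 0 <= M by apply: le_trans (hM 0%N).
exists (Num.sqrt M) => n.
rewrite -ler_sqr ?nnegrE ?normc_ge0 ?mulr_ge0 ?exprn_ge0 ?sqrtr_ge0//.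
have E : (2^-1 ^+ n) ^+ 2 = (4 ^+ n)^-1 :> R.
  by rewrite exprAC expr2 -invfM -natrM exprVn.
by rewrite exprMn sqr_sqrtr// E ler_pdivlMr ?exprn_gt0// mulrC; exact: hM.
Qed.

(** Convergence to 0 in the mean forces the lower limit to vanish almost
    everywhere; this replaces the extraction of a subsequence. *)
Lemma ae_liminf0 (k : nat -> R -> R) : (forall n, Li (k n)) ->
  (forall n x, 0 <= k n x) -> \int[mu]_x k n x @[n --> \oo] --> (0 : R) ->
  {ae mu, forall x, forall (e : R) (N : nat), 0 < e ->
    exists2 n, (N <= n)%N & k n x < e}.
Proof.
move=> ik k0 /(cvg0P (fun n => Rint_ge0 (k0 n))) h.
(* 2^j times a term of integral at most 4^-j has summable integrals. *)
have {}h j : exists n, (j <= n)%N /\ \int[mu]_x k n x < 4^-1 ^+ j.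
  have [|N hN] := h (4^-1 ^+ j); first by rewrite exprn_gt0.
  by exists (maxn N j); rewrite leq_maxr hN// leq_maxl.
have [n_ hn] := choice h.
pose k' j x := 2 ^+ j * k (n_ j) x.
have ik' j : Li (k' j) by apply: LiZ.
have k'0 j x : 0 <= k' j x by rewrite mulr_ge0// exprn_ge0.
have := @ae_bounded_series _ k' 1 (fun n => Li_meas (ik' n)) k'0.
move=> H; apply: (ae_mono (H _)) => [j|x [M hM] e N' e0].
  rewrite -Rint_EFin// lee_fin mul1r RintegralZl//.
  apply: (@le_trans _ _ (2 ^+ j * 4^-1 ^+ j)).
    by rewrite ler_pM2l ?exprn_gt0// ltW// (hn j).2.
  rewrite -exprMn (_ : 2 / 4 = 2^-1 :> R)//; by field.
have M0 : 0 <= M by apply: le_trans (hM 0%N).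
have c0 : M * 2 ^-1 ^+ n @[n --> \oo] --> (0 : R).
  by apply: cvg0Z; apply: cvg_expr; rewrite ger0_norm// invf_lt1// ltr1n.
have [|N hN] := (@cvg0P _ (fun n => M * 2 ^-1 ^+ n) _).1 c0 _ e0.
  by move=> n; rewrite mulr_ge0// exprn_ge0.
exists (n_ (maxn N N')).
  by apply: leq_trans (hn _).1; rewrite leq_maxr.
apply: le_lt_trans (hN (maxn N N') (leq_maxl _ _)).
by rewrite exprVn ler_pdivlMr ?exprn_gt0// mulrC; exact: hM.
Qed.

Lemma cmeas_clim (u : nat -> R -> C) : (forall n, cmeas (u n)) ->
  cmeas (fun x => clim (fun n => u n x)).
Proof.
move=> hu; split.
  apply: (@measurableT_comp _ _ _ _ _ _ (@fine R)); first exact: fine_measurable.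
  apply: measurable_fun_limn_esup => n; apply/measurable_EFinP.
  by case: (hu n).
apply: (@measurableT_comp _ _ _ _ _ _ (@fine R)); first exact: fine_measurable.
apply: measurable_fun_limn_esup => n; apply/measurable_EFinP.
by case: (hu n).
Qed.

Lemma measurable_limn_einf (k : nat -> R -> \bar R) :
  (forall n, measurable_fun setT (k n)) ->
  measurable_fun setT (fun x => limn_einf (fun n => k n x)).
Proof.
move=> mk; apply: (emeasurable_fun_cvg (fun n x => einfs (fun m => k m x) n)).
  by move=> n; exact: measurable_fun_einfs.
by move=> x _; rewrite limn_einf_lim; exact: is_cvg_einfs.
Qed.

(** Lower semicontinuity of the norm under almost everywhere convergence. *)
Lemma fatou_L2 (u : nat -> R -> C) v (M : R) : (forall n, L2 (u n)) -> cmeas v ->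
  {ae mu, forall x, ccvg (fun n => u n x) (v x)} -> (forall n, nr (u n) <= M) ->
  L2 v /\ nr v <= M.
Proof.
move=> hu mv uv uM.
have M0 : 0 <= M by apply: le_trans (uM 0%N); exact: nr_ge0.
have mu2 n : measurable_fun setT (fun x => (normc (u n x) ^+ 2)%:E).
  by apply/measurable_EFinP; apply: measurable_funX; exact/meas_normc/L2_meas.
have mv2 : measurable_fun setT (fun x => normc (v x) ^+ 2).
  by apply: measurable_funX; exact/meas_normc.
have fat := @fatou _ _ _ mu setT measurableT
  (fun n x => (normc (u n x) ^+ 2)%:E) mu2 (fun n x _ => sqr_ge0 _).
have le1 : (\int[mu]_x (normc (v x) ^+ 2)%:E <= (M ^+ 2)%:E)%E.
  apply: (@le_trans _ _ (limn_einf
      (fun n => \int[mu]_x (normc (u n x) ^+ 2)%:E)%E)).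
    apply: le_trans fat; apply: ae_ge0_le_integral => //.
    - by move=> x _; rewrite lee_fin sqr_ge0.
    - exact/measurable_EFinP.
    - move=> x _; rewrite limn_einf_lim; apply: lime_ge; first exact: is_cvg_einfs.
      apply: nearW => n; apply: le_ereal_inf_tmp => _ [m _ <-].
      by rewrite lee_fin sqr_ge0.
    - exact: measurable_limn_einf.
    - apply: (ae_mono uv) => x /normc_ccvg h _.
      have h2 : (normc (u n x) ^+ 2)%:E @[n --> \oo] --> (normc (v x) ^+ 2)%:E.
        apply/fine_cvgP; split; first exact: nearW.
        exact: cvgM.
      rewrite is_cvg_limn_einfE; last by apply/cvg_ex; eexists; exact: h2.
      by rewrite (cvg_lim _ h2).
  rewrite limn_einf_lim; apply: lime_le; first exact: is_cvg_einfs.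
  apply: nearW => n; apply: (@le_trans _ _
      (\int[mu]_x (normc (u n x) ^+ 2)%:E)%E).
    by apply: ereal_inf_lbound; exists n => //=.
  rewrite -Rint_EFin; last exact: L2_sq.
  by rewrite lee_fin -nr_sq ler_sqr ?nnegrE ?nr_ge0.
have iv : Li (fun x => normc (v x) ^+ 2).
  apply: LiP => //; first by move=> x; exact: sqr_ge0.
  by apply: le_lt_trans le1 _; rewrite ltry.
split; first exact/L2P.
rewrite -ler_sqr ?nnegrE ?nr_ge0// nr_sq -lee_fin Rint_EFin//.
Qed.

(** The Riesz-Fischer argument: a rapidly converging subsequence converges almost
    everywhere, and Fatou's lemma transfers the Cauchy estimate to the limit. *)
Lemma L2_complete (u : nat -> R -> C) : (forall n, L2 (u n)) ->
  (forall e : R, 0 < e -> exists N, forall m n, (N <= m)%N -> (N <= n)%N ->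
     nr (fun x => u m x - u n x) < e) ->
  exists2 v, L2 v & nr (fun x => u n x - v x) @[n --> \oo] --> (0 : R).
Proof.
move=> hu hc.
have h j : exists N, forall m n, (N <= m)%N -> (N <= n)%N ->
    nr (fun x => u m x - u n x) < 4^-1 ^+ j by apply: hc; rewrite exprn_gt0.
have [N_ hN] := choice h.
(* Summing makes the indices increase with k. *)
pose idx k := (\sum_(i < k.+1) N_ i)%N.
have idxN k : (N_ k <= idx k)%N by rewrite /idx big_ord_recr leq_addl.
have idxS k : (idx k <= idx k.+1)%N.
  by rewrite /idx [leqRHS]big_ord_recr leq_addr.
have idxm k j : (k <= j)%N -> (N_ k <= idx j)%N.
  move=> kj; apply: leq_trans (idxN k) _; rewrite -(subnKC kj).
  elim: (j - k)%N => [|n IH]; first by rewrite addn0.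
  by rewrite addnS; exact: leq_trans IH (idxS _).
pose w k := u (idx k).
pose v x := clim (fun k => w k x).
have mv : cmeas v by apply: cmeas_clim => k; exact/L2_meas/hu.
have wv : {ae mu, forall x, ccvg (fun k => w k x) (v x)}.
  have hg := @ae_geo (fun k x => w k.+1 x - w k x) (fun k => L2B (hu _) (hu _)).
  apply: (ae_mono (hg _)) => [k|x [M hM]].
    by rewrite ltW// hN// idxm.
  by apply: ccauchy_cvg; apply: geo_cauchy hM.
have key k n : (N_ k <= n)%N -> L2 (fun x => v x - u n x) /\
    nr (fun x => v x - u n x) <= 4^-1 ^+ k.
  move=> kn; apply: (@fatou_L2 (fun j x => w (j + k)%N x - u n x)).
  - by move=> j; apply: L2B; exact: hu.
  - by apply: cmeasB => //; exact/L2_meas/hu.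
  - apply: (ae_mono wv) => x h1; apply: ccvgD; last exact: ccvg_cst.
    apply: (@ccvg_sub _ (fun j => w j x) _ (fun j => (j + k)%N)) => //.
    by move=> a b; rewrite ltn_add2r.
  - by move=> j; rewrite ltW// hN// idxm// leq_addl.
have L2v : L2 v.
  have [+ _] := key 0%N _ (leqnn _) => /L2D /(_ (hu (N_ 0%N))).
  by under eq_fun do rewrite subrK.
exists v => //; apply/(cvg0P (fun n => nr_ge0 _)) => e e0.
have c0 : 4^-1 ^+ n @[n --> \oo] --> (0 : R).
  by apply: cvg_expr; rewrite ger0_norm// invf_lt1// ltr1n.
have [|K hK] := (@cvg0P _ (fun n => 4^-1 ^+ n) _).1 c0 _ e0.
  by move=> n; rewrite exprn_ge0.
exists (N_ K) => n Kn; rewrite nr_subC.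
by apply: le_lt_trans (key K n Kn).2 (hK K (leqnn K)).
Qed.

Lemma nr_sq_cvg0 (u : nat -> R -> C) :
  \int[mu]_x (normc (u n x) ^+ 2) @[n --> \oo] --> (0 : R) ->
  nr (u n) @[n --> \oo] --> (0 : R).
Proof.
move=> h; have := cvg_comp _ (@Num.sqrt R) h (@sqrt_continuous R 0).
by rewrite sqrtr0.
Qed.

Lemma nr_cvg0_sq (u : nat -> R -> C) : nr (u n) @[n --> \oo] --> (0 : R) ->
  \int[mu]_x (normc (u n x) ^+ 2) @[n --> \oo] --> (0 : R).
Proof.
move=> h; have := cvgM h h; rewrite mulr0.
rewrite (_ : (fun n => \int[mu]_x (normc (u n x) ^+ 2)) = (fun n => nr (u n) * nr (u n)));
  last by apply/funext => n; rewrite -nr_sq.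
exact.
Qed.

Lemma L2_dct0 (u : nat -> R -> C) (g : R -> R) : (forall n, cmeas (u n)) ->
  Li (fun x => g x ^+ 2) -> {ae mu, forall x, forall n, normc (u n x) <= g x} ->
  {ae mu, forall x, ccvg (fun n => u n x) 0} ->
  nr (u n) @[n --> \oo] --> (0 : R).
Proof.
move=> hu ig ug u0; apply: nr_sq_cvg0.
have := @dct0 _ (fun n x => normc (u n x) ^+ 2) (fun x => g x ^+ 2) _ ig.
rewrite (_ : (fun n => \int[mu]_x `|normc (u n x) ^+ 2|) =
             (fun n => \int[mu]_x (normc (u n x) ^+ 2))); last first.
  by apply/funext => n; apply: eqRint => x; rewrite ger0_norm ?sqr_ge0.
apply.
- by move=> n; apply: measurable_funX; exact: meas_normc.
- apply: (ae_mono ug) => x h n; rewrite ger0_norm ?sqr_ge0//.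
  have g0 : 0 <= g x by apply: le_trans (h n); exact: normc_ge0.
  by rewrite ler_sqr ?nnegrE ?normc_ge0.
- apply: (ae_mono u0) => x /normc_ccvg h; have := cvgM h h.
  by rewrite normc0 mulr0; exact.
Qed.

Lemma L2_le_ae u (g : R -> R) : cmeas u -> Li (fun x => g x ^+ 2) ->
  {ae mu, forall x, normc (u x) <= g x} ->
  L2 u /\ nr u <= Num.sqrt (\int[mu]_x (g x ^+ 2)).
Proof.
move=> hu ig ug.
have h : {ae mu, forall x, normc (u x) ^+ 2 <= g x ^+ 2}.
  apply: (ae_mono ug) => x h.
  have g0 : 0 <= g x by apply: le_trans h; exact: normc_ge0.
  by rewrite ler_sqr ?nnegrE ?normc_ge0.
have iu : Li (fun x => normc (u x) ^+ 2).
  apply: (Li_le_ae _ ig); first by apply: measurable_funX; exact: meas_normc.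
  by apply: (ae_mono h) => x; rewrite ger0_norm ?sqr_ge0.
split; first exact/L2P.
by rewrite ler_wsqrtr// le_Rint_ae// => x; exact: sqr_ge0.
Qed.

Lemma L2_dct (u : nat -> R -> C) (g : R -> R) : (forall n, cmeas (u n)) ->
  Li (fun x => g x ^+ 2) -> {ae mu, forall x, forall n, normc (u n x) <= g x} ->
  {ae mu, forall x, ccauchy (fun n => u n x)} ->
  exists2 v, L2 v & nr (fun x => u n x - v x) @[n --> \oo] --> (0 : R).
Proof.
move=> mu_ ig ug uc.
have hu n : L2 (u n).
  by apply: (L2_le_ae (mu_ n) ig _).1; apply: (ae_mono ug) => x.
pose v x := clim (fun n => u n x).
have mv : cmeas v by exact: cmeas_clim.
have uv : {ae mu, forall x, ccvg (fun n => u n x) (v x)}.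
  by apply: (ae_mono uc) => x; exact: ccauchy_cvg.
have vg : {ae mu, forall x, normc (v x) <= g x}.
  apply: (ae_mono (ae_and ug uv)) => x [h1 /normc_ccvg h2].
  rewrite -(cvg_lim (@Rhausdorff R) h2); apply: limr_le.
    by apply/cvg_ex; eexists; exact: h2.
  by apply: nearW => n; exact: h1.
exists v; first exact: (L2_le_ae mv ig vg).1.
apply: (@L2_dct0 _ (fun x => 2 * g x)).
- by move=> n; exact: cmeasB.
- by under [X in mu.-integrable _ (_ \o X)]eq_fun do rewrite exprMn; exact: LiZ.
- apply: (ae_mono (ae_and ug vg)) => x [h1 h2] n.
  by rewrite (le_trans (normcD _ _))// normcN mulrDl mul1r lerD.
- apply: (ae_mono uv) => x h; rewrite -(subrr (v x)).
  by apply: ccvgD => //; exact: ccvg_cst.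
Qed.

(** Mean convergence and pointwise convergence have the same limit, because the
    lower limit of |u_n - v|^2 is 0 almost everywhere. *)
Lemma L2_lim_ae (u : nat -> R -> C) v (w : R -> C) : (forall n, L2 (u n)) ->
  L2 v -> nr (fun x => u n x - v x) @[n --> \oo] --> (0 : R) ->
  {ae mu, forall x, ccvg (fun n => u n x) (w x)} ->
  {ae mu, forall x, v x = w x}.
Proof.
move=> hu hv uv uw.
have h := @ae_liminf0 (fun n x => normc (u n x - v x) ^+ 2)
  (fun n => L2_sq (L2B (hu n) hv)) (fun n x => sqr_ge0 _) (nr_cvg0_sq uv).
apply: (ae_mono (ae_and h uw)) => x [h1 /(cvg0P (fun n => normc_ge0 _)) h2].
apply/eqP; rewrite -subr_eq0; apply/eqP/normc_eq0/eqP.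
rewrite eq_le normc_ge0 andbT; apply/ler_addgt0Pl => e e0; rewrite addr0.
have e20 : 0 < e / 2 by rewrite divr_gt0.
have [N hN] := h2 _ e20.
have [n Nn] := h1 ((e / 2) ^+ 2) N (exprn_gt0 _ e20).
rewrite ltr_sqr ?nnegrE ?normc_ge0 ?(ltW e20)// => h3.
rewrite (le_trans (normc_triangle _ _ (u n x)))// [X in _ <= X]splitr.
by rewrite lerD// ltW//; [rewrite normcBC|exact: hN].
Qed.

End MeanConvergence.

(** * Affine changes of variable *)

Section ChangeOfVariable.
Context {R : realType}.
Local Notation C := R[i].
Local Notation mu := (@lebesgue_measure R).
Local Notation Li f := (mu.-integrable setT (EFin \o f)).
Implicit Types (f g : R -> R) (u v : R -> C).

Lemma meas_affine (a b : R) : measurable_fun setT (fun x : R => a * x + b).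
Proof.
apply: continuous_measurable_fun => x.
by apply: cvgD; [apply: cvgM => //; exact: cvg_cst|exact: cvg_cst].
Qed.

(** If the image of Lebesgue measure under phi is a multiple of Lebesgue measure
    on half-open intervals, then it is so on all Borel sets. *)
Lemma ge0_integral_image (phi : R -> R) (k : {nonneg R}) (f : R -> \bar R) :
  measurable_fun setT phi ->
  (forall c d : R, (mu `]c, d] = k%:num%:E * mu (phi @^-1` `]c, d]))%E) ->
  measurable_fun setT f -> (forall x, (0 <= f x)%E) ->
  (\int[mu]_x f x = k%:num%:E * \int[mu]_x f (phi x))%E.
Proof.
move=> mphi hphi mf f0.
have [pm pmE] : exists m : {measure set (measurableTypeR R) -> \bar R},
    forall A, m A = pushforward mu (phi : measurableTypeR R -> measurableTypeR R) A.
  unshelve refine (ex_intro _ (pushforward mu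
    (phi : measurableTypeR R -> measurableTypeR R) :
    {measure set (measurableTypeR R) -> \bar R}) _) => //.
have E A : measurable A -> mu A = mscale k pm A.
  move=> mA.
  apply: (@lebesgue_measure_unique R (mscale k pm) _ A mA).
  move=> _ [[c d]] _ <-; apply: etrans (hphi c d) _.
  exact: (congr1 (fun z => (k%:num%:E * z)%E) (esym (pmE _))).
transitivity (\int[mscale k pm]_x f x)%E.
  by apply: eq_measure_integral => A mA _; exact: E.
rewrite ge0_integral_mscale//; congr (_ * _)%E.
transitivity (\int[pushforward mu
    (phi : measurableTypeR R -> measurableTypeR R)]_x f x)%E.
  by apply: eq_measure_integral => A mA _; exact: pmE.
by rewrite ge0_integral_pushforward.
Qed.

Lemma ge0_integral_affine (a b : R) (f : R -> \bar R) : 0 < a ->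
  measurable_fun setT f -> (forall x, (0 <= f x)%E) ->
  (\int[mu]_x f x = a%:E * \int[mu]_x f (a * x + b)%R)%E.
Proof.
move=> a0 mf f0.
rewrite (@ge0_integral_image (fun x => a * x + b) (NngNum (ltW a0)))//.
  exact: meas_affine.
move=> c d; rewrite /=.
have -> : (fun x => a * x + b) @^-1` `]c, d]%classic =
    `](c - b) / a, (d - b) / a]%classic.
  by apply/seteqP; split => x /=; rewrite !in_itv /=;
    rewrite ltr_pdivrMr// ler_pdivlMr// ltrBlDr lerBrDr mulrC.
rewrite !lebesgue_measure_itv/= !lte_fin ltr_pM2r ?invr_gt0// ltrD2r.
case: ifPn => cd; last by rewrite mule0.
rewrite -!EFinB -EFinM; congr EFin; field; exact: lt0r_neq0.
Qed.

Lemma ge0_integral_opp (f : R -> \bar R) :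
  measurable_fun setT f -> (forall x, (0 <= f x)%E) ->
  (\int[mu]_x f x = \int[mu]_x f (- x)%R)%E.
Proof.
move=> mf f0.
rewrite (@ge0_integral_image -%R (1%:nng))//= ?mul1e// => c d.
by rewrite mul1e -(@lebesgue_measureN R `]c, d]%classic).
Qed.

Lemma Li_affine (a b : R) f : 0 < a -> Li f -> Li (fun x => f (a * x + b)).
Proof.
move=> a0 fi.
have mf : measurable_fun setT (fun x => f (a * x + b)).
  by apply: (measurableT_comp (Li_meas fi)); exact: meas_affine.
apply/integrableP; split; first exact/measurable_EFinP.
have := @ge0_integral_affine a b (fun x => `|f x|%:E)%E a0.
have -> : (\int[mu]_x `|f x|%:E)%E = (\int[mu]_x `|f x|)%:E.
  by rewrite Rint_EFin//; exact: integrable_norm.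
move=> h; have {}h := h _ _; rewrite ltey; apply/negP => /eqP E.
rewrite /= E in h; have := h _ _; rewrite gt0_muley ?lte_fin//.
have mn : measurable_fun setT (fun x : R => (`|f x|%:E)%E).
  by apply/measurable_EFinP; exact: measurableT_comp (Li_meas fi).
by move=> /(_ mn (fun x => normr_ge0 _)).
Qed.

Lemma Rint_affine (a b : R) f : 0 < a -> Li f ->
  \int[mu]_x f x = a * \int[mu]_x f (a * x + b).
Proof.
move=> a0 fi.
have fi' := Li_affine b a0 fi.
(* f is the difference of the nonnegative functions |f| + f and |f|. *)
pose p x := `|f x| + f x; have p0 x : 0 <= p x.
  by rewrite /p -lerBlDr sub0r -normrN ler_norm.
have ifn : Li (fun x => `|f x|) by exact: integrable_norm.
have ip : Li p by exact: (LiD ifn fi).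
have ifn' := Li_affine b a0 ifn.
have ip' := Li_affine b a0 ip.
have key g : Li g -> (forall x, 0 <= g x) ->
    \int[mu]_x g x = a * \int[mu]_x g (a * x + b).
  move=> gi g0; apply: EFin_inj; rewrite EFinM !Rint_EFin//; last exact: Li_affine.
  rewrite (@ge0_integral_affine a b (fun x => (g x)%:E))//.
  by apply/measurable_EFinP; exact: Li_meas gi.
have -> : \int[mu]_x f x = \int[mu]_x p x - \int[mu]_x `|f x|.
  by rewrite -RintegralB//; apply: eqRint => x; rewrite /p addrAC subrr add0r.
rewrite key// (key (fun x => `|f x|))// -mulrBr; congr (_ * _).
by rewrite -RintegralB//; apply: eqRint => x; rewrite /p addrAC subrr add0r.
Qed.

Lemma Li_opp f : Li f -> Li (fun x : R => f (- x)).
Proof.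
move=> fi.
have mf : measurable_fun setT (fun x : R => f (- x)).
  by apply: (measurableT_comp (Li_meas fi)).
apply/integrableP; split; first exact/measurable_EFinP.
rewrite -(@ge0_integral_opp (fun x => `|f x|%:E)%E)//; first exact: Li_lty.
by apply/measurable_EFinP; exact: measurableT_comp (Li_meas fi).
Qed.

Lemma Rint_opp f : Li f -> \int[mu]_x f x = \int[mu]_x f (- x).
Proof.
move=> fi; have fi' := Li_opp fi.
pose p x := `|f x| + f x; have p0 x : 0 <= p x.
  by rewrite /p -lerBlDr sub0r -normrN ler_norm.
have ifn : Li (fun x => `|f x|) by exact: integrable_norm.
have ip : Li p by exact: (LiD ifn fi).
have ifn' := Li_opp ifn; have ip' := Li_opp ip.
have key g : Li g -> (forall x, 0 <= g x) ->
    \int[mu]_x g x = \int[mu]_x g (- x).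
  move=> gi g0; apply: EFin_inj; rewrite !Rint_EFin//; last exact: Li_opp.
  apply: (@ge0_integral_opp (fun x => (g x)%:E)) => //.
  by apply/measurable_EFinP; exact: Li_meas gi.
have -> : \int[mu]_x f x = \int[mu]_x p x - \int[mu]_x `|f x|.
  by rewrite -RintegralB//; apply: eqRint => x; rewrite /p addrAC subrr add0r.
rewrite key// (key (fun x => `|f x|))//.
by rewrite -RintegralB//; apply: eqRint => x; rewrite /p addrAC subrr add0r.
Qed.

Lemma L2_reflect (xi : R) u : L2 u -> L2 (fun x => u (xi - x)) /\
  nr (fun x => u (xi - x)) = nr u.
Proof.
move=> /L2P[mu_ iu].
have m1 : measurable_fun setT (fun x : R => xi - x) by exact: measurable_funB.
have E : \int[mu]_x (normc (u (xi - x)) ^+ 2) = \int[mu]_x (normc (u x) ^+ 2).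
  rewrite (@Rint_affine 1 xi _ ltr01 iu) mul1r.
  rewrite [RHS](Rint_opp (Li_affine xi ltr01 iu)).
  by apply: eqRint => x; rewrite mul1r addrC.
split; last by rewrite /nr E.
apply/L2P; split; first exact: (cmeas_comp m1).
have := Li_opp (Li_affine xi ltr01 iu).
by under [X in mu.-integrable _ (_ \o X)]eq_fun do rewrite mul1r addrC.
Qed.

Lemma L2_shift (h : R) u : L2 u -> L2 (fun x => u (x + h)) /\
  nr (fun x => u (x + h)) = nr u.
Proof.
move=> /L2P[mu_ iu].
have m1 : measurable_fun setT (fun x : R => x + h) by exact: measurable_funD.
split.
  apply/L2P; split; first exact: (cmeas_comp m1).
  have := (Li_affine h ltr01 iu).
  by under [X in mu.-integrable _ (_ \o X)]eq_fun do rewrite mul1r.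
rewrite /nr (@Rint_affine 1 h _ ltr01 iu) mul1r.
by congr Num.sqrt; apply: eqRint => x; rewrite mul1r.
Qed.

End ChangeOfVariable.

(** * Parametric integrals and Fubini *)

Section ParametricIntegrals.
Context {R : realType}.
Local Notation C := R[i].
Local Notation mu := (@lebesgue_measure R).
Local Notation Li f := (mu.-integrable setT (EFin \o f)).
Implicit Types (f g : R -> C).

Lemma meas_param (F : R * R -> R) : measurable_fun setT F ->
  measurable_fun setT (fun x : R => \int[mu]_y F (x, y)).
Proof.
move=> mF; apply: (@measurableT_comp _ _ _ _ _ _ (@fine R)).
  exact: fine_measurable.
have mE : measurable_fun setT (EFin \o F) by exact/measurable_EFinP.
under eq_fun do rewrite integralE.
have tonelli (g : R * R -> \bar R) : measurable_fun setT g ->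
    (forall z, 0 <= g z)%E -> measurable_fun setT (fun x => \int[mu]_y g (x, y))%E.
  by move=> mg g0; exact: (measurable_fun_fubini_tonelli_F (m2 := mu) g mg g0).
apply: emeasurable_funB.
  rewrite [X in measurable_fun _ X](_ : _ =
    (fun x => \int[mu]_y (EFin \o F)^\+ (x, y))%E); last first.
    by apply/funext => x; apply: eq_integral => y _; rewrite !funeposE.
  exact: (tonelli _ (measurable_funepos mE) (fun z => funepos_ge0 _ z)).
rewrite [X in measurable_fun _ X](_ : _ =
  (fun x => \int[mu]_y (EFin \o F)^\- (x, y))%E); last first.
  by apply/funext => x; apply: eq_integral => y _; rewrite !funenegE.
exact: (tonelli _ (measurable_funeneg mE) (fun z => funeneg_ge0 _ z)).
Qed.

Lemma meas_section1 (F : R * R -> R) (x : R) : measurable_fun setT F ->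
  measurable_fun setT (fun y : R => F (x, y)).
Proof. by move=> mF; apply: (measurableT_comp mF); exact: measurable_pair1. Qed.

Lemma meas_section2 (F : R * R -> R) (y : R) : measurable_fun setT F ->
  measurable_fun setT (fun x : R => F (x, y)).
Proof. by move=> mF; apply: (measurableT_comp mF); exact: measurable_pair2. Qed.

Lemma Rfubini (F : R * R -> R) : measurable_fun setT F ->
  (\int[mu]_x \int[mu]_y (`|F (x, y)|)%:E < +oo)%E ->
  (forall x, Li (fun y : R => F (x, y))) -> (forall y, Li (fun x : R => F (x, y))) ->
  Li (fun x : R => \int[mu]_y F (x, y)) /\
  \int[mu]_x \int[mu]_y F (x, y) = \int[mu]_y \int[mu]_x F (x, y).
Proof.
move=> mF iF i1 i2.
have mE : measurable_fun setT (EFin \o F) by exact/measurable_EFinP.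
have iFF : (mu \x mu)%E.-integrable setT (EFin \o F).
  by apply/(@integrable12ltyP _ _ _ _ _ mu mu (EFin \o F) mE).
split.
  have := integrable_fubini_F iFF; apply: eq_integrable => // x _.
  by rewrite /fubini_F /= -Rint_EFin.
congr fine.
have := Fubini iFF; rewrite /fubini_F /fubini_G /= => h.
transitivity (\int[mu]_x \int[mu]_y (F (x, y))%:E)%E.
  by apply: eq_integral => x _; rewrite Rint_EFin.
by rewrite h; apply: eq_integral => x _; rewrite Rint_EFin.
Qed.

Lemma cmeas_param (F : R * R -> C) : cmeas F ->
  cmeas (fun x : R => cint (fun y => F (x, y))).
Proof.
move=> [m1 m2]; split; rewrite /=.
  exact: (meas_param m1).
exact: (meas_param m2).
Qed.

Lemma cmeas_section1 (F : R * R -> C) (x : R) : cmeas F ->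
  cmeas (fun y : R => F (x, y)).
Proof.
by move=> [m1 m2]; split; [exact: (meas_section1 _ m1)|exact: (meas_section1 _ m2)].
Qed.

Lemma cmeas_section2 (F : R * R -> C) (y : R) : cmeas F ->
  cmeas (fun x : R => F (x, y)).
Proof.
by move=> [m1 m2]; split; [exact: (meas_section2 _ m1)|exact: (meas_section2 _ m2)].
Qed.

Lemma cmeas_fst f : cmeas f -> cmeas (fun z : R * R => f z.1).
Proof. by move=> mf; apply: (cmeas_comp _ mf); exact: measurable_fst. Qed.

Lemma cmeas_snd f : cmeas f -> cmeas (fun z : R * R => f z.2).
Proof. by move=> mf; apply: (cmeas_comp _ mf); exact: measurable_snd. Qed.

Lemma cfubini (F : R * R -> C) : cmeas F ->
  (\int[mu]_x \int[mu]_y (normc (F (x, y)))%:E < +oo)%E ->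
  (forall x, cintegrable (fun y : R => F (x, y))) ->
  (forall y, cintegrable (fun x : R => F (x, y))) ->
  cintegrable (fun x : R => cint (fun y => F (x, y))) /\
  cint (fun x => cint (fun y => F (x, y))) =
  cint (fun y => cint (fun x => F (x, y))).
Proof.
move=> mF iF i1 i2; have [m1 m2] := mF.
have mn : measurable_fun setT (fun z => (normc (F z))%:E).
  by apply/measurable_EFinP; exact: meas_normc.
have le1 (G : R * R -> R) : measurable_fun setT G ->
    (forall z, `|G z| <= normc (F z)) ->
    (\int[mu]_x \int[mu]_y (`|G (x, y)|)%:E < +oo)%E.
  move=> mG GF; apply: le_lt_trans iF.
  have mGn : measurable_fun setT (fun z => (`|G z|)%:E).
    by apply/measurable_EFinP; exact: measurableT_comp.
  apply: ge0_le_integral => //.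
  - by move=> x _; apply: integral_ge0 => y _; rewrite lee_fin.
  - exact: (@measurable_fun_fubini_tonelli_F _ _ _ _ R mu _ mGn (fun z => normr_ge0 (G z))).
  - exact: (@measurable_fun_fubini_tonelli_F _ _ _ _ R mu _ mn (fun z => normc_ge0 (F z))).
  - move=> x _; apply: ge0_le_integral => //.
    + apply/measurable_EFinP; apply: measurableT_comp => //.
      exact: meas_section1.
    + by apply/measurable_EFinP/meas_normc/cmeas_section1.
    + by move=> y _; rewrite lee_fin.
have [a1 a2] := Rfubini m1 (le1 _ m1 (fun z => normRe_le _))
  (fun x => (i1 x).1) (fun y => (i2 y).1).
have [b1 b2] := Rfubini m2 (le1 _ m2 (fun z => normIm_le _))
  (fun x => (i1 x).2) (fun y => (i2 y).2).
split; first by split.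
by rewrite !cintE /= a2 b2.
Qed.

(** Fubini for a bounded kernel b between two integrable functions, the shape in
    which it occurs for Fourier integrals. *)
Lemma cfubini_prod f g (b : R * R -> C) (K : R) : cintegrable f ->
  cintegrable g -> cmeas b -> (forall z, normc (b z) <= K) ->
  cintegrable (fun x => f x * cint (fun y => b (x, y) * g y)) /\
  cint (fun x => f x * cint (fun y => b (x, y) * g y)) =
  cint (fun y => g y * cint (fun x => b (x, y) * f x)).
Proof.
move=> fi gi mb bK.
have mf := cintegrable_meas fi; have mg := cintegrable_meas gi.
have nf := cintegrable_normc fi; have ng := cintegrable_normc gi.
have K0 : 0 <= K by apply: le_trans (bK (0, 0)); exact: normc_ge0.
pose F z := f z.1 * (b z * g z.2).
have mF : cmeas F.
  by apply: cmeasM; [exact: cmeas_fst|apply: cmeasM => //; exact: cmeas_snd].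
have Fle z : normc (F z) <= K * normc (f z.1) * normc (g z.2).
  rewrite /F !normcM mulrCA -mulrA; apply: ler_wpM2r => //.
  by rewrite mulr_ge0 ?normc_ge0.
have i1g x : cintegrable (fun y => b (x, y) * g y).
  apply: (@cintegrable_le _ _ (fun y => K * normc (g y))).
  - by apply: cmeasM => //; exact: cmeas_section1.
  - exact: LiZ.
  - by move=> y; rewrite normcM ler_wpM2r ?normc_ge0.
have i2f y : cintegrable (fun x => b (x, y) * f x).
  apply: (@cintegrable_le _ _ (fun x => K * normc (f x))).
  - by apply: cmeasM => //; exact: cmeas_section2.
  - exact: LiZ.
  - by move=> x; rewrite normcM ler_wpM2r ?normc_ge0.
have [|||h1 h2] := @cfubini F mF _ _ _.
- apply: (@le_lt_trans _ _ (\int[mu]_x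
      (K * normc (f x) * \int[mu]_y normc (g y))%:E)%E); last first.
    rewrite -Rint_EFin ?ltry//.
    have := LiZ (\int[mu]_y normc (g y) * K) nf.
    by under [X in mu.-integrable _ (_ \o X)]eq_fun do rewrite -mulrA mulrC.
  have mn : measurable_fun setT (fun z => (normc (F z))%:E).
    by apply/measurable_EFinP; exact: meas_normc.
  apply: ge0_le_integral => //.
  + by move=> x _; apply: integral_ge0 => y _; rewrite lee_fin normc_ge0.
  + exact: (@measurable_fun_fubini_tonelli_F _ _ _ _ R mu _ mn (fun z => normc_ge0 (F z))).
  + apply/measurable_EFinP; apply: measurable_funM => //.
    by apply: measurable_funM => //; exact: meas_normc.
  + move=> x _; rewrite EFinM Rint_EFin// -ge0_integralZl//; last 3 first.
    * by apply/measurable_EFinP; exact: meas_normc.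
    * by move=> y _; rewrite lee_fin normc_ge0.
    * by rewrite lee_fin mulr_ge0 ?normc_ge0.
    apply: ge0_le_integral => //.
    * by move=> y _; rewrite lee_fin normc_ge0.
    * by apply/measurable_EFinP/meas_normc/cmeas_section1.
    * apply/measurable_EFinP; apply: measurable_funM => //; exact: meas_normc.
    * by move=> y _; rewrite -EFinM lee_fin.
- by move=> x; exact: (cintegrableZ (f x) (i1g x)).
- move=> y; rewrite (_ : (fun x => _) = (fun x => g y * (b (x, y) * f x))).
    exact: cintegrableZ.
  by apply/funext => x; rewrite /F /= mulrC mulrAC mulrC mulrA.
have E1 : (fun x => f x * cint (fun y => b (x, y) * g y)) =
          (fun x => cint (fun y => F (x, y))).
  by apply/funext => x; rewrite -cintZ.
have alg (p q r : C) : p * (q * r) = r * (q * p) by ring.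
rewrite E1; split; first exact: h1.
apply: (etrans h2); apply: eq_cint => y; rewrite -(cintZ (g y) (i2f y)).
by apply: eq_cint => x; exact: alg.
Qed.

End ParametricIntegrals.

(** * The Poisson kernel *)

Section PoissonKernel.
Context {R : realType}.
Local Notation C := R[i].
Local Notation mu := (@lebesgue_measure R).
Local Notation Li f := (mu.-integrable setT (EFin \o f)).
Variables (eps t : R).
Hypothesis eps0 : 0 < eps.

Let den0 : eps ^+ 2 + t ^+ 2 != 0.
Proof. by rewrite gt_eqF// ltr_pwDl ?exprn_gt0// sqr_ge0. Qed.

(** The coefficient c in [0, 1] keeps the integrand nonnegative, so that the
    fundamental theorem on a half-line applies; the oscillating integral itself is
    then the difference of the cases c = 1 and c = 0. *)
Lemma integral_expR_cos (c : R) : 0 <= c <= 1 ->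
  (\int[mu]_(x in `[0%R, +oo[) ((1 + c * cos (t * x)) * expR (- (eps * x)))%:E =
  (eps^-1 + c * eps / (eps ^+ 2 + t ^+ 2))%:E)%E.
Proof.
move=> /andP[c0 c1].
(* An explicit primitive, vanishing at infinity. *)
pose F x := expR (- (eps * x)) *
  (c * (t * sin (t * x) - eps * cos (t * x)) / (eps ^+ 2 + t ^+ 2) - eps^-1).
have dF (x : R) : is_derive x (1 : R) F ((1 + c * cos (t * x)) * expR (- (eps * x))).
  apply: is_derive_eq; rewrite /GRing.scale /=; field.
  by rewrite den0 gt_eqF.
have cf : continuous (fun x => (1 + c * cos (t * x)) * expR (- (eps * x))).
  move=> x; apply: (@differentiable_continuous _ R^o R^o).
  by apply/derivable1_diffP.
have cvge : expR (- (eps * x)) @[x --> +oo] --> (0 : R).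
  apply: (cvg_comp (fun x => eps * x) (fun x => expR (- x))); last exact: cvgr_expR.
  exact: gt0_cvgMry.
pose K := (`|t| + eps) / (eps ^+ 2 + t ^+ 2) + eps^-1.
have FK x : `|F x| <= K * expR (- (eps * x)).
  rewrite /F normrM ger0_norm ?expR_ge0// mulrC ler_wpM2r ?expR_ge0//.
  apply: (le_trans (ler_normB _ _)); rewrite /K lerD//; last first.
    by rewrite ger0_norm// invr_ge0 ltW.
  have d0 : 0 < eps ^+ 2 + t ^+ 2 by rewrite ltr_pwDl ?exprn_gt0// sqr_ge0.
  rewrite normrM [X in _ * X]ger0_norm ?invr_ge0 ?(ltW d0)//.
  rewrite ler_pM2r ?invr_gt0// normrM (ger0_norm c0).
  apply: (@le_trans _ _ (1 * `|t * sin (t * x) - eps * cos (t * x)|)).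
    by rewrite ler_wpM2r.
  rewrite mul1r; apply: (le_trans (ler_normB _ _)); rewrite !normrM lerD//.
    by rewrite ler_piMr// sin_max.
  by rewrite (gtr0_norm eps0) ler_piMr ?(ltW eps0)// cos_max.
have cvgF : F x @[x --> +oo] --> (0 : R).
  apply: (@squeeze_cvgr _ _ _ _ (fun x => - (K * expR (- (eps * x))))
    (fun x => K * expR (- (eps * x)))).
  - by apply: nearW => x; rewrite -ler_norml.
  - by rewrite -[X in _ --> X](@oppr0 R) -{1}(mulr0 K); apply: cvgN; apply: cvgMr.
  - by rewrite -[X in _ --> X](mulr0 K); apply: cvgMr.
rewrite (@ge0_continuous_FTC2y _ _ F 0 0).
- rewrite /F !mulr0 sin0 cos0 oppr0 expR0 -EFinB; congr EFin.
  by field; rewrite den0 gt_eqF.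
- move=> x _; rewrite mulr_ge0 ?expR_ge0//.
  by have := cos_geN1 (t * x); nra.
- exact: continuous_subspaceT.
- exact: cvgF.
- by move=> x _; exact: ex_derive.
- apply: cvg_at_right_filter; apply: (@differentiable_continuous _ R^o R^o).
  by apply/derivable1_diffP; exact: ex_derive.
- by move=> x _; rewrite derive1E; apply: derive_val.
Qed.

Lemma continuous_expR_cos (c : R) :
  continuous (fun x => (1 + c * cos (t * x)) * expR (- (eps * `|x|))).
Proof.
move=> x; apply: cvgM.
  apply: cvgD; first exact: cvg_cst.
  apply: cvgM; first exact: cvg_cst.
  apply: (cvg_comp (fun x => t * x) cos); last exact: continuous_cos.
  by apply: cvgM; [exact: cvg_cst|].
apply: (cvg_comp (fun x => - (eps * `|x|)) expR); last exact: continuous_expR.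
apply: cvgN; apply: cvgM; first exact: cvg_cst.
exact: norm_continuous.
Qed.

Lemma integralT_expR_cos (c : R) : 0 <= c <= 1 ->
  (\int[mu]_x ((1 + c * cos (t * x)) * expR (- (eps * `|x|)))%:E =
  (2 * (eps^-1 + c * eps / (eps ^+ 2 + t ^+ 2)))%:E)%E.
Proof.
move=> c01; rewrite ge0_symfun_integralT.
- rewrite (_ : [set x | _] = `[0, +oo[%classic); last first.
    by apply/seteqP; split => x/=; rewrite in_itv/= andbT.
  rewrite EFinM -(integral_expR_cos c01); congr (_ * _)%E; apply: eq_integral => x.
  by rewrite inE /= in_itv/= andbT => x0; rewrite (ger0_norm x0).
- move=> x; rewrite mulr_ge0 ?expR_ge0//.
  by have := cos_geN1 (t * x); case/andP: c01; nra.
- exact: continuous_expR_cos.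
- by move=> x /=; rewrite mulrN cosN normrN.
Qed.

Lemma Li_expR_cos (c : R) : 0 <= c <= 1 ->
  Li (fun x => (1 + c * cos (t * x)) * expR (- (eps * `|x|))).
Proof.
move=> c01; apply: LiP.
- by apply: continuous_measurable_fun; exact: continuous_expR_cos.
- move=> x; rewrite mulr_ge0 ?expR_ge0//.
  by have := cos_geN1 (t * x); case/andP: c01; nra.
- by rewrite integralT_expR_cos// ltry.
Qed.

Lemma Li_expR_abs : Li (fun x : R => expR (- (eps * `|x|))).
Proof.
have := @Li_expR_cos 0; rewrite lexx ler01 => /(_ erefl).
by under [X in mu.-integrable _ (_ \o X)]eq_fun do rewrite mul0r addr0 mul1r.
Qed.

Lemma Rint_expR_cos : \int[mu]_x (cos (t * x) * expR (- (eps * `|x|))) =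
  2 * eps / (eps ^+ 2 + t ^+ 2).
Proof.
have c01 : 0 <= (1 : R) <= 1 by rewrite ler01 lexx.
have c00 : 0 <= (0 : R) <= 1 by rewrite ler01 lexx.
transitivity (\int[mu]_x ((1 + 1 * cos (t * x)) * expR (- (eps * `|x|)) -
                          (1 + 0 * cos (t * x)) * expR (- (eps * `|x|)))).
  by apply: eqRint => x; ring.
rewrite RintegralB//; try exact: Li_expR_cos.
rewrite /Rintegral !integralT_expR_cos//=.
by field; rewrite den0 gt_eqF.
Qed.

Lemma meas_expR_abs : measurable_fun setT (fun x : R => expR (- (eps * `|x|))).
Proof. exact: Li_meas Li_expR_abs. Qed.

(** The Fourier transform of e^{- eps |x|} is the Poisson kernel. *)
Lemma cint_poisson :
  cint (fun x => expi (t * x) * (expR (- (eps * `|x|)))%:C) =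
  (2 * eps / (eps ^+ 2 + t ^+ 2))%:C.
Proof.
have mw := meas_expR_abs.
have mt : measurable_fun setT (fun x : R => t * x).
  by apply: measurable_funM => //; exact: measurable_cst.
have iu : cintegrable (fun x => expi (t * x) * (expR (- (eps * `|x|)))%:C).
  apply: (cintegrable_le _ Li_expR_abs).
    by apply: cmeasM; [exact: cmeas_expi|exact: cmeas_real].
  by move=> x; rewrite normcM normc_expi mul1r normc_real ger0_norm ?expR_ge0.
rewrite cintE; apply: complex_ext => /=.
  rewrite -Rint_expR_cos; apply: eqRint => x.
  by rewrite /= mulr0 subr0.
have E (x : R) : cos (t * x) * 0 + sin (t * x) * expR (- (eps * `|x|)) =
    sin (t * x) * expR (- (eps * `|x|)) by rewrite mulr0 add0r.
under eq_Rintegral do rewrite E.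
have is_ : Li (fun x => sin (t * x) * expR (- (eps * `|x|))).
  case: iu => _; apply: eq_integrable => // x _.
  by rewrite /= E.
have := Rint_opp is_.
rewrite (_ : (\int[mu]_x (sin (t * - x) * _)) =
  - (\int[mu]_x (sin (t * x) * expR (- (eps * `|x|))))).
  by lra.
rewrite -mulN1r -RintegralZl//; apply: eqRint => x.
by rewrite mulrN sinN normrN mulNr mulN1r.
Qed.

End PoissonKernel.

Section CauchyDensity.
Context {R : realType}.
Local Notation mu := (@lebesgue_measure R).
Local Notation Li f := (mu.-integrable setT (EFin \o f)).

Lemma integralT_oneDsqrV :
  (\int[mu]_x ((1 + x ^+ 2)^-1)%:E = (pi : R)%:E)%E.
Proof.
rewrite ge0_symfun_integralT.
- rewrite (_ : [set x | _] = `[0, +oo[%classic); last first.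
    by apply/seteqP; split => x/=; rewrite in_itv/= andbT.
  by rewrite (@integral0y_oneDsqr R) -EFinM mulrC divfK.
- by move=> x; rewrite invr_ge0 addr_ge0// sqr_ge0.
- exact: continuous_oneDsqrV.
- by move=> x /=; rewrite sqrrN.
Qed.

Lemma Li_oneDsqrV : Li (fun x : R => (1 + x ^+ 2)^-1).
Proof.
apply: LiP.
- by apply: continuous_measurable_fun; exact: continuous_oneDsqrV.
- by move=> x; rewrite invr_ge0 addr_ge0// sqr_ge0.
- by rewrite integralT_oneDsqrV ltry.
Qed.

Lemma Rint_oneDsqrV : \int[mu]_x (1 + x ^+ 2)^-1 = pi :> R.
Proof. by rewrite /Rintegral integralT_oneDsqrV. Qed.

End CauchyDensity.

(** * Complex integrals: limits and substitutions *)

Section ComplexDominated.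
Context {R : realType}.
Local Notation C := R[i].
Local Notation mu := (@lebesgue_measure R).
Local Notation Li f := (mu.-integrable setT (EFin \o f)).

Lemma cint_dct (u : nat -> R -> C) (v : R -> C) (g : R -> R) :
  (forall n, cmeas (u n)) -> cmeas v -> Li g ->
  {ae mu, forall x, forall n, normc (u n x) <= g x} ->
  {ae mu, forall x, ccvg (fun n => u n x) (v x)} ->
  ccvg (fun n => cint (u n)) (cint v).
Proof.
move=> hu hv ig ug uv.
have vg : {ae mu, forall x, normc (v x) <= g x}.
  apply: (ae_mono (ae_and ug uv)) => x [h1 /normc_ccvg h2].
  rewrite -(cvg_lim (@Rhausdorff R) h2); apply: limr_le.
    by apply/cvg_ex; eexists; exact: h2.
  by apply: nearW => n; exact: h1.
have iu n : cintegrable (u n).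
  apply: cintegrableP => //; apply: (Li_le_ae _ ig); first exact: meas_normc.
  by apply: (ae_mono ug) => x h; rewrite ger0_norm ?normc_ge0.
have iv : cintegrable v.
  apply: cintegrableP => //; apply: (Li_le_ae _ ig); first exact: meas_normc.
  by apply: (ae_mono vg) => x h; rewrite ger0_norm ?normc_ge0.
have h : \int[mu]_x `|normc (u n x - v x)| @[n --> \oo] --> (0 : R).
  apply: (@dct0 _ (fun n x => normc (u n x - v x)) (fun x => 2 * g x)).
  - by move=> n; apply: meas_normc; exact: cmeasB.
  - exact: LiZ.
  - apply: (ae_mono (ae_and ug vg)) => x [h1 h2] n.
    rewrite ger0_norm ?normc_ge0// (le_trans (normcD _ _))// normcN.
    by rewrite mulrDl mul1r lerD.
  - exact: uv.
apply: (cvg0_le _ _ h) => n; first exact: normc_ge0.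
rewrite -cintB//; apply: (le_trans (le_normc_cint (cintegrableB (iu n) iv))).
by rewrite le_eqVlt; apply/orP; left; apply/eqP/eqRint => x;
  rewrite ger0_norm ?normc_ge0.
Qed.

Lemma cint_affine (a b : R) (u : R -> C) : 0 < a -> cintegrable u ->
  cint u = a%:C * cint (fun x => u (a * x + b)).
Proof.
move=> a0 [u1 u2]; rewrite !cintE; apply: complex_ext => /=.
  by rewrite mul0r subr0; exact: Rint_affine.
by rewrite mul0r addr0; exact: Rint_affine.
Qed.

Lemma cint_conj (u : R -> C) : cintegrable u ->
  cint (fun x => (u x)^*) = (cint u)^*.
Proof.
move=> [u1 u2]; rewrite !cintE; apply: complex_ext; rewrite /=.
  by apply: eqRint => x; rewrite ReJE.
by rewrite -mulN1r -RintegralZl//; apply: eqRint => x; rewrite ImJE mulN1r.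
Qed.

Lemma cint_real (f : R -> R) : cint (fun x => (f x)%:C) = (\int[mu]_x f x)%:C.
Proof. by rewrite cintE /= /Rintegral integral0. Qed.

End ComplexDominated.

(** * Fourier integrals and Abel summation *)

Section FourierIntegral.
Context {R : realType}.
Local Notation C := R[i].
Local Notation mu := (@lebesgue_measure R).
Local Notation Li f := (mu.-integrable setT (EFin \o f)).
Implicit Types (u v h : R -> C) (s : R).

(** The normalizing constant of the unitary Fourier transform. *)
Definition kap : R := (Num.sqrt (2 * pi))^-1.

Lemma kap_gt0 : 0 < kap.
Proof. by rewrite invr_gt0 sqrtr_gt0 mulr_gt0// pi_gt0. Qed.

Lemma kap_sq : kap ^+ 2 = (2 * pi)^-1.
Proof. by rewrite /kap exprVn sqr_sqrtr// mulr_ge0// pi_ge0. Qed.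

Lemma conj_real (a : R) : (a%:C)^* = a%:C.
Proof. by rewrite /= oppr0. Qed.

Lemma conjcM (z w : C) : (z * w)^* = z^* * w^*.
Proof.
by apply: complex_ext; rewrite ?(ReJE, ImJE, ReME, ImME) //; ring.
Qed.

Lemma normc_sqC (z : C) : (normc z ^+ 2)%:C = z^* * z.
Proof.
by apply: complex_ext; rewrite ?ReME ?ImME ReJE ImJE /= ?normc_sq; ring.
Qed.

Lemma normc_expi_le (t : R) : normc (expi t) <= 1.
Proof. by rewrite normc_expi. Qed.

Lemma realcM (a b : R) : (a * b)%:C = a%:C * b%:C.
Proof. by rewrite rmorphM. Qed.

(** The Fourier integral with sign s: meaningful at every point for integrable
    functions, whereas [fourier] is only a class of functions. *)
Definition ft s u : R -> C :=
  fun xi => kap%:C * cint (fun x => expi (s * x * xi) * u x).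

Definition cutoff (n : nat) u : R -> C :=
  fun x => if x \in `[- n%:R, n%:R]%classic then u x else 0.

Lemma fourier_truncE s n u : fourier_trunc s n u = ft s (cutoff n u).
Proof.
apply/funext => xi; rewrite /fourier_trunc /ft; congr (_ * _).
rewrite /cintegral cintE; congr (_ +i* _).
  rewrite Rintegral_mkcond; apply: eqRint => x; rewrite /patch /cutoff.
  by case: ifP => //; rewrite mulr0.
rewrite Rintegral_mkcond; apply: eqRint => x; rewrite /patch /cutoff.
by case: ifP => //; rewrite mulr0.
Qed.

Lemma cmeas_kernel s : cmeas (fun z : R * R => expi (s * z.2 * z.1) : C).
Proof.
apply: cmeas_expi; apply: measurable_funM; last exact: measurable_fst.
by apply: measurable_funM; [exact: measurable_cst|exact: measurable_snd].
Qed.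

Lemma cmeas_kernel1 s xi : cmeas (fun x : R => expi (s * x * xi) : C).
Proof.
apply: cmeas_expi; apply: measurable_funM; last exact: measurable_cst.
by apply: measurable_funM; [exact: measurable_cst|exact: measurable_id].
Qed.

Lemma cmeas_kernel1' s x : cmeas (fun xi : R => expi (s * x * xi) : C).
Proof.
apply: cmeas_expi; apply: measurable_funM; last exact: measurable_id.
exact: measurable_cst.
Qed.

Lemma cintegrable_kernel s u xi : cintegrable u ->
  cintegrable (fun x => expi (s * x * xi) * u x).
Proof.
move=> iu; apply: (cintegrable_le _ (cintegrable_normc iu)).
  by apply: cmeasM; [exact: cmeas_kernel1|exact: cintegrable_meas].
by move=> x; rewrite normcM normc_expi mul1r.
Qed.

Lemma cmeas_ft s u : cintegrable u -> cmeas (ft s u).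
Proof.
move=> iu; apply: cmeasZ.
apply: (@cmeas_param _ (fun z => expi (s * z.2 * z.1) * u z.2)).
by apply: cmeasM; [exact: cmeas_kernel|exact/cmeas_snd/cintegrable_meas].
Qed.

Lemma normc_ft_le s u xi : cintegrable u ->
  normc (ft s u xi) <= kap * \int[mu]_x normc (u x).
Proof.
move=> iu; rewrite /ft normcM normc_real (gtr0_norm kap_gt0).
rewrite ler_pM2l ?kap_gt0//.
apply: (le_trans (le_normc_cint (cintegrable_kernel s xi iu))).
rewrite le_eqVlt; apply/orP; left; apply/eqP/eqRint => x.
by rewrite normcM normc_expi mul1r.
Qed.

Lemma ftD s u v : cintegrable u -> cintegrable v ->
  ft s (fun x => u x + v x) = (fun xi => ft s u xi + ft s v xi).
Proof.
move=> iu iv; apply/funext => xi; rewrite /ft -mulrDr -cintD.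
- by congr (_ * _); apply: eq_cint => x; rewrite mulrDr.
- exact: cintegrable_kernel.
- exact: cintegrable_kernel.
Qed.

Lemma ftZ s (c : C) u : cintegrable u ->
  ft s (fun x => c * u x) = (fun xi => c * ft s u xi).
Proof.
move=> iu; apply/funext => xi; rewrite /ft [RHS]mulrCA.
rewrite -(cintZ c (cintegrable_kernel s xi iu)).
by congr (_ * _); apply: eq_cint => x; rewrite mulrCA.
Qed.

Lemma ftB s u v : cintegrable u -> cintegrable v ->
  ft s (fun x => u x - v x) = (fun xi => ft s u xi - ft s v xi).
Proof.
move=> iu iv; apply/funext => xi; rewrite /ft -mulrBr -cintB.
- by congr (_ * _); apply: eq_cint => x; rewrite mulrBr.
- exact: cintegrable_kernel.
- exact: cintegrable_kernel.
Qed.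

Lemma ft_conj s u : cintegrable u ->
  (fun xi => (ft s u xi)^*) = ft (- s) (fun x => (u x)^*).
Proof.
move=> iu; apply/funext => xi; rewrite /ft conjcM conj_real.
rewrite -(cint_conj (cintegrable_kernel s xi iu)).
by congr (_ * _); apply: eq_cint => x; rewrite conjcM -expiN !mulNr.
Qed.

(** Plancherel's identity is first proved for bounded functions with bounded
    support satisfying the last clause, which suffices for pointwise convergence of
    Poisson means and holds for a continuous function cut off to an interval, in
    spite of its jumps at the ends. *)
Definition nice h : Prop := [/\ cmeas h,
  exists B : R, forall x, normc (h x) <= B,
  exists A : R, forall x, A < `|x| -> h x = 0 &
  {ae mu, forall x, forall t : R, ccvg (fun m => h (x + m.+1%:R^-1 * t)) (h x)}].

Lemma Li_itv (A : R) : Li (\1_(`[- A, A]%classic : set R)).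
Proof. exact: integrable_indic_itv. Qed.

Lemma compact_bounded_integrable (f : R -> R) (A B : R) :
  measurable_fun setT f -> (forall x, `|f x| <= B) ->
  (forall x, A < `|x| -> f x = 0) -> Li f.
Proof.
move=> mf fB fA; have B0 : 0 <= B by apply: le_trans (fB 0).
apply: (Li_le mf (LiZ B (Li_itv A))) => x; rewrite indicE.
have [Ax|xA] := ltP A `|x|; first by rewrite fA// normr0 mulr_ge0.
rewrite mem_set ?mulr1//= in_itv /=; by rewrite -ler_norml.
Qed.

Lemma nice_integrable h : nice h -> cintegrable h.
Proof.
move=> [mh [B hB] [A hA] _]; apply: cintegrableP => //.
apply: (@compact_bounded_integrable _ A B); first exact: meas_normc.
  by move=> x; rewrite ger0_norm ?normc_ge0.
by move=> x /hA ->; rewrite normc0.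
Qed.

Lemma nice_L2 h : nice h -> L2 h.
Proof.
move=> [mh [B hB] [A hA] _]; apply/L2P; split => //.
apply: (@compact_bounded_integrable _ A (B ^+ 2)).
- by apply: measurable_funX; exact: meas_normc.
- move=> x; rewrite ger0_norm ?sqr_ge0// ler_sqr ?nnegrE ?normc_ge0//.
  by apply: le_trans (hB x); exact: normc_ge0.
- by move=> x /hA ->; rewrite normc0 expr0n.
Qed.

Lemma cvgMc (a : nat -> R) (l k : R) : a n @[n --> \oo] --> l ->
  a n * k @[n --> \oo] --> l * k.
Proof. by move=> h; apply: cvgM => //; exact: cvg_cst. Qed.

Lemma cvgMc0 (a : nat -> R) (k : R) : a n @[n --> \oo] --> (0 : R) ->
  a n * k @[n --> \oo] --> (0 : R).
Proof. by move=> /(@cvgMc a _ k); rewrite mul0r. Qed.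

Lemma cvgMc1 (a : nat -> R) (k : R) : a n @[n --> \oo] --> (1 : R) ->
  a n * k @[n --> \oo] --> k.
Proof. by move=> /(@cvgMc a _ k); rewrite mul1r. Qed.

(** Up to the factor pi, the Poisson mean of the conjugate of h, in the variable
    t = (y - x) / e. *)
Definition poisson_mean h (e x : R) : C :=
  cint (fun t => (1 + t ^+ 2)^-1%:C * (h (x + e * t))^*).

Lemma oneDsqrV_ge0 (t : R) : 0 <= (1 + t ^+ 2)^-1.
Proof. by rewrite invr_ge0 addr_ge0// sqr_ge0. Qed.

Lemma oneDsqrV_le (t : R) : (1 + t ^+ 2)^-1 <= 1.
Proof. by rewrite invf_le1 ?lerDl ?sqr_ge0// ltr_pwDl// sqr_ge0. Qed.

Lemma meas_oneDsqrV : measurable_fun setT (fun t : R => (1 + t ^+ 2)^-1).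
Proof. exact: Li_meas Li_oneDsqrV. Qed.

Lemma poisson_mean_integrable h (e x B : R) : cmeas h ->
  (forall x, normc (h x) <= B) ->
  cintegrable (fun t : R => (1 + t ^+ 2)^-1%:C * (h (x + e * t))^*).
Proof.
move=> mh hB; apply: (cintegrable_le _ (LiZ B Li_oneDsqrV)).
  apply: cmeasM; first exact: (cmeas_real meas_oneDsqrV).
  apply: cmeas_conj; apply: (cmeas_comp _ mh).
  by under eq_fun do rewrite addrC; exact: meas_affine.
move=> t; rewrite normcM normc_conj normc_real ger0_norm ?oneDsqrV_ge0//.
by rewrite mulrC ler_wpM2r ?oneDsqrV_ge0.
Qed.

Lemma poisson_mean_le h (e x B : R) : cmeas h -> (forall x, normc (h x) <= B) ->
  normc (poisson_mean h e x) <= B * pi.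
Proof.
move=> mh hB; apply: (le_trans (le_normc_cint (poisson_mean_integrable e x mh hB))).
rewrite -Rint_oneDsqrV -RintegralZl//; last exact: Li_oneDsqrV.
apply: le_Rint.
- exact: cintegrable_normc (poisson_mean_integrable e x mh hB).
- exact: LiZ Li_oneDsqrV.
- move=> t; rewrite normcM normc_conj normc_real ger0_norm ?oneDsqrV_ge0//.
  by rewrite mulrC ler_wpM2r ?oneDsqrV_ge0.
Qed.

Lemma cmeas_poisson_mean h (e : R) : cmeas h -> cmeas (poisson_mean h e).
Proof.
move=> mh; apply: (@cmeas_param _
  (fun z => (1 + z.2 ^+ 2)^-1%:C * (h (z.1 + e * z.2))^*)).
apply: cmeasM.
  by apply: (@cmeas_snd _ (fun t => (1 + t ^+ 2)^-1%:C));
    exact: (cmeas_real meas_oneDsqrV).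
apply: cmeas_conj; apply: (cmeas_comp _ mh).
apply: measurable_funD; first exact: measurable_fst.
by apply: measurable_funM; [exact: measurable_cst|exact: measurable_snd].
Qed.

Lemma poisson_scaled h (e x : R) : 0 < e -> cintegrable h ->
  cint (fun y => (h y)^* * (2 * e / (e ^+ 2 + (x - y) ^+ 2))%:C) =
  2%:C * poisson_mean h e x.
Proof.
move=> e0 ih.
have E y : (h y)^* * (2 * e / (e ^+ 2 + (x - y) ^+ 2))%:C =
    (2 * e^-1)%:C * ((1 + ((x - y) / e) ^+ 2)^-1%:C * (h y)^*).
  rewrite mulrA -realcM mulrC; congr (_%:C * _).
  by field; rewrite gt_eqF// gt_eqF ?ltr_pwDl ?exprn_gt0 ?sqr_ge0.
have iQ : cintegrable (fun y => (1 + ((x - y) / e) ^+ 2)^-1%:C * (h y)^*).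
  apply: (cintegrable_le _ (cintegrable_normc ih)).
    apply: cmeasM; last exact: cmeas_conj (cintegrable_meas ih).
    apply: cmeas_real; apply: (measurableT_comp meas_oneDsqrV).
    apply: measurable_funM; last exact: measurable_cst.
    by apply: measurable_funB; [exact: measurable_cst|exact: measurable_id].
  move=> y; rewrite normcM normc_conj normc_real ger0_norm ?oneDsqrV_ge0//.
  by rewrite ler_piMl ?normc_ge0// oneDsqrV_le.
rewrite (eq_cint E) (cintZ _ iQ) (cint_affine x e0 iQ) mulrA -realcM.
rewrite -mulrA mulVf ?gt_eqF// mulr1; congr (_ * _); apply: eq_cint => t.
rewrite [e * t + x]addrC; congr (_ * _); congr (_%:C); congr (_^-1).
by congr (_ + _); field; rewrite gt_eqF.
Qed.

(** Inserting the factor e^{- e |xi|} makes the double integral absolutely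
    convergent; integrating in xi first produces the Poisson kernel. *)
Lemma ft_poisson s (e x : R) (g : R -> C) : s ^+ 2 = 1 -> 0 < e ->
  cintegrable g ->
  cint (fun xi => expi (s * x * xi) *
    ((expR (- (e * `|xi|)))%:C * ft (- s) g xi)) =
  kap%:C * cint (fun y => g y * (2 * e / (e ^+ 2 + (x - y) ^+ 2))%:C).
Proof.
move=> s1 e0 ig.
have E1 y : cint (fun xi => expi (- s * y * xi) *
      (expi (s * x * xi) * (expR (- (e * `|xi|)))%:C)) =
    (2 * e / (e ^+ 2 + (x - y) ^+ 2))%:C.
  have E xi : expi (- s * y * xi) * (expi (s * x * xi) * (expR (- (e * `|xi|)))%:C) =
     expi ((s * (x - y)) * xi) * (expR (- (e * `|xi|)))%:C.
    by rewrite mulrA -expiD; congr (expi _ * _); ring.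
  by rewrite (eq_cint E) (cint_poisson (s * (x - y)) e0) exprMn s1 mul1r.
pose f (xi : R) : C := expi (s * x * xi) * (expR (- (e * `|xi|)))%:C.
have if_ : cintegrable f.
  apply: (cintegrable_le _ (Li_expR_abs 0 e0)).
    apply: cmeasM; first exact: cmeas_kernel1'.
    exact: cmeas_real (meas_expR_abs 0 e0).
  by move=> xi; rewrite normcM normc_expi mul1r normc_real ger0_norm ?expR_ge0.
have [i2 e2] := @cfubini_prod _ f g (fun z => expi (- s * z.2 * z.1)) 1 if_ ig
  (cmeas_kernel (- s)) (fun z => normc_expi_le _).
have E xi : expi (s * x * xi) * ((expR (- (e * `|xi|)))%:C * ft (- s) g xi) =
    kap%:C * (f xi * cint (fun y => expi (- s * y * xi) * g y)).
  by rewrite mulrA mulrCA.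
rewrite (eq_cint E) (cintZ _ i2) e2; congr (_ * _); apply: eq_cint => y.
by congr (_ * _); exact: E1.
Qed.

(** The Abel mean of the squared modulus of the transform of h is the Poisson mean
    of h paired with h; as e tends to 0 the right hand side tends to the squared
    norm of h. *)
Lemma abel_mean s h (e : R) : s ^+ 2 = 1 -> 0 < e -> nice h ->
  cint (fun xi => (expR (- (e * `|xi|)) * normc (ft s h xi) ^+ 2)%:C) =
  (pi^-1)%:C *
  cint (fun x => h x * poisson_mean h e x).
Proof.
move=> s1 e0 hn; have [mh [B hB] _ _] := hn; have ih := nice_integrable hn.
have ihc : cintegrable (fun x => (h x)^*).
  apply: (cintegrable_le _ (cintegrable_normc ih)); first exact: cmeas_conj.
  by move=> x; rewrite normc_conj.
have ihQ : cintegrable (fun x => h x * poisson_mean h e x).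
  apply: (cintegrable_le _ (LiZ (B * pi) (cintegrable_normc ih))).
    by apply: cmeasM; [exact: mh|exact: cmeas_poisson_mean].
  move=> x; rewrite normcM mulrC ler_wpM2r ?normc_ge0//.
  exact: poisson_mean_le.
have E2 x : cint (fun xi => expi (s * x * xi) * ((expR (- (e * `|xi|)))%:C *
     ft (- s) (fun x => (h x)^*) xi)) = (kap * 2)%:C * poisson_mean h e x.
  by rewrite (ft_poisson x s1 e0 ihc) (poisson_scaled x e0 ih) mulrA realcM.
pose f xi := (expR (- (e * `|xi|)))%:C * ft (- s) (fun x => (h x)^*) xi.
have if_ : cintegrable f.
  apply: (cintegrable_le _ (LiZ (kap * \int[mu]_x normc ((h x)^*))
    (Li_expR_abs 0 e0))).
    apply: cmeasM; last exact: cmeas_ft.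
    exact: cmeas_real (meas_expR_abs 0 e0).
  move=> xi; rewrite /f normcM normc_real ger0_norm ?expR_ge0// mulrC.
  by rewrite ler_wpM2r ?expR_ge0// normc_ft_le.
have E1 (xi : R) : (expR (- (e * `|xi|)) * normc (ft s h xi) ^+ 2)%:C =
    kap%:C * (f xi * cint (fun x => expi (s * x * xi) * h x)).
  rewrite [RHS]mulrCA -/(ft s h xi) /f -(ft_conj s ih).
  by rewrite (realcM _ (normc (ft s h xi) ^+ 2)) normc_sqC mulrA.
have [i1 e1] := @cfubini_prod _ f h (fun z => expi (s * z.2 * z.1)) 1 if_ ih
  (cmeas_kernel s) (fun z => normc_expi_le _).
rewrite (eq_cint E1) (cintZ _ i1) e1.
have E3 x : h x * cint (fun xi => expi (s * x * xi) * f xi) =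
    (kap * 2)%:C * (h x * poisson_mean h e x) by rewrite E2 mulrCA.
rewrite (eq_cint E3) (cintZ _ ihQ) mulrA -realcM; congr (_%:C * _).
by rewrite mulrA -expr2 kap_sq invfM mulrAC mulVf ?mul1r// pnatr_eq0.
Qed.

(** Let e tend to 0 in [abel_mean]: the left hand side converges by monotone
    convergence, the right hand side by dominated convergence. *)
Lemma plancherel_nice s h : s ^+ 2 = 1 -> nice h ->
  L2 (ft s h) /\ nr (ft s h) = nr h.
Proof.
move=> s1 hn; have [mh [B hB] [A hA] hc] := hn.
have ih := nice_integrable hn; have hL := nice_L2 hn.
pose e m : R := m.+1%:R^-1.
have e0 m : 0 < e m by rewrite invr_gt0.
have B0 : 0 <= B by apply: le_trans (hB 0); exact: normc_ge0.
have mf := cmeas_ft s ih.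
pose I m := \int[mu]_xi (expR (- (e m * `|xi|)) * normc (ft s h xi) ^+ 2).
have EI m : (I m)%:C = (pi^-1)%:C * cint (fun x => h x * poisson_mean h (e m) x).
  by rewrite -(abel_mean s1 (e0 m) hn) cint_real.
have lim1 : ccvg (fun m => cint (fun x => h x * poisson_mean h (e m) x))
    (cint (fun x => h x * (pi%:C * (h x)^*))).
  apply: (@cint_dct _ _ _ (fun x => B * pi * normc (h x))).
  - by move=> m; apply: cmeasM => //; exact: cmeas_poisson_mean.
  - by apply: cmeasM => //; apply: cmeasZ; exact: cmeas_conj.
  - exact: LiZ (cintegrable_normc ih).
  - apply: ae_all => x m; rewrite normcM mulrC ler_wpM2r ?normc_ge0//.
    exact: poisson_mean_le.
  - apply: (ae_mono hc) => x hx; apply: ccvgZ.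
    have -> : pi%:C * (h x)^* = cint (fun t => (1 + t ^+ 2)^-1%:C * (h x)^*).
      transitivity (cint (fun t : R => (h x)^* * (1 + t ^+ 2)^-1%:C)).
        rewrite cintZ; last first.
          apply: (cintegrable_le _ Li_oneDsqrV).
            exact: (cmeas_real meas_oneDsqrV).
          by move=> t; rewrite normc_real ger0_norm ?oneDsqrV_ge0.
        by rewrite cint_real Rint_oneDsqrV mulrC.
      by apply: eq_cint => t; rewrite mulrC.
    apply: (@cint_dct _ _ _ (fun t => B * (1 + t ^+ 2)^-1)).
    - move=> m; exact: cintegrable_meas (poisson_mean_integrable (e m) x mh hB).
    - apply: cmeasM; last exact: cmeas_cst.
      exact: (cmeas_real meas_oneDsqrV).
    - exact: LiZ Li_oneDsqrV.
    - apply: ae_all => t m; rewrite normcM normc_conj normc_real.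
      by rewrite ger0_norm ?oneDsqrV_ge0// mulrC ler_wpM2r ?oneDsqrV_ge0.
    - apply: ae_all => t; apply: ccvgZ.
      apply: (cvg0_le _ _ (hx t)) => m; first exact: normc_ge0.
      by rewrite -rmorphB /= normc_conj.
have lim2 : I m @[m --> \oo] --> nr h ^+ 2.
  have E : (pi^-1)%:C * cint (fun x => h x * (pi%:C * (h x)^*)) = (nr h ^+ 2)%:C.
    rewrite (_ : (fun x => _) = (fun x => (pi * normc (h x) ^+ 2)%:C)).
      rewrite cint_real -realcM RintegralZl//; last exact: L2_sq.
      by rewrite -nr_sq mulrA mulVf ?mul1r// gt_eqF// pi_gt0.
    apply/funext => x; rewrite (realcM pi (normc (h x) ^+ 2)) normc_sqC.
    by rewrite mulrCA [h x * _]mulrC.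
  have := ccvgZ (pi^-1)%:C lim1; rewrite E => /ccvgP[+ _].
  by under eq_fun do rewrite -EI.
have lim3 : (\int[mu]_xi (expR (- (e m * `|xi|)) * normc (ft s h xi) ^+ 2)%:E
   @[m --> \oo] --> \int[mu]_xi (normc (ft s h xi) ^+ 2)%:E)%E.
  have mn : measurable_fun setT (fun xi => normc (ft s h xi) ^+ 2).
    by apply: measurable_funX; exact: meas_normc.
  have em xi : expR (- (e m * `|xi|)) * normc (ft s h xi) ^+ 2 @[m --> \oo] -->
      normc (ft s h xi) ^+ 2.
    have a1 : e m * `|xi| @[m --> \oo] --> (0 : R).
      by apply: cvgMc0; exact: cvg_harmonic.
    have a2 : expR (- (e m * `|xi|)) @[m --> \oo] --> (1 : R).
      have := cvg_comp _ _ (cvgN a1) (@continuous_expR R (- 0)).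
      by rewrite oppr0 expR0; exact.
    exact: cvgMc1.
  rewrite (_ : (\int[mu]_xi (normc (ft s h xi) ^+ 2)%:E)%E = (\int[mu]_xi
     limn (fun m => (expR (- (e m * `|xi|)) * normc (ft s h xi) ^+ 2)%:E))%E).
    apply: cvg_monotone_convergence => //.
    - move=> m; apply/measurable_EFinP; apply: measurable_funM => //.
      exact: (meas_expR_abs 0 (e0 m)).
    - by move=> m xi _; rewrite lee_fin mulr_ge0 ?expR_ge0 ?sqr_ge0.
    - move=> xi _ m n mn'; rewrite lee_fin ler_wpM2r ?sqr_ge0// ler_expR lerN2.
      by rewrite ler_wpM2r// lef_pV2 ?posrE// ler_nat ltnS.
  apply: eq_integral => xi _; apply/esym/cvg_lim => //.
  by apply/fine_cvgP; split; [exact: nearW|exact: em].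
have iI m : Li (fun xi => expR (- (e m * `|xi|)) * normc (ft s h xi) ^+ 2).
  pose K := kap * \int[mu]_x normc (h x).
  apply: (Li_le _ (LiZ (K ^+ 2) (Li_expR_abs 0 (e0 m)))).
    apply: measurable_funM; first exact: (meas_expR_abs 0 (e0 m)).
    by apply: measurable_funX; exact: meas_normc.
  move=> xi; rewrite ger0_norm; last by rewrite mulr_ge0 ?expR_ge0// sqr_ge0.
  rewrite mulrC ler_wpM2r ?expR_ge0//; have nK : normc (ft s h xi) <= K.
    exact: normc_ft_le.
  by rewrite ler_sqr// nnegrE; [exact: normc_ge0|apply: le_trans nK; exact: normc_ge0].
have E : (\int[mu]_xi (normc (ft s h xi) ^+ 2)%:E = (nr h ^+ 2)%:E)%E.
  have lim4 : (I m)%:E @[m --> \oo] --> (nr h ^+ 2)%:E.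
    by apply/fine_cvgP; split; [exact: nearW|exact: lim2].
  have E4 : (fun m => (I m)%:E) = (fun m => \int[mu]_xi
      (expR (- (e m * `|xi|)) * normc (ft s h xi) ^+ 2)%:E)%E.
    by apply/funext => k; rewrite (Rint_EFin (iI k)).
  rewrite E4 in lim4.
  exact: (cvg_unique _ lim3 lim4).
have iL : Li (fun xi => normc (ft s h xi) ^+ 2).
  apply: LiP; first by apply: measurable_funX; exact: meas_normc.
    by move=> x; exact: sqr_ge0.
  by rewrite E ltry.
split; first exact/L2P.
by rewrite /nr /Rintegral E /= sqrtr_sqr ger0_norm ?nr_ge0.
Qed.

End FourierIntegral.

(** * Truncation to bounded intervals *)

Section Cutoff.
Context {R : realType}.
Local Notation C := R[i].
Local Notation mu := (@lebesgue_measure R).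
Local Notation Li f := (mu.-integrable setT (EFin \o f)).
Implicit Types (u v h f : R -> C) (s : R).

Lemma cutoffE n u x : cutoff n u x = if - n%:R <= x <= n%:R then u x else 0.
Proof.
rewrite /cutoff; congr (if _ then _ else _).
by apply/idP/idP => [/set_mem|h]; [|apply/mem_set]; rewrite /= in_itv.
Qed.

Lemma cmeas_cutoff n u : cmeas u -> cmeas (cutoff n u).
Proof.
by move=> mu_; apply: cmeas_if => //; exact: cmeas_cst.
Qed.

Lemma normc_cutoff_le n u x : normc (cutoff n u x) <= normc (u x).
Proof. by rewrite /cutoff; case: ifP => // _; rewrite normc0 normc_ge0. Qed.

Lemma L2_cutoff n u : L2 u -> L2 (cutoff n u).
Proof.
move=> hu; apply: (L2_le _ hu); first exact/cmeas_cutoff/L2_meas.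
by move=> x; exact: normc_cutoff_le.
Qed.

Lemma cutoff_eventually u x : exists N, forall n, (N <= n)%N -> cutoff n u x = u x.
Proof.
exists (Num.trunc `|x|).+1 => n hn; rewrite cutoffE -ler_norml.
suff -> : `|x| <= n%:R by [].
by rewrite ltW//; apply: lt_le_trans (truncnS_gt _) _; rewrite ler_nat.
Qed.

Lemma eventually_ccvg (z : nat -> C) (w : C) :
  (exists N, forall n, (N <= n)%N -> z n = w) -> ccvg z w.
Proof.
move=> [N hN]; apply/(cvg0P (fun n => normc_ge0 _)) => e e0; exists N => n Nn.
by rewrite hN// subrr normc0.
Qed.

Lemma eventually_eq_ccvg (z z' : nat -> C) (w : C) :
  (exists N, forall n, (N <= n)%N -> z n = z' n) -> ccvg z' w -> ccvg z w.
Proof.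
move=> [N hN] /(cvg0P (fun n => normc_ge0 _)) h.
apply/(cvg0P (fun n => normc_ge0 _)) => e /h [M hM]; exists (maxn N M) => n.
by rewrite geq_max => /andP[Nn Mn]; rewrite hN// hM.
Qed.

Lemma cutoff_cvg u : L2 u -> nr (fun x => cutoff n u x - u x) @[n --> \oo] --> (0 : R).
Proof.
move=> hu; have /L2P[mu_ iu] := hu.
apply: (@L2_dct0 _ _ (fun x => 2 * normc (u x))).
- by move=> n; apply: cmeasB => //; exact: cmeas_cutoff.
- by under [X in mu.-integrable _ (_ \o X)]eq_fun do rewrite exprMn; exact: LiZ.
- apply: ae_all => x n; rewrite (le_trans (normcD _ _))// normcN mulrDl mul1r.
  by rewrite lerD2r normc_cutoff_le.
- apply: ae_all => x; rewrite -(subrr (u x)).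
  apply: ccvgD; last exact: ccvg_cst.
  exact/eventually_ccvg/cutoff_eventually.
Qed.

Definition supp n u : Prop := forall x, n%:R < `|x| -> u x = 0.

Lemma cutoff_out n u x : n%:R < `|x| -> cutoff n u x = 0.
Proof. by move=> hx; rewrite cutoffE -ler_norml leNgt hx. Qed.

Lemma cutoff_in n u x : `|x| <= n%:R -> cutoff n u x = u x.
Proof. by move=> hx; rewrite cutoffE -ler_norml hx. Qed.

Lemma supp_cutoff n u : supp n (cutoff n u).
Proof. by move=> x; exact: cutoff_out. Qed.

Lemma suppB n u v : supp n u -> supp n v -> supp n (fun x => u x - v x).
Proof. by move=> hu hv x hx; rewrite hu// hv// subr0. Qed.

Lemma supp_widen m n u : (m <= n)%N -> supp m u -> supp n u.
Proof.
by move=> mn hu x hx; rewrite hu//; apply: le_lt_trans hx; rewrite ler_nat.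
Qed.

Definition box n : R -> C := cutoff n (fun=> 1).

Lemma L2_box n : L2 (box n).
Proof.
apply/L2P; split; first by apply: cmeas_cutoff; exact: cmeas_cst.
apply: (@compact_bounded_integrable _ _ n%:R 1).
- by apply: measurable_funX; apply: meas_normc; apply: cmeas_cutoff; exact: cmeas_cst.
- move=> x; rewrite ger0_norm ?sqr_ge0// expr_le1 ?normc_ge0//.
  by rewrite (le_trans (normc_cutoff_le _ _ _))// normc1.
- by move=> x hx; rewrite /box cutoff_out// normc0 expr0n.
Qed.

Lemma supp_mul n u : supp n u -> (fun x => box n x * u x) = u.
Proof.
move=> hu; apply/funext => x; rewrite /box.
have [h|h] := leP `|x| n%:R; first by rewrite cutoff_in// mul1r.
by rewrite cutoff_out// mul0r hu.
Qed.

(** Multiply by the indicator of the interval and use Cauchy-Schwarz. *)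
Lemma supp_integrable n u : supp n u -> L2 u -> cintegrable u.
Proof. by move=> hu Lu; rewrite -(supp_mul hu); apply: L2_cintegrable => //; exact: L2_box. Qed.

Lemma supp_L1_le n u : supp n u -> L2 u ->
  \int[mu]_x normc (u x) <= nr (box n) * nr u.
Proof.
move=> hu Lu; apply: le_trans (cauchy_schwarz (L2_box n) Lu).
rewrite le_eqVlt; apply/orP; left; apply/eqP/eqRint => x.
by rewrite -normcM -[in LHS](supp_mul hu).
Qed.

(** The regularity clause of [nice] can fail only at the two end points. *)
Lemma nice_cutoff n (g1 g2 : R -> R) (B : R) : continuous g1 -> continuous g2 ->
  (forall x, `|g1 x| <= B) -> (forall x, `|g2 x| <= B) ->
  nice (cutoff n (fun x => g1 x +i* g2 x)).
Proof.
move=> c1 c2 b1 b2; split.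
- by apply: cmeas_cutoff; split; exact: continuous_measurable_fun.
- exists (B + B) => x; apply: (le_trans (normc_cutoff_le _ _ _)).
  by apply: (le_trans (normc_le_ReIm _)); exact: (lerD (b1 x) (b2 x)).
- by exists n%:R => x hx; rewrite cutoff_out.
- have hneg : mu.-negligible ([set - n%:R] `|` [set n%:R] : set R).
    have h1 (a : R) : mu.-negligible ([set a] : set R).
      exists [set a]; split => //; exact: lebesgue_measure_set1.
    exact: negligibleU.
  apply: (negligibleS _ hneg) => x /= hx.
  apply: contrapT => /not_orP[xn1 xn2]; apply: hx => t; move: (x : R) xn1 xn2.
  move=> {}x xn1 xn2.
  have xt : x + m.+1%:R^-1 * t @[m --> \oo] --> x.
    have h0 : m.+1%:R^-1 * t @[m --> \oo] --> (0 : R).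
      by apply: cvgMc0; exact: cvg_harmonic.
    by have := cvgD (@cvg_cst _ x nat \oo _) h0; rewrite addr0; exact.
  have nt : `|x + m.+1%:R^-1 * t| @[m --> \oo] --> (`|x| : R).
    by apply: cvg_norm; exact: xt.
  have [h|h] := leP `|x| n%:R.
    have {}h : `|x| < n%:R.
      rewrite lt_neqAle h andbT; apply/eqP => E.
      have [x0|x0] := leP 0 x.
        by apply: xn2; rewrite -E ger0_norm.
      by apply: xn1; rewrite -E ltr0_norm// opprK.
    have [N _ hN] := cvgr_lt _ nt _ h.
    apply: (eventually_eq_ccvg (z' := fun m =>
      g1 (x + m.+1%:R^-1 * t) +i* g2 (x + m.+1%:R^-1 * t))).
      by exists N => m /hN /= hm; rewrite cutoff_in// ltW.
    rewrite cutoff_in ?ltW//; apply/ccvgP; split => /=.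
      exact: (cvg_comp _ g1 xt (c1 x)).
    exact: (cvg_comp _ g2 xt (c2 x)).
  have [N _ hN] := cvgr_gt _ nt _ h.
  apply: (eventually_eq_ccvg (z' := fun=> 0)).
    by exists N => m /hN /= hm; rewrite cutoff_out.
  by rewrite cutoff_out//; exact: ccvg_cst.
Qed.

End Cutoff.

(** * Approximation by continuous functions *)

Section Density.
Context {R : realType}.
Local Notation C := R[i].
Local Notation mu := (@lebesgue_measure R).
Local Notation Li f := (mu.-integrable setT (EFin \o f)).
Implicit Types (u v h f : R -> C) (s : R).

(** Clipping a continuous approximation to [-B, B] keeps it continuous and, as the
    target takes its values there, does not increase the error. *)
Definition clip (B y : R) : R := Num.max (- B) (Num.min B y).

Lemma clip_norm B y : 0 <= B -> `|clip B y| <= B.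
Proof.
move=> B0; rewrite ler_norml /clip le_max lexx /= ge_max ge_min lexx.
by rewrite andbT; lra.
Qed.

Lemma clip_dist B p y : `|p| <= B -> `|p - clip B y| <= `|p - y|.
Proof.
rewrite ler_norml /clip => /andP[p1 p2].
have [h1|h1] := leP B y.
  have [h2|h2] := leP (- B) B; last by lra.
  rewrite !ler0_norm; lra.
have [h2|h2] := leP (- B) y; first by [].
rewrite !ger0_norm; lra.
Qed.

Lemma clip_continuous B (g : R -> R) : continuous g ->
  continuous (fun x => clip B (g x)).
Proof.
move=> cg x; apply: (@continuous_max _ _ _ _ x); first exact: cst_continuous.
by apply: (@continuous_min _ _ _ _ x); [exact: cst_continuous|exact: cg].
Qed.

(** An approximation in the mean of order one becomes one of order two, since both
    functions are bounded by B: the square of the error is at most 2 B times the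
    error. *)
Lemma continuous_approx n (p : R -> R) (B e : R) : measurable_fun setT p ->
  (forall x, `|p x| <= B) -> 0 < e ->
  exists g : R -> R, [/\ continuous g, forall x, `|g x| <= B &
    \int[mu]_x (if `|x| <= n%:R then (p x - g x) ^+ 2 else 0) <= 2 * B * e].
Proof.
move=> mp pB e0.
have B0 : 0 <= B by apply: le_trans (pB 0).
pose E : set R := `[- n%:R, n%:R]%classic.
have mE : measurable E by exact: measurable_itv.
have muE : (mu E < +oo)%E.
  rewrite /E lebesgue_measure_itv /=; case: ifP => // _.
  by rewrite -EFinB ltry.
have ip : mu.-integrable E (EFin \o p).
  apply: measurable_bounded_integrable => //; first exact: measurable_funTS.
  exists B; split; first exact: num_real.
  by move=> M BM x _; exact: le_trans (pB x) (ltW BM).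
have [g_ [cg ig gp]] := approximation_continuous_integrable mE muE ip.
have [k hk] : exists k, (\int[mu]_(z in E) `|(p z - g_ k z)%:E| < e%:E)%E.
  have /fine_cvgP[[N1 _ h1] /cvgrPdist_lt /(_ _ e0) [N2 _ h2]] := gp.
  exists (maxn N1 N2); have /= f1 := h1 (maxn N1 N2) (leq_maxl _ _).
  have /= := h2 (maxn N1 N2) (leq_maxr _ _).
  rewrite sub0r normrN ger0_norm ?fine_ge0 ?integral_ge0// => h.
  by rewrite -(fineK f1) lte_fin.
exists (fun x => clip B (g_ k x)); split.
- exact: clip_continuous.
- by move=> x; exact: clip_norm.
pose D x : R := if `|x| <= n%:R then `|p x - g_ k x| else 0.
have E1 x : (x \in E) = (`|x| <= n%:R).
  rewrite ler_norml; apply/idP/idP => [/set_mem|h]; last apply/mem_set;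
    by rewrite /E /= in_itv.
have DE : (\int[mu]_x (D x)%:E = \int[mu]_(z in E) `|(p z - g_ k z)%:E|)%E.
  rewrite [RHS]integral_mkcond; apply: eq_integral => x _.
  by rewrite /patch E1 /D; case: ifP.
have mb : measurable_fun setT (fun x : R => `|x| <= n%:R).
  by apply: measurable_fun_ler; [by apply: continuous_measurable_fun; exact: norm_continuous|exact: measurable_cst].
have mg : measurable_fun setT (g_ k) by exact: continuous_measurable_fun.
have iD : Li D.
  apply: LiP.
  - apply: measurable_fun_ifT => //.
    by apply: measurableT_comp => //; exact: measurable_funB.
  - by move=> x; rewrite /D; case: ifP.
  - by rewrite DE (lt_trans hk)// ltry.
have le1 x : (if `|x| <= n%:R then (p x - clip B (g_ k x)) ^+ 2 else 0) <=
    2 * B * D x.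
  rewrite /D; case: ifP => _; last by rewrite mulr0.
  rewrite -real_normK ?num_real// expr2; apply: ler_pM => //.
    apply: (le_trans (ler_normB _ _)); rewrite mulrDl mul1r lerD//.
    exact: clip_norm.
  exact: clip_dist.
have ge1 x : 0 <= (if `|x| <= n%:R then (p x - clip B (g_ k x)) ^+ 2 else 0).
  by case: ifP => // _; exact: sqr_ge0.
apply: (@le_trans _ _ (\int[mu]_x (2 * B * D x))).
  apply: le_Rint => //; last exact: LiZ.
  apply: (Li_le _ (LiZ (2 * B) iD)); last by move=> x; rewrite ger0_norm.
  apply: measurable_fun_ifT => //.
  apply: measurable_funX; apply: measurable_funB => //.
  by apply: continuous_measurable_fun; exact: clip_continuous.
rewrite RintegralZl// ler_wpM2l ?mulr_ge0//.
by rewrite -lee_fin Rint_EFin// DE ltW.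
Qed.

Lemma nice_dense_bounded n f (B e : R) : cmeas f -> supp n f ->
  (forall x, normc (f x) <= B) -> 0 < e ->
  exists h, [/\ nice h, supp n h & nr (fun x => f x - h x) < e].
Proof.
move=> [m1 m2] sf fB e0; have B0 : 0 <= B by apply: le_trans (fB 0); exact: normc_ge0.
(* The two components contribute 2 B d each, in total less than e^2. *)
pose d := e ^+ 2 / (8 * (B + 1)).
have B1 : 0 < B + 1 by rewrite ltr_pwDr.
have d0 : 0 < d by rewrite divr_gt0 ?exprn_gt0// mulr_gt0.
have [g1 [c1 b1 i1]] := continuous_approx n m1 (fun x => le_trans (normRe_le _) (fB x)) d0.
have [g2 [c2 b2 i2]] := continuous_approx n m2 (fun x => le_trans (normIm_le _) (fB x)) d0.
have hn := nice_cutoff n c1 c2 b1 b2.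
exists (cutoff n (fun x => g1 x +i* g2 x)); split => //; first exact: supp_cutoff.
have mb : measurable_fun setT (fun x : R => `|x| <= n%:R).
  by apply: measurable_fun_ler; [by apply: continuous_measurable_fun; exact: norm_continuous|exact: measurable_cst].
have Lq (q g : R -> R) : measurable_fun setT q -> continuous g ->
    (forall x, `|q x| <= B) -> (forall x, `|g x| <= B) ->
    Li (fun x => if `|x| <= n%:R then (q x - g x) ^+ 2 else 0).
  move=> mq cg qB gB; apply: (@compact_bounded_integrable _ _ n%:R ((B + B) ^+ 2)).
  - apply: measurable_fun_ifT => //.
    apply: measurable_funX; apply: measurable_funB => //.
    exact: continuous_measurable_fun.
  - move=> x; case: ifP => _; last by rewrite normr0 sqr_ge0.
    rewrite normrX; apply: lerXn2r; rewrite ?nnegrE ?addr_ge0//.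
    by apply: (le_trans (ler_normB _ _)); rewrite lerD.
  - by move=> x; rewrite ltNge => /negbTE ->.
rewrite -ltr_sqr ?nnegrE ?nr_ge0 ?(ltW e0)// nr_sq.
rewrite (_ : \int[mu]_x _ =
  \int[mu]_x (if `|x| <= n%:R then (Re (f x) - g1 x) ^+ 2 else 0) +
  \int[mu]_x (if `|x| <= n%:R then (Im (f x) - g2 x) ^+ 2 else 0)); last first.
  rewrite -RintegralD//; [|apply: Lq => //|apply: Lq => //].
  - apply: eqRint => x; case: ifP => hx.
      by rewrite cutoff_in// normc_sq ReDE ImDE ReNE ImNE.
    have hx' : n%:R < `|x| by rewrite ltNge hx.
    by rewrite cutoff_out// sf// subr0 normc0 expr0n addr0.
  - by move=> x; exact: le_trans (normRe_le _) (fB x).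
  - by move=> x; exact: le_trans (normIm_le _) (fB x).
apply: (le_lt_trans (lerD i1 i2)).
rewrite (_ : _ + _ = e ^+ 2 * (B / (B + 1) / 2)); last first.
  by rewrite /d; field; rewrite gt_eqF.
rewrite gtr_pMr ?exprn_gt0// ltr_pdivrMr// ltr_pdivrMr//; lra.
Qed.

Lemma nice_dense n f (e : R) : L2 f -> supp n f -> 0 < e ->
  exists h, [/\ nice h, supp n h & nr (fun x => f x - h x) < e].
Proof.
move=> Lf sf e0; have /L2P[mf if_] := Lf.
(* Truncating the values reduces to the bounded case. *)
pose f_ (k : nat) x : C := if normc (f x) <= k%:R then f x else 0.
have f_le k x : normc (f_ k x) <= normc (f x).
  by rewrite /f_; case: ifP => //; rewrite normc0 normc_ge0.
have mf_ k : cmeas (f_ k).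
  rewrite (_ : f_ k = fun x =>
      (if normc (f x) <= k%:R then 1 else 0)%:C * f x); last first.
    by apply/funext => x; rewrite /f_; case: ifP => _; rewrite ?mul1r ?mul0r.
  apply: cmeasM => //; apply: cmeas_real; apply: measurable_fun_ifT => //.
  by apply: measurable_fun_ler => //; exact: meas_normc.
have cv : nr (fun x => f_ k x - f x) @[k --> \oo] --> (0 : R).
  apply: (@L2_dct0 _ _ (fun x => 2 * normc (f x))).
  - by move=> k; exact: cmeasB.
  - by under [X in mu.-integrable _ (_ \o X)]eq_fun do rewrite exprMn; exact: LiZ.
  - apply: ae_all => x k; rewrite (le_trans (normcD _ _))// normcN mulrDl mul1r.
    by rewrite lerD2r f_le.
  - apply: ae_all => x; rewrite -(subrr (f x)).
    apply: ccvgD; last exact: ccvg_cst.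
    apply: eventually_ccvg; exists (Num.trunc (normc (f x))).+1 => k hk.
    rewrite /f_ ltW//; apply: lt_le_trans (truncnS_gt _) _; rewrite ler_nat//.
have e20 : 0 < e / 2 by rewrite divr_gt0.
have [N hN] := (cvg0P (fun n => nr_ge0 _)).1 cv _ e20.
have LfN : L2 (f_ N) by exact: L2_le (mf_ N) Lf (f_le N).
have [||h [nh sh fh]] := @nice_dense_bounded n (f_ N) N%:R (e / 2) (mf_ N) _ _ e20.
- by move=> x hx; rewrite /f_ sf//; case: ifP.
- by move=> x; rewrite /f_; case: ifP => //; rewrite normc0.
exists h; split => //; apply: (le_lt_trans (nr_triangle Lf LfN (nice_L2 nh))).
by rewrite [X in _ < X]splitr ltrD// nr_subC hN.
Qed.

End Density.

(** * The Fourier transform on L2 *)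

Section FourierL2.
Context {R : realType}.
Local Notation C := R[i].
Local Notation mu := (@lebesgue_measure R).
Local Notation Li f := (mu.-integrable setT (EFin \o f)).
Implicit Types (u v w h f : R -> C) (s : R).

(** Approximate f by nice functions in the mean; on a fixed bounded interval their
    transforms converge pointwise, and Fatou's lemma bounds the limit. *)
Lemma plancherel_supp_le s n f : s ^+ 2 = 1 -> L2 f -> supp n f ->
  L2 (ft s f) /\ nr (ft s f) <= nr f.
Proof.
move=> s1 Lf sf; have if_ := supp_integrable sf Lf.
suff key (e : R) : 0 < e -> L2 (ft s f) /\ nr (ft s f) <= nr f + e.
  split; first by case: (key 1 ltr01).
  by apply/ler_addgt0Pl => e e0; rewrite addrC; case: (key e e0).
move=> e0; pose d k : R := e * k.+1%:R^-1.
have d0 k : 0 < d k by rewrite mulr_gt0// invr_gt0.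
have de k : d k <= e by rewrite ler_piMr ?(ltW e0)// invf_le1// ler1n.
have [h hP] := choice (fun k => nice_dense Lf sf (d0 k)).
have nh k : nice (h k) by case: (hP k).
have sh k : supp n (h k) by case: (hP k).
have fh k : nr (fun x => f x - h k x) < d k by case: (hP k).
have Lh k := nice_L2 (nh k).
apply: (@fatou_L2 _ (fun k => ft s (h k))).
- by move=> k; case: (plancherel_nice s1 (nh k)).
- exact: cmeas_ft.
- apply: ae_all => xi.
  rewrite /ccvg; apply: (@cvg0_le _ _ (fun k => kap * (nr (box n) * d k))).
  + by move=> k; exact: normc_ge0.
  + move=> k; have ih := nice_integrable (nh k).
    have -> : ft s (h k) xi - ft s f xi = ft s (fun x => h k x - f x) xi.
      by rewrite (ftB s ih if_).
    apply: (le_trans (normc_ft_le s xi (cintegrableB ih if_))).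
    rewrite ler_pM2l ?kap_gt0//.
    apply: (le_trans (supp_L1_le (suppB (sh k) sf) (L2B (Lh k) Lf))).
    by rewrite ler_wpM2l ?nr_ge0// nr_subC ltW.
  + apply: cvg0Z; apply: cvg0Z; apply: cvg0Z; exact: cvg_harmonic.
- move=> k; have [_ ->] := plancherel_nice s1 (nh k).
  have := nr_sub_dist (Lh k) Lf; rewrite nr_subC => h1.
  have := le_trans (ler_norm _) h1; have := fh k; have := de k; lra.
Qed.

Lemma chain_bound (a b c d e f : R) : a - b <= c -> c < e / 2 -> d <= c ->
  b - f <= d -> a <= e + f.
Proof. lra. Qed.

(** The reverse inequality follows by applying the direct one to f - h, for h nice
    and close to f. *)
Lemma plancherel_supp s n f : s ^+ 2 = 1 -> L2 f -> supp n f ->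
  L2 (ft s f) /\ nr (ft s f) = nr f.
Proof.
move=> s1 Lf sf; have [LF Fle] := plancherel_supp_le s1 Lf sf.
split => //; apply/eqP; rewrite eq_le Fle /=; apply/ler_addgt0Pl => e e0.
have e20 : 0 < e / 2 by rewrite divr_gt0.
have [h [nh sh fh]] := nice_dense Lf sf e20.
have Lh := nice_L2 nh; have [LFh Fh] := plancherel_nice s1 nh.
have := plancherel_supp_le s1 (L2B Lf Lh) (suppB sf sh).
rewrite (ftB s (supp_integrable sf Lf) (nice_integrable nh)) => -[_ h1].
have h2 := le_trans (ler_norm _) (nr_sub_dist Lf Lh).
have := nr_sub_dist LFh LF.
rewrite (nr_subC (ft s h) (ft s f)) => /(le_trans (ler_norm _)) h3.
rewrite Fh in h3; exact: (chain_bound h2 fh h1 h3).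
Qed.

Lemma L2_ft_cutoff s n u : s ^+ 2 = 1 -> L2 u -> L2 (ft s (cutoff n u)).
Proof.
by move=> s1 Lu; case: (plancherel_supp s1 (L2_cutoff n Lu) (@supp_cutoff _ n u)).
Qed.

Lemma nr_ft_cutoff s n u : s ^+ 2 = 1 -> L2 u ->
  nr (ft s (cutoff n u)) = nr (cutoff n u).
Proof.
by move=> s1 Lu; case: (plancherel_supp s1 (L2_cutoff n Lu) (@supp_cutoff _ n u)).
Qed.

(** The definition in terms of real norms and of Fourier integrals of truncations;
    here s^2 = 1 covers the transform and its inverse at once. *)
Lemma is_fourierP s u v : s ^+ 2 = 1 -> is_fourier s u v <-> [/\ L2 u, L2 v &
  nr (fun xi => ft s (cutoff n u) xi - v xi) @[n --> \oo] --> (0 : R)].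
Proof.
move=> s1.
have E n : fourier_trunc s n u = ft s (cutoff n u) := fourier_truncE s n u.
have key : L2 u -> L2 v ->
  (L2norm (fun xi => fourier_trunc s n u xi - v xi) @[n --> \oo] --> 0%E) <->
  (nr (fun xi => ft s (cutoff n u) xi - v xi) @[n --> \oo] --> (0 : R)).
  move=> Lu Lv.
  have L n : L2 (fun xi => fourier_trunc s n u xi - v xi).
    by rewrite E; apply: L2B Lv; exact: L2_ft_cutoff.
  have <- : (fun n => nr (fun xi => fourier_trunc s n u xi - v xi)) =
            (fun n => nr (fun xi => ft s (cutoff n u) xi - v xi)).
    by apply/funext => n; rewrite E.
  exact: L2norm_cvg0.
by split=> -[Lu Lv h]; split; [exact: Lu|exact: Lv|exact: (key Lu Lv).1|
  exact: Lu|exact: Lv|exact: (key Lu Lv).2].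
Qed.

Lemma cutoff_integrable n u : L2 u -> cintegrable (cutoff n u).
Proof. by move=> Lu; apply: supp_integrable (L2_cutoff n Lu); exact: supp_cutoff. Qed.

(** By Plancherel for functions with bounded support, the transforms of the
    truncations form a Cauchy sequence. *)
Lemma fourier_exists s u : s ^+ 2 = 1 -> L2 u -> exists v, is_fourier s u v.
Proof.
move=> s1 Lu.
have [|e e0|v Lv hv] := @L2_complete _ (fun n => ft s (cutoff n u)).
- by move=> n; exact: L2_ft_cutoff.
- have e20 : 0 < e / 2 by rewrite divr_gt0.
  have [N hN] := (cvg0P (fun n => nr_ge0 _)).1 (cutoff_cvg Lu) _ e20.
  exists N => m n Nm Nn.
  rewrite -(ftB s (cutoff_integrable m Lu) (cutoff_integrable n Lu)).
  have sm := supp_widen (leq_maxl m n) (@supp_cutoff _ m u).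
  have sn := supp_widen (leq_maxr m n) (@supp_cutoff _ n u).
  have [_ ->] := plancherel_supp s1 (L2B (L2_cutoff m Lu) (L2_cutoff n Lu))
    (suppB sm sn).
  apply: (le_lt_trans (nr_triangle (L2_cutoff m Lu) Lu (L2_cutoff n Lu))).
  rewrite [X in _ < X]splitr; apply: ltrD; first exact: hN.
  by rewrite nr_subC; exact: hN.
- by exists v; apply/(is_fourierP _ _ s1); split.
Qed.

Lemma nr_cvg (u : nat -> R -> C) v : (forall n, L2 (u n)) -> L2 v ->
  nr (fun x => u n x - v x) @[n --> \oo] --> (0 : R) ->
  nr (u n) @[n --> \oo] --> nr v.
Proof.
move=> hu hv h; apply/cvg_dist0; apply: (cvg0_le _ _ h) => n //.
exact: nr_sub_dist.
Qed.

(** Plancherel's identity. *)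
Lemma fourier_norm s u v : s ^+ 2 = 1 -> is_fourier s u v -> nr v = nr u.
Proof.
move=> s1 /(is_fourierP _ _ s1) [Lu Lv h].
have h1 := nr_cvg (fun n => L2_ft_cutoff n s1 Lu) Lv h.
have h2 := nr_cvg (fun n => L2_cutoff n Lu) Lu (cutoff_cvg Lu).
have E : (fun n => nr (ft s (cutoff n u))) = (fun n => nr (cutoff n u)).
  by apply/funext => n; exact: nr_ft_cutoff.
rewrite E in h1; exact: (cvg_unique _ h1 h2).
Qed.

Lemma cutoff_lin n (a : C) u v :
  cutoff n (fun x => a * u x + v x) = (fun x => a * cutoff n u x + cutoff n v x).
Proof.
by apply/funext => x; rewrite /cutoff; case: ifP => // _; rewrite mulr0 addr0.
Qed.

Lemma L2_lin (a : C) u v : L2 u -> L2 v -> L2 (fun x => a * u x + v x).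
Proof. by move=> Lu Lv; apply: L2D => //; exact: L2Z. Qed.

Lemma fourier_lin s (a : C) u v u' v' : s ^+ 2 = 1 -> is_fourier s u v ->
  is_fourier s u' v' ->
  is_fourier s (fun x => a * u x + u' x) (fun x => a * v x + v' x).
Proof.
move=> s1 /(is_fourierP _ _ s1) [Lu Lv h] /(is_fourierP _ _ s1) [Lu' Lv' h'].
apply/(is_fourierP _ _ s1); split; [exact: L2_lin|exact: L2_lin|].
apply: (cvg0_le _ _ (cvg0D (cvg0Z (normc a) h) h')) => n; first exact: nr_ge0.
rewrite cutoff_lin ftD; [|exact/cintegrableZ/cutoff_integrable|exact: cutoff_integrable].
rewrite ftZ; last exact: cutoff_integrable.
have L1 := L2B (L2_ft_cutoff n s1 Lu) Lv.
have L1' := L2B (L2_ft_cutoff n s1 Lu') Lv'.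
have := nrD (L2Z a L1) L1'; rewrite nrZ//; apply: le_trans.
by under eq_fun do rewrite opprD addrACA -mulrBr.
Qed.

Lemma fourier_zero s u v : s ^+ 2 = 1 -> is_fourier s u v ->
  {ae mu, forall x, u x = 0} -> {ae mu, forall x, v x = 0}.
Proof.
move=> s1 Fuv u0; have [Lu Lv _] := Fuv.
apply: nr_eq0 => //; rewrite (fourier_norm s1 Fuv).
rewrite (nr_ae (L2_meas Lu) (cmeas_cst _ 0) u0).
rewrite /nr; under eq_Rintegral do rewrite normc0 expr0n/=.
by rewrite /Rintegral integral0 sqrtr0.
Qed.

Lemma fourier_ae s u v u' v' : s ^+ 2 = 1 -> is_fourier s u v ->
  is_fourier s u' v' -> {ae mu, forall x, u x = u' x} ->
  {ae mu, forall x, v x = v' x}.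
Proof.
move=> s1 F1 F2 uu'.
have h := fourier_zero s1 (fourier_lin (- 1) s1 F2 F1) _.
apply: (ae_mono (h _)) => [|x /eqP].
  by apply: (ae_mono uu') => x ->; rewrite mulN1r addNr.
by rewrite mulN1r addrC subr_eq0 => /eqP.
Qed.

Lemma fourier_unique s u v v' : s ^+ 2 = 1 -> is_fourier s u v ->
  is_fourier s u v' -> {ae mu, forall x, v x = v' x}.
Proof. by move=> s1 F1 F2; apply: (fourier_ae s1 F1 F2); exact: ae_all. Qed.

Lemma nr_congr_ae u v w : cmeas u -> cmeas v -> cmeas w ->
  {ae mu, forall x, v x = w x} ->
  nr (fun x => u x - v x) = nr (fun x => u x - w x).
Proof.
move=> m1 m2 m3 vw; apply: nr_ae; [exact: cmeasB|exact: cmeasB|].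
by apply: (ae_mono vw) => x ->.
Qed.

Lemma is_fourier_ae s u v u' v' : s ^+ 2 = 1 -> is_fourier s u v ->
  cmeas u' -> cmeas v' ->
  {ae mu, forall x, u x = u' x} -> {ae mu, forall x, v x = v' x} ->
  is_fourier s u' v'.
Proof.
move=> s1 F1 mu' mv' uu' vv'; have [Lu Lv _] := F1.
have Lu' : L2 u' by exact: L2_ae mu' Lu uu'.
have Lv' : L2 v' by exact: L2_ae mv' Lv vv'.
have [z Fz] := fourier_exists s1 Lu'.
have /(is_fourierP _ _ s1) [_ Lz hz] := Fz.
have vz := fourier_ae s1 F1 Fz uu'.
apply/(is_fourierP _ _ s1); split; [exact: Lu'|exact: Lv'|].
apply: cvg_trans hz; apply: near_eq_cvg; apply: nearW => n.
apply: nr_congr_ae => //; [exact/L2_meas/L2_ft_cutoff|exact: L2_meas|].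
by apply: (ae_mono (ae_and vz vv')) => x [<- ->].
Qed.

(** The truncated integrals converge pointwise by dominated convergence, and mean and
    pointwise limits agree. *)
Lemma fourier_L1 s u v : s ^+ 2 = 1 -> is_fourier s u v -> cintegrable u ->
  {ae mu, forall xi, v xi = ft s u xi}.
Proof.
move=> s1 /(is_fourierP _ _ s1) [Lu Lv h] iu.
apply: (L2_lim_ae (fun n => L2_ft_cutoff n s1 Lu) Lv h).
apply: ae_all => xi; apply: ccvgZ.
apply: (@cint_dct _ _ _ (fun x => normc (u x))).
- by move=> n; apply: cmeasM; [exact: cmeas_kernel1|exact/cmeas_cutoff/L2_meas].
- by apply: cmeasM; [exact: cmeas_kernel1|exact: L2_meas].
- exact: cintegrable_normc.
- by apply: ae_all => x n; rewrite normcM normc_expi mul1r normc_cutoff_le.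
- by apply: ae_all => x; apply: ccvgZ; exact/eventually_ccvg/cutoff_eventually.
Qed.

Lemma cint_L2_cvg (u v : nat -> R -> C) (u0 v0 : R -> C) :
  (forall n, L2 (u n)) -> (forall n, L2 (v n)) -> L2 u0 -> L2 v0 ->
  nr (fun x => u n x - u0 x) @[n --> \oo] --> (0 : R) ->
  nr (fun x => v n x - v0 x) @[n --> \oo] --> (0 : R) ->
  ccvg (fun n => cint (fun x => u n x * v n x)) (cint (fun x => u0 x * v0 x)).
Proof.
move=> hu hv hu0 hv0 uc vc.
have vn := nr_cvg hv hv0 vc.
have h1 : nr (fun x => u n x - u0 x) * nr (v n) +
    nr u0 * nr (fun x => v n x - v0 x) @[n --> \oo] --> (0 : R).
  apply: cvg0D; last exact: cvg0Z.
  by have := cvgM uc vn; rewrite mul0r; exact.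
apply: (cvg0_le _ _ h1) => n; first exact: normc_ge0.
rewrite -cintB; [|exact: L2_cintegrable|exact: L2_cintegrable].
rewrite (_ : (fun x => _) = (fun x => (u n x - u0 x) * v n x +
    u0 x * (v n x - v0 x))); last by apply/funext => x; ring.
have L1 := L2B (hu n) hu0; have L1' := L2B (hv n) hv0.
rewrite cintD; [|exact: L2_cintegrable|exact: L2_cintegrable].
apply: (le_trans (normcD _ _)); rewrite lerD//; exact: normc_cint_L2.
Qed.

(** By Fubini both sides are the same double integral. *)
Lemma ft_mult s u v : cintegrable u -> cintegrable v ->
  cint (fun xi => v xi * ft s u xi) = cint (fun x => u x * ft s v x).
Proof.
move=> iu iv.
have [i1 e1] := @cfubini_prod _ v u (fun z => expi (s * z.2 * z.1)) 1 iv iu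
  (cmeas_kernel s) (fun z => normc_expi_le _).
have [i2 _] := @cfubini_prod _ u v (fun z => expi (s * z.2 * z.1)) 1 iu iv
  (cmeas_kernel s) (fun z => normc_expi_le _).
have E1 xi : v xi * ft s u xi =
    kap%:C * (v xi * cint (fun x => expi (s * x * xi) * u x)) by rewrite mulrCA.
have E2 x : u x * ft s v x =
    kap%:C * (u x * cint (fun y => expi (s * y * x) * v y)) by rewrite mulrCA.
apply: (etrans (etrans (eq_cint E1) (cintZ _ i1))).
apply: (etrans _ (esym (etrans (eq_cint E2) (cintZ _ i2)))); congr (_ * _).
apply: (etrans e1); apply: eq_cint => x; congr (_ * _); apply: eq_cint => y.
by rewrite mulrAC.
Qed.

Lemma fourier_mult s u v w z : s ^+ 2 = 1 -> is_fourier s u v ->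
  is_fourier s w z -> cint (fun x => w x * v x) = cint (fun x => u x * z x).
Proof.
move=> s1 /(is_fourierP _ _ s1) [Lu Lv hv] /(is_fourierP _ _ s1) [Lw Lz hz].
have c1 := cint_L2_cvg (fun n => L2_cutoff n Lw) (fun n => L2_ft_cutoff n s1 Lu)
  Lw Lv (cutoff_cvg Lw) hv.
have c2 := cint_L2_cvg (fun n => L2_cutoff n Lu) (fun n => L2_ft_cutoff n s1 Lw)
  Lu Lz (cutoff_cvg Lu) hz.
have E : (fun n => cint (fun x => cutoff n w x * ft s (cutoff n u) x)) =
         (fun n => cint (fun x => cutoff n u x * ft s (cutoff n w) x)).
  apply/funext => n.
  exact: (ft_mult s (cutoff_integrable n Lu) (cutoff_integrable n Lw)).
rewrite E in c1; exact: (ccvg_unique c1 c2).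
Qed.

Lemma L2_conj u : L2 u -> L2 (fun x => (u x)^*).
Proof.
move=> Lu; apply: (L2_le _ Lu); first exact/cmeas_conj/L2_meas.
by move=> x; rewrite normc_conj.
Qed.

Lemma fourier_conj s u v : s ^+ 2 = 1 -> is_fourier s u v ->
  is_fourier (- s) (fun x => (u x)^*) (fun x => (v x)^*).
Proof.
move=> s1 /(is_fourierP _ _ s1) [Lu Lv h].
have s1' : (- s) ^+ 2 = 1 by rewrite sqrrN.
apply/(is_fourierP _ _ s1'); split; [exact: L2_conj|exact: L2_conj|].
apply: cvg_trans h; apply: near_eq_cvg; apply: nearW => n.
congr Num.sqrt; apply: eqRint => xi; congr (_ ^+ 2).
have -> : cutoff n (fun x => (u x)^*) = (fun x => (cutoff n u x)^*).
  by apply/funext => x; rewrite /cutoff; case: ifP => // _; rewrite conj_real.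
rewrite -(ft_conj s (cutoff_integrable n Lu)) -[LHS]normc_conj; congr normc.
by apply: complex_ext; rewrite ?(ReDE, ImDE, ReNE, ImNE, ReJE, ImJE)//; ring.
Qed.

(** Inversion follows from Plancherel and the multiplication formula: if z is the
    inverse transform of v, then <z, u> = <v, v>, and all norms agree, so
    ||z - u|| = 0. *)
Lemma fourier_inv s u v : s ^+ 2 = 1 -> is_fourier s u v ->
  is_fourier (- s) v u.
Proof.
move=> s1 Fuv; have [Lu Lv _] := Fuv.
have s1' : (- s) ^+ 2 = 1 by rewrite sqrrN.
have [z Fz] := fourier_exists s1' Lv; have [_ Lz _] := Fz.
suff zu : {ae mu, forall x, z x = u x}.
  by apply: (is_fourier_ae s1' Fz) => //; [exact: L2_meas|exact: L2_meas|exact: ae_all].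
have h0 : nr (fun x => z x - u x) = 0.
  apply/eqP; rewrite -sqrf_eq0; apply/eqP.
  have Lzu := L2_cintegrable Lz (L2_conj Lu).
  have -> : nr (fun x => z x - u x) ^+ 2 = nr z ^+ 2 + nr u ^+ 2 -
      2 * Re (cint (fun x => z x * (u x)^*)).
    rewrite !nr_sq /= -RintegralZl//; last by case: Lzu.
    rewrite -RintegralD//; [|exact: L2_sq|exact: L2_sq].
    rewrite -RintegralB//; [|exact: (LiD (L2_sq Lz) (L2_sq Lu))|].
      by apply: eqRint => x; rewrite normcB_sq.
    by apply: LiZ; case: Lzu.
  have m := fourier_mult s1' Fz (fourier_conj s1 Fuv).
  have -> : cint (fun x => z x * (u x)^*) = (nr v ^+ 2)%:C.
    transitivity (cint (fun x => v x * (v x)^*)).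
      by rewrite -m; apply: eq_cint => x; rewrite mulrC.
    rewrite nr_sq -cint_real; apply: eq_cint => x.
    by rewrite normc_sqC mulrC.
  by rewrite (fourier_norm s1' Fz) (fourier_norm s1 Fuv) /=; ring.
have h := nr_eq0 (L2B Lz Lu) h0.
by apply: (ae_mono h) => x /eqP; rewrite subr_eq0 => /eqP.
Qed.

End FourierL2.

(** * Smooth cut-off functions *)

Section Smooth.
Context {R : realType}.
Implicit Types (f g : R -> R).

(** n-fold differentiability, stated recursively so that sums, products and affine
    substitutions are handled by induction. *)
Fixpoint Cn (n : nat) f : Prop :=
  if n is m.+1 then (forall x, derivable f x 1) /\ Cn m (derive1 f) else True.

Lemma Cn_smooth f : (forall n, Cn n f) ->
  forall n x, derivable (derive1n n f) x 1.
Proof.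
move=> hf n; elim: n f hf => [|n IH] f hf x; first by case: (hf 1%N).
by rewrite /derive1n iterSr; apply: IH => m; case: (hf m.+1).
Qed.

Lemma CnW n f : Cn n.+1 f -> Cn n f.
Proof.
by elim: n f => // n IH f [df h]; split => //; exact: IH.
Qed.

Lemma derive1_is_derive f x (d : R) : is_derive x (1 : R) f d -> (derive1 f) x = d.
Proof. by move=> h; rewrite derive1E; apply: derive_val. Qed.

Lemma CnD n f g : Cn n f -> Cn n g -> Cn n (fun x => f x + g x).
Proof.
elim: n f g => // n IH f g [df hf] [dg hg]; split.
  by move=> x; exact: derivableD.
rewrite (_ : derive1 _ = fun x => (derive1 f) x + (derive1 g) x); first exact: IH.
by apply/funext => x; rewrite !derive1E deriveD.
Qed.

Lemma CnZ n (k : R) f : Cn n f -> Cn n (fun x => k * f x).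
Proof.
elim: n f => // n IH f [df hf]; split.
  by move=> x; apply: derivableM => //; exact: derivable_cst.
rewrite (_ : derive1 _ = fun x => k * (derive1 f) x); first exact: IH.
by apply/funext => x; rewrite !derive1E deriveM// derive_cst scaler0 addr0.
Qed.

Lemma CnM n f g : Cn n f -> Cn n g -> Cn n (fun x => f x * g x).
Proof.
elim: n f g => // n IH f g hf hg; split.
  by move=> x; apply: derivableM; [exact: hf.1|exact: hg.1].
rewrite (_ : derive1 _ = fun x => f x * (derive1 g) x + (derive1 f) x * g x).
  by apply: CnD; apply: IH; [exact: CnW|exact: hg.2|exact: hf.2|exact: CnW].
apply/funext => x; rewrite !derive1E deriveM; [|exact: hf.1|exact: hg.1].
by rewrite /GRing.scale /= [g x * _]mulrC.
Qed.

Lemma is_derive_affine f (a b x d : R) : is_derive (a * x + b) (1 : R) f d ->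
  is_derive x (1 : R) (fun y => f (a * y + b)) (a * d).
Proof.
move=> h.
have h2 : is_derive x (1 : R) (fun y => a * y + b) a.
  by apply: is_derive_eq; rewrite /GRing.scale /=; ring.
by have := @is_derive1_comp R f (fun y => a * y + b) x d a h h2; rewrite mulrC.
Qed.

Lemma Cn_affine n f (a b : R) : Cn n f -> Cn n (fun x => f (a * x + b)).
Proof.
elim: n f => // n IH f [df hf]; split.
  by move=> x; have := is_derive_affine (derivableP (df (a * x + b))); case.
rewrite (_ : derive1 _ = fun x => a * (derive1 f) (a * x + b)); first exact/CnZ/IH.
apply/funext => x; apply: derive1_is_derive; apply: is_derive_affine.
by rewrite derive1E; exact: derivableP.
Qed.

Lemma Cn_sincos n : Cn n (@sin R) /\ Cn n (@cos R).
Proof.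
elim: n => // n [IHs IHc]; split; split.
- by move=> x; exact: derivable_sin.
- rewrite (_ : derive1 _ = @cos R) //.
  by apply/funext => x; apply: derive1_is_derive; exact: is_derive_sin.
- by move=> x; exact: derivable_cos.
- rewrite (_ : derive1 _ = fun x => (- 1) * sin x); first exact: CnZ.
  by apply/funext => x; apply: derive1_is_derive; rewrite mulN1r; exact: is_derive_cos.
Qed.

(** The function x^-k e^{-1/x}, extended by 0.  The derivative of a member of this
    family is a combination of members, so all of them are smooth at once. *)
Definition flat (k : nat) (x : R) : R :=
  if 0 < x then x^-1 ^+ k * expR (- x^-1) else 0.

Lemma expR_ge_pow (k : nat) (y : R) : 0 <= y -> y ^+ k <= k`!%:R * expR y.
Proof.
case: k => [|k] y0; first by rewrite expr0 fact0 mul1r -expR0 ler_expR.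
have h := @expR_ge1Dxn R y k y0.
rewrite mulrC -ler_pdivrMr ?ltr0n ?fact_gt0//; apply: le_trans h.
by rewrite lerDr.
Qed.

Lemma flat_ge0 k x : 0 <= flat k x.
Proof.
rewrite /flat; case: ifPn => // x0.
by rewrite mulr_ge0 ?expR_ge0 ?exprn_ge0 ?invr_ge0 ?ltW.
Qed.

Lemma flat_le k x : flat k x <= k`!%:R.
Proof.
rewrite /flat; case: ifPn => [x0|_]; last by [].
rewrite expRN ler_pdivrMr ?expR_gt0//.
by apply: expR_ge_pow; rewrite invr_ge0 ltW.
Qed.

(** The bound by x^2 is what gives differentiability at 0. *)
Lemma flat_sq k x : flat k x <= k.+2`!%:R * x ^+ 2.
Proof.
rewrite /flat; case: ifPn => [x0|_]; last by rewrite mulr_ge0 ?sqr_ge0.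
have := flat_le k.+2 x; rewrite /flat x0.
rewrite -ler_pdivrMr ?exprn_gt0//; apply: le_trans.
by rewrite -exprVn mulrAC -exprD addn2.
Qed.

Lemma is_derive_flat k x :
  is_derive x (1 : R) (flat k) (flat k.+2 x - k%:R * flat k.+1 x).
Proof.
have [x0|x0|->] := ltgtP x 0.
- rewrite /flat !ifN; [|by rewrite -leNgt ltW..].
  rewrite mulr0 subr0; apply: (@near_eq_is_derive _ _ _ (fun=> 0)).
    near=> y; rewrite ifN//; rewrite -leNgt ltW//.
    by near: y; exact: lt_nbhsl.
- have xn0 : x != 0 by rewrite gt_eqF.
  have dV : is_derive x (1 : R) (fun y : R => y^-1) (- x ^- 2).
    have := @is_deriveV R (@id R) x 1 1 xn0 (is_derive_id x 1).
    by rewrite /GRing.scale /= mulr1.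
  have dk : is_derive (x^-1) (1 : R) (fun y : R => y ^+ k * expR (- y))
      (k%:R * x^-1 ^+ k.-1 * expR (- x^-1) - x^-1 ^+ k * expR (- x^-1)).
    have hX := @is_deriveX R R (@id R) k (x^-1) 1 1 (is_derive_id _ _).
    rewrite exprfctE in hX.
    have hE : is_derive (x^-1) (1 : R) (fun y : R => expR (- y)) (- expR (- x^-1)).
      by apply: is_derive_eq; rewrite /GRing.scale /=; ring.
    have := is_deriveM hX hE; rewrite /GRing.scale /=.
    set A := (X in is_derive _ _ _ X -> _).
    rewrite (_ : A = k%:R * x^-1 ^+ k.-1 * expR (- x^-1) -
      x^-1 ^+ k * expR (- x^-1))//; rewrite /A; ring.
  have H := @is_derive1_comp R _ _ x _ _ dk dV.
  have E : (k%:R * x^-1 ^+ k.-1 * expR (- x^-1) - x^-1 ^+ k * expR (- x^-1)) *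
      (- x ^- 2) = flat k.+2 x - k%:R * flat k.+1 x.
    rewrite /flat !x0 -exprVn; move: (x^-1) (expR _) => y z.
    by case: (k) => [|m]; rewrite /= ?exprS; ring.
  rewrite -E; apply: near_eq_is_derive H.
  near=> y; rewrite /= /flat ifT//.
  by near: y; exact: lt_nbhsr.
- rewrite /flat ltxx mulr0 subr0.
  have fl0 : flat k 0 = 0 by rewrite /flat ltxx.
  pose K : R := k.+2`!%:R.
  have key : (fun h : R => h^-1 *: ((flat k \o shift 0) (h *: (1 : R)) - flat k 0))
      @ 0^' --> (0 : R).
    have bd (h : R) : `|h^-1 *: ((flat k \o shift 0) (h *: (1 : R)) - flat k 0)| <=
        K * `|h|.
      rewrite fl0 subr0 /= addr0 /GRing.scale /= mulr1 normrM normfV.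
      rewrite (ger0_norm (flat_ge0 k h)).
      have [->|h0] := eqVneq h 0; first by rewrite normr0 invr0 mul0r mulr0.
      rewrite mulrC ler_pdivrMr ?normr_gt0// -mulrA -expr2 real_normK ?num_real//.
      exact: flat_sq.
    have cK : K * `|h| @[h --> (0 : R)^'] --> (0 : R).
      apply: cvg_within_filter.
      have : K * `|h| @[h --> (0 : R)] --> K * `|0 : R|.
        by apply: cvgM; [exact: cvg_cst|exact: norm_continuous].
      by rewrite normr0 mulr0; exact.
    apply: (@squeeze_cvgr _ _ _ _ (fun h => - (K * `|h|)) (fun h => K * `|h|)) => //.
      by apply: nearW => h; rewrite -ler_norml; exact: bd.
    by have := cvgN cK; rewrite oppr0; exact.
  apply: DeriveDef; first by apply/cvg_ex; exists 0; exact: key.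
  exact: (cvg_lim _ key).
Unshelve. all: by end_near.
Qed.

Lemma Cn_flat n k : Cn n (flat k).
Proof.
elim: n k => // n IH k; split; first by move=> x; case: (is_derive_flat k x).
rewrite (_ : derive1 _ = fun x => flat k.+2 x + (- k%:R) * flat k.+1 x).
  by apply: CnD => //; exact: CnZ.
by apply/funext => x; apply: derive1_is_derive; rewrite mulNr; exact: is_derive_flat.
Qed.

End Smooth.

Section Bump.
Context {R : realType}.
Implicit Types (x : R).

(** A smooth function supported in [-1, 1]; the factor e^2 makes its value at 0
    equal to 1. *)
Definition bump x : R :=
  expR 2 * (flat 0 ((- 1) * x + 1) * flat 0 (1 * x + 1)).

Definition dbump x : R :=
  expR 2 * (flat 0 ((- 1) * x + 1) * flat 2 (1 * x + 1) -
            flat 2 ((- 1) * x + 1) * flat 0 (1 * x + 1)).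

Lemma is_derive_bump x : is_derive x (1 : R) bump (dbump x).
Proof.
have h1 := is_derive_affine (is_derive_flat 0 ((- 1) * x + 1)).
have h2 := is_derive_affine (is_derive_flat 0 (1 * x + 1)).
have := is_deriveZ (expR 2) (is_deriveM h1 h2).
rewrite /GRing.scale /= /dbump => h.
by apply: (is_derive_eq h); rewrite /GRing.scale /=; ring.
Qed.

Lemma Cn_bump n : Cn n bump.
Proof. by apply/CnZ/CnM; apply: Cn_affine; exact: Cn_flat. Qed.

Lemma bump0 : bump 0 = 1.
Proof.
rewrite /bump !mulr0 !add0r /flat ltr01 invr1 !expr0 !mul1r -!expRD.
by rewrite (_ : _ + _ = 0) ?expR0//; ring.
Qed.

Lemma flat_out k x : x <= 0 -> flat k x = 0.
Proof. by move=> x0; rewrite /flat ltNge x0. Qed.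

Lemma bump_out x : 1 < `|x| -> bump x = 0.
Proof.
rewrite /bump ltr_normr => /orP[h|h].
  by rewrite (flat_out _ (_ : -1 * x + 1 <= 0)) ?mul0r ?mulr0//; lra.
by rewrite (flat_out _ (_ : 1 * x + 1 <= 0)) ?mulr0//; lra.
Qed.

Lemma dbump_out x : 1 < `|x| -> dbump x = 0.
Proof.
rewrite /dbump ltr_normr => /orP[h|h].
  have h' : -1 * x + 1 <= 0 by lra.
  by rewrite !(flat_out _ h') !mul0r subr0 mulr0.
have h' : 1 * x + 1 <= 0 by lra.
by rewrite !(flat_out _ h') !mulr0 subr0 mulr0.
Qed.

Lemma flat0_le1 x : flat 0 x <= 1.
Proof. by have := flat_le 0 x; rewrite fact0. Qed.

Lemma flat2_le2 x : flat 2 x <= 2.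
Proof. exact: flat_le 2 x. Qed.

Lemma bump_le x : `|bump x| <= expR 2.
Proof.
rewrite /bump normrM ger0_norm ?expR_ge0// ler_piMr ?expR_ge0//.
rewrite ger0_norm ?mulr_ge0 ?flat_ge0//.
by apply: mulr_ile1; rewrite ?flat_ge0 ?flat0_le1.
Qed.

Lemma dbump_le x : `|dbump x| <= expR 2 * 2.
Proof.
rewrite /dbump normrM ger0_norm ?expR_ge0// ler_wpM2l ?expR_ge0//.
move: (flat_ge0 0 (-1 * x + 1)) (flat0_le1 (-1 * x + 1))
  (flat_ge0 0 (1 * x + 1)) (flat0_le1 (1 * x + 1))
  (flat_ge0 2 (-1 * x + 1)) (flat2_le2 (-1 * x + 1))
  (flat_ge0 2 (1 * x + 1)) (flat2_le2 (1 * x + 1)).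
move: (flat 0 _) (flat 0 _) (flat 2 _) (flat 2 _) => a b c d a0 a1 b0 b1 c0 c1 d0 d1.
by rewrite ler_norml; apply/andP; split; nra.
Qed.

Lemma Cn_continuous f : Cn 1 f -> continuous (f : R -> R).
Proof.
by move=> [df _] x; apply/differentiable_continuous/derivable1_diffP.
Qed.

Lemma continuous_bump : continuous bump.
Proof. exact: Cn_continuous (Cn_bump 1). Qed.

End Bump.

(** * Weak derivatives on the Fourier side *)

Section WeakDerivative.
Context {R : realType}.
Local Notation C := R[i].
Local Notation mu := (@lebesgue_measure R).
Local Notation Li f := (mu.-integrable setT (EFin \o f)).
Implicit Types (u v : R -> C).

Lemma Li_L2_mul (f g : R -> R) : L2 (cplx f) -> L2 (cplx g) ->
  Li (fun x => f x * g x).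
Proof.
move=> Lf Lg; have [h _] := L2_cintegrable Lf Lg.
move: h; apply: eq_integrable => // x _.
by rewrite /= /cplx /= mulr0 subr0.
Qed.

Lemma L2_Re u : L2 u -> L2 (cplx (fun x => Re (u x))).
Proof.
move=> Lu; apply: (L2_le _ Lu); first by apply: cmeas_real; case: (L2_meas Lu).
by move=> x; rewrite normc_real normRe_le.
Qed.

Lemma L2_Im u : L2 u -> L2 (cplx (fun x => Im (u x))).
Proof.
move=> Lu; apply: (L2_le _ Lu); first by apply: cmeas_real; case: (L2_meas Lu).
by move=> x; rewrite normc_real normIm_le.
Qed.

(** Weak derivatives are tested with real functions; this is the version for
    complex test functions P of derivative Q, and for u, v that are square integrable
    near the supports only. *)
Lemma weak_complex N u v (P Q : R -> C) : is_weak_derivative u v ->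
  L2 (fun x => box N x * u x) -> L2 (fun x => box N x * v x) ->
  L2 P -> L2 Q -> supp N P -> supp N Q -> test_function (fun x => Re (P x)) ->
  test_function (fun x => Im (P x)) ->
  derive1 (fun x => Re (P x)) = (fun x => Re (Q x)) ->
  derive1 (fun x => Im (P x)) = (fun x => Im (Q x)) ->
  cint (fun x => u x * Q x) = - cint (fun x => v x * P x).
Proof.
move=> [[_ _ w1] [_ _ w2]] Lu Lv LP LQ sP sQ tR tI dR dI.
have loc (w Z : R -> C) x : supp N Z ->
    [/\ Re (box N x * w x) * Re (Z x) = Re (w x) * Re (Z x),
        Im (box N x * w x) * Im (Z x) = Im (w x) * Im (Z x),
        Re (box N x * w x) * Im (Z x) = Re (w x) * Im (Z x) &
        Im (box N x * w x) * Re (Z x) = Im (w x) * Re (Z x)].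
  move=> sZ; have [h|h] := leP `|x| N%:R.
    by rewrite /box cutoff_in// mul1r.
  by rewrite (sZ _ h) /= !mulr0.
have li (w Z : R -> C) : L2 (fun x => box N x * w x) -> L2 Z -> supp N Z ->
    [/\ Li (fun x => Re (w x) * Re (Z x)), Li (fun x => Im (w x) * Im (Z x)),
        Li (fun x => Re (w x) * Im (Z x)) & Li (fun x => Im (w x) * Re (Z x))].
  move=> Lw LZ sZ; split.
  - have := Li_L2_mul (L2_Re Lw) (L2_Re LZ); congr (mu.-integrable _ (_ \o _)).
    by apply/funext => x; have [? _ _ _] := loc w Z x sZ.
  - have := Li_L2_mul (L2_Im Lw) (L2_Im LZ); congr (mu.-integrable _ (_ \o _)).
    by apply/funext => x; have [_ ? _ _] := loc w Z x sZ.
  - have := Li_L2_mul (L2_Re Lw) (L2_Im LZ); congr (mu.-integrable _ (_ \o _)).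
    by apply/funext => x; have [_ _ ? _] := loc w Z x sZ.
  - have := Li_L2_mul (L2_Im Lw) (L2_Re LZ); congr (mu.-integrable _ (_ \o _)).
    by apply/funext => x; have [_ _ _ ?] := loc w Z x sZ.
have [u1 u2 u3 u4] := li _ _ Lu LQ sQ; have [v1 v2 v3 v4] := li _ _ Lv LP sP.
have := w1 _ tR; rewrite dR => e1; have := w1 _ tI; rewrite dI => e2.
have := w2 _ tR; rewrite dR => e3; have := w2 _ tI; rewrite dI => e4.
rewrite !cintE; apply: complex_ext; rewrite ?ReNE ?ImNE /=.
  rewrite (eqRint (fun x => ReME (u x) (Q x))) (eqRint (fun x => ReME (v x) (P x))).
  rewrite RintegralB; [|by []|exact: u1|exact: u2].
  rewrite RintegralB; [|by []|exact: v1|exact: v2].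
  by rewrite e1 e4 opprB addrC opprK.
rewrite (eqRint (fun x => ImME (u x) (Q x))) (eqRint (fun x => ImME (v x) (P x))).
rewrite RintegralD; [|by []|exact: u3|exact: u4].
rewrite RintegralD; [|by []|exact: v3|exact: v4].
by rewrite e2 e3 opprD.
Qed.

(** The smooth cut-off at scale n + 1. *)
Definition chi (n : nat) (x : R) : R := bump (n.+1%:R^-1 * x + 0).
Definition dchi (n : nat) (x : R) : R := n.+1%:R^-1 * dbump (n.+1%:R^-1 * x + 0).

Lemma is_derive_chi n x : is_derive x (1 : R) (chi n) (dchi n x).
Proof. by apply: is_derive_affine; exact: is_derive_bump. Qed.

Lemma Cn_chi m n : Cn m (chi n).
Proof. by apply: Cn_affine; exact: Cn_bump. Qed.

Lemma chi_out n x : n.+1%:R < `|x| -> chi n x = 0.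
Proof.
move=> h; rewrite /chi bump_out// addr0 normrM gtr0_norm ?invr_gt0//.
by rewrite mulrC ltr_pdivlMr// mul1r.
Qed.

Lemma dchi_out n x : n.+1%:R < `|x| -> dchi n x = 0.
Proof.
move=> h; rewrite /dchi dbump_out ?mulr0// addr0 normrM gtr0_norm ?invr_gt0//.
by rewrite mulrC ltr_pdivlMr// mul1r.
Qed.

Lemma chi_le n x : `|chi n x| <= expR 2.
Proof. exact: bump_le. Qed.

Lemma dchi_le n x : `|dchi n x| <= n.+1%:R^-1 * (expR 2 * 2).
Proof.
by rewrite /dchi normrM ger0_norm ?invr_ge0// ler_wpM2l ?invr_ge0// dbump_le.
Qed.

Lemma meas_chi n : measurable_fun setT (chi n).
Proof.
by apply: continuous_measurable_fun; exact: Cn_continuous (Cn_chi 1 n).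
Qed.

Lemma meas_dchi n : measurable_fun setT (dchi n).
Proof.
apply: continuous_measurable_fun.
have -> : dchi n = derive1 (chi n).
  by apply/funext => x; exact: (esym (derive1_is_derive (is_derive_chi n x))).
by apply: Cn_continuous; case: (Cn_chi 2 n).
Qed.

Lemma chi_cvg x : chi n x @[n --> \oo] --> (1 : R).
Proof.
have h : n.+1%:R^-1 * x @[n --> \oo] --> (0 : R).
  by apply: cvgMc0; exact: cvg_harmonic.
have := cvg_comp _ _ h (@continuous_bump R 0); rewrite bump0.
by rewrite (_ : bump \o _ = (fun n => chi n x))//; apply/funext => n;
  rewrite /= /chi addr0.
Qed.

Lemma L2_chiM n u : L2 u -> L2 (fun x => (chi n x)%:C * u x).
Proof.
move=> Lu; apply: (L2M_bounded (K := expR 2) _ Lu).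
  exact: cmeas_real (meas_chi n).
by move=> x; rewrite normc_real chi_le.
Qed.

Lemma L2_dchiM n u : L2 u -> L2 (fun x => (dchi n x)%:C * u x).
Proof.
move=> Lu; apply: (L2M_bounded (K := n.+1%:R^-1 * (expR 2 * 2)) _ Lu).
  exact: cmeas_real (meas_dchi n).
by move=> x; rewrite normc_real dchi_le.
Qed.

Lemma supp_chiM n u : supp n.+1 (fun x => (chi n x)%:C * u x).
Proof. by move=> x h; rewrite chi_out// mul0r. Qed.

Lemma supp_dchiM n u : supp n.+1 (fun x => (dchi n x)%:C * u x).
Proof. by move=> x h; rewrite dchi_out// mul0r. Qed.

Lemma chiM_cvg u : L2 u ->
  nr (fun x => (chi n x)%:C * u x - u x) @[n --> \oo] --> (0 : R).
Proof.
move=> Lu; apply: (@L2_dct0 _ _ (fun x => (expR 2 + 1) * normc (u x))).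
- by move=> n; apply: cmeasB; [exact: L2_meas (L2_chiM n Lu)|exact: L2_meas].
- under [X in mu.-integrable _ (_ \o X)]eq_fun do rewrite exprMn.
  exact: LiZ (L2_sq Lu).
- apply: ae_all => x n; rewrite (le_trans (normcD _ _))// normcN mulrDl mul1r.
  by rewrite lerD2r normcM normc_real ler_wpM2r ?normc_ge0// chi_le.
- apply: ae_all => x; have := chi_cvg x => /cvg_dist0 h.
  have h2 := cvg0Z (normc (u x)) h.
  apply: (cvg0_le _ _ h2) => n; first exact: normc_ge0.
  have -> : (chi n x)%:C * u x - u x - 0 = (chi n x - 1)%:C * u x.
    by rewrite subr0 rmorphB /= mulrBl mul1r.
  by rewrite normcM normc_real mulrC.
Qed.

(** Truncations of u have transforms as close to that of u as they are to u. *)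
Lemma ft_supp s n u U (v : R -> C) : s ^+ 2 = 1 -> is_fourier s u U ->
  supp n v -> L2 v ->
  L2 (ft s v) /\
  nr (fun xi => ft s v xi - U xi) = nr (fun x => v x - u x).
Proof.
move=> s1 Fu sv Lv; have [Lu LU _] := Fu.
have [LF _] := plancherel_supp s1 Lv sv; split; first exact: LF.
have [V FV] := fourier_exists s1 Lv; have [_ LV _] := FV.
have VE := fourier_L1 s1 FV (supp_integrable sv Lv).
have := fourier_norm s1 (fourier_lin (- 1) s1 Fu FV).
have -> : (fun x => -1 * u x + v x) = (fun x => v x - u x).
  by apply/funext => x; rewrite mulN1r addrC.
move=> <-; apply: nr_ae.
- by apply: cmeasB; exact: L2_meas.
- by apply: cmeasD; [apply: cmeasZ|]; exact: L2_meas.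
- by apply: (ae_mono VE) => xi ->; rewrite mulN1r addrC.
Qed.

Lemma L2_chi_bounded n (m : R -> C) (K : R) : cmeas m ->
  (forall x, normc (m x) <= K) ->
  L2 (fun x => (chi n x)%:C * m x) /\ L2 (fun x => (dchi n x)%:C * m x).
Proof.
move=> mm m1; have Lm : L2 (fun x => m x * box n.+1 x).
  by apply: (L2M_bounded mm _ m1); exact: L2_box.
have bE x (a : R) : (n.+1%:R < `|x| -> a = 0) ->
    a%:C * (m x * box n.+1 x) = a%:C * m x.
  move=> h; have [hx|hx] := leP `|x| n.+1%:R.
    by rewrite /box cutoff_in// mulr1.
  by rewrite h// !mul0r.
split.
  have := L2_chiM n Lm; rewrite (_ : (fun x => _) = (fun x => (chi n x)%:C * m x))//.
  by apply/funext => x; apply: bE; exact: chi_out.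
have := L2_dchiM n Lm; rewrite (_ : (fun x => _) = (fun x => (dchi n x)%:C * m x))//.
by apply/funext => x; apply: bE; exact: dchi_out.
Qed.

(** Test the weak derivative with a truncated character: the derivative of the
    cut-off contributes the last term. *)
Lemma weak_ft u v n xi : is_weak_derivative u v ->
  L2 (fun x => box n.+1 x * u x) -> L2 (fun x => box n.+1 x * v x) ->
  ft (- 1) (fun x => (chi n x)%:C * v x) xi =
  (0 +i* xi) * ft (- 1) (fun x => (chi n x)%:C * u x) xi -
  ft (- 1) (fun x => (dchi n x)%:C * u x) xi.
Proof.
move=> wuv Lu Lv.
pose e x : C := expi (- 1 * x * xi).
have me : cmeas e by exact: cmeas_kernel1.
have e1 x : normc (e x) <= 1 by rewrite normc_expi.
have [L1 L2'] := L2_chi_bounded n me e1.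
pose P x : C := (chi n x)%:C * e x.
pose Q x : C := (dchi n x)%:C * e x + (0 +i* (- xi)) * P x.
have LP : L2 P by exact: L1.
have LQ : L2 Q by apply: L2D; [exact: L2'|exact: L2Z].
have ce x : cos (- 1 * x * xi) = cos ((- xi) * x + 0) by congr cos; ring.
have se x : sin (- 1 * x * xi) = sin ((- xi) * x + 0) by congr sin; ring.
have RP : (fun x => Re (P x)) = (fun x => chi n x * cos ((- xi) * x + 0)).
  by apply/funext => x; rewrite /P /e /= ce mul0r subr0.
have IP : (fun x => Im (P x)) = (fun x => chi n x * sin ((- xi) * x + 0)).
  by apply/funext => x; rewrite /P /e /= se mul0r addr0.
have [Cs Cc] : (forall m, Cn m (fun x : R => sin ((- xi) * x + 0))) /\
               (forall m, Cn m (fun x : R => cos ((- xi) * x + 0))).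
  by split=> m; apply: Cn_affine; case: (@Cn_sincos R m).
have tR : test_function (fun x => Re (P x)).
  rewrite RP; split; first by apply: Cn_smooth => m; apply: CnM; [exact: Cn_chi|].
  by exists n.+1%:R => x hx; rewrite chi_out// mul0r.
have tI : test_function (fun x => Im (P x)).
  rewrite IP; split; first by apply: Cn_smooth => m; apply: CnM; [exact: Cn_chi|].
  by exists n.+1%:R => x hx; rewrite chi_out// mul0r.
have dR : derive1 (fun x => Re (P x)) = (fun x => Re (Q x)).
  rewrite RP; apply/funext => x; apply: derive1_is_derive.
  have h := is_deriveM (is_derive_chi n x)
    (is_derive_affine (is_derive_cos ((- xi) * x + 0))).
  apply: (is_derive_eq h); rewrite /Q ReDE ReME /P /e /= ce se /GRing.scale /=.
  ring.
have dI : derive1 (fun x => Im (P x)) = (fun x => Im (Q x)).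
  rewrite IP; apply/funext => x; apply: derive1_is_derive.
  have h := is_deriveM (is_derive_chi n x)
    (is_derive_affine (is_derive_sin ((- xi) * x + 0))).
  apply: (is_derive_eq h); rewrite /Q ImDE ImME /P /e /= ce se /GRing.scale /=.
  ring.
have sP : supp n.+1 P by move=> x hx; rewrite /P chi_out// mul0r.
have sD : supp n.+1 (fun x => (dchi n x)%:C * e x).
  by move=> x hx; rewrite dchi_out// mul0r.
have sQ : supp n.+1 Q by move=> x hx; rewrite /Q (sD _ hx) (sP _ hx) mulr0 addr0.
have w := weak_complex wuv Lu Lv LP LQ sP sQ tR tI dR dI.
have loc (Z : R -> C) : supp n.+1 Z ->
    (fun x => box n.+1 x * u x * Z x) = (fun x => u x * Z x).
  move=> sZ; rewrite -[in RHS](supp_mul sZ); apply/funext => x.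
  by rewrite mulrCA mulrA.
have i1 := L2_cintegrable Lu L2'; have i2 := L2_cintegrable Lu LP.
rewrite (loc _ sD) in i1; rewrite (loc _ sP) in i2.
have EQ x : u x * Q x = u x * ((dchi n x)%:C * e x) + (0 +i* (- xi)) * (u x * P x).
  by rewrite /Q mulrDr; congr (_ + _); rewrite mulrCA.
rewrite (eq_cint EQ) (cintD i1 (cintegrableZ _ i2)) (cintZ _ i2) in w.
have A1 : cint (fun x => expi (- 1 * x * xi) * ((chi n x)%:C * v x)) =
          cint (fun x => v x * P x).
  by apply: eq_cint => x; rewrite /P /e mulrA mulrC [expi _ * _]mulrC.
have A2 : cint (fun x => expi (- 1 * x * xi) * ((chi n x)%:C * u x)) =
          cint (fun x => u x * P x).
  by apply: eq_cint => x; rewrite /P /e mulrA mulrC [expi _ * _]mulrC.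
have A3 : cint (fun x => expi (- 1 * x * xi) * ((dchi n x)%:C * u x)) =
          cint (fun x => u x * ((dchi n x)%:C * e x)).
  by apply: eq_cint => x; rewrite /e mulrA mulrC [expi _ * _]mulrC.
rewrite /ft A1 A2 A3.
have -> : cint (fun x => v x * P x) = - (cint (fun x => u x * ((dchi n x)%:C * e x)) +
  (0 +i* (- xi)) * cint (fun x => u x * P x)) by rewrite w opprK.
have -> : (0 +i* (- xi) : C) = - (0 +i* xi) by apply: complex_ext; rewrite /= ?oppr0.
move: (cint _) (cint _) => a b; ring.
Qed.

(** In [weak_ft] the last term is O(1/n) in the mean; the three mean limits hold
    simultaneously pointwise along some indices, almost everywhere. *)
Lemma weak_fourier u v U V : is_weak_derivative u v -> L2 u -> L2 v ->
  is_fourier (- 1) u U -> is_fourier (- 1) v V ->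
  {ae mu, forall xi, V xi = (0 +i* xi) * U xi}.
Proof.
move=> wuv Lu Lv FU FV.
have s1 : (- 1) ^+ 2 = 1 :> R by rewrite sqrrN expr1n.
have [_ LU _] := FU; have [_ LV _] := FV.
have bx n (w : R -> C) : L2 w -> L2 (fun x => box n x * w x).
  move=> Lw; apply: (L2M_bounded (K := 1) (L2_meas (L2_box n)) Lw) => x.
  by rewrite (le_trans (normc_cutoff_le _ _ _))// normc1.
have keyid n xi := weak_ft xi wuv (bx n.+1 _ Lu) (bx n.+1 _ Lv).
have [Lp Ep] : (forall n, L2 (ft (- 1) (fun x => (chi n x)%:C * v x))) /\
   (forall n, nr (fun xi => ft (- 1) (fun x => (chi n x)%:C * v x) xi - V xi) =
              nr (fun x => (chi n x)%:C * v x - v x)).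
  by split=> n; have [] := ft_supp s1 FV (@supp_chiM n v) (L2_chiM n Lv).
have [Lq Eq] : (forall n, L2 (ft (- 1) (fun x => (chi n x)%:C * u x))) /\
   (forall n, nr (fun xi => ft (- 1) (fun x => (chi n x)%:C * u x) xi - U xi) =
              nr (fun x => (chi n x)%:C * u x - u x)).
  by split=> n; have [] := ft_supp s1 FU (@supp_chiM n u) (L2_chiM n Lu).
have [Lr Er] : (forall n, L2 (ft (- 1) (fun x => (dchi n x)%:C * u x))) /\
   (forall n, nr (ft (- 1) (fun x => (dchi n x)%:C * u x)) <=
              n.+1%:R^-1 * (expR 2 * 2 * nr u)).
  split=> n; have [L E] := plancherel_supp s1 (L2_dchiM n Lu) (@supp_dchiM n u).
    exact: L.
  rewrite E mulrA; apply: nrM_bounded => //; first exact: cmeas_real (meas_dchi n).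
  by move=> x; rewrite normc_real; exact: dchi_le.
pose p n xi := ft (- 1) (fun x => (chi n x)%:C * v x) xi - V xi.
pose q n xi := ft (- 1) (fun x => (chi n x)%:C * u x) xi - U xi.
pose r n := ft (- 1) (fun x => (dchi n x)%:C * u x).
have p0 : nr (p n) @[n --> \oo] --> (0 : R).
  by rewrite (funext Ep); exact: chiM_cvg.
have q0 : nr (q n) @[n --> \oo] --> (0 : R).
  by rewrite (funext Eq); exact: chiM_cvg.
have r0 : nr (r n) @[n --> \oo] --> (0 : R).
  apply: (cvg0_le _ Er); first by move=> n; exact: nr_ge0.
  by apply: cvgMc0; exact: cvg_harmonic.
have L2p n : L2 (p n) by exact: L2B.
have L2q n : L2 (q n) by exact: L2B.
have := @ae_liminf0 R (fun n xi => normc (p n xi) ^+ 2 + normc (q n xi) ^+ 2 +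
  normc (r n xi) ^+ 2) (fun n => LiD (LiD (L2_sq (L2p n)) (L2_sq (L2q n))) (L2_sq (Lr n))).
move=> h; apply: (ae_mono (h _ _)) => {h}.
- by move=> n x; rewrite !addr_ge0 ?sqr_ge0.
- have := cvg0D (cvg0D (nr_cvg0_sq p0) (nr_cvg0_sq q0)) (nr_cvg0_sq r0).
  apply: cvg_trans; apply: near_eq_cvg; apply: nearW => n.
  rewrite RintegralD; [|by []|exact: (LiD (L2_sq (L2p n)) (L2_sq (L2q n)))|
    exact: L2_sq (Lr n)].
  by rewrite RintegralD; [|by []|exact: L2_sq (L2p n)|exact: L2_sq (L2q n)].
move=> xi h; apply/eqP; rewrite -subr_eq0; apply/eqP/normc_eq0/eqP.
rewrite eq_le normc_ge0 andbT; apply/ler_addgt0Pl => e e0; rewrite addr0.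
(* The three errors enter with the factors 1, |xi| and 1. *)
pose d := e / (2 + `|xi|).
have x2 : 0 < 2 + `|xi| by rewrite ltr_pwDl.
have d0 : 0 < d by rewrite divr_gt0.
have [n _ hn] := h (d ^+ 2) 0%N (exprn_gt0 _ d0).
have sm (a b c : R) : 0 <= a -> a ^+ 2 <= b -> b < c ^+ 2 -> 0 < c -> a < c.
  move=> a0 ab bc c0; rewrite -ltr_sqr ?nnegrE ?(ltW c0)//.
  exact: le_lt_trans ab bc.
have pd : normc (p n xi) < d.
  apply: (sm _ _ _ (normc_ge0 _) _ hn d0).
  by rewrite -addrA lerDl addr_ge0 ?sqr_ge0.
have qd : normc (q n xi) < d.
  apply: (sm _ _ _ (normc_ge0 _) _ hn d0).
  by rewrite addrAC lerDr addr_ge0 ?sqr_ge0.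
have rd : normc (r n xi) < d.
  apply: (sm _ _ _ (normc_ge0 _) _ hn d0).
  by rewrite lerDr addr_ge0 ?sqr_ge0.
have -> : V xi - (0 +i* xi) * U xi = - p n xi + (0 +i* xi) * q n xi - r n xi.
  by rewrite /p /q /r (keyid n xi); ring.
have nxi : normc (0 +i* xi : C) = `|xi| by rewrite /= expr0n add0r sqrtr_sqr.
apply: (le_trans (normcD _ _)); apply: (le_trans (lerD (normcD _ _) (lexx _))).
rewrite !normcN normcM nxi.
have -> : e = d + `|xi| * d + d by rewrite /d; field; rewrite gt_eqF.
by rewrite !lerD// ?(ltW pd) ?(ltW rd)// ler_wpM2l// ltW.
Qed.

End WeakDerivative.

(** * Functions of order two as Fourier integrals *)

Section SobolevTwo.
Context {R : realType}.
Local Notation C := R[i].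
Local Notation mu := (@lebesgue_measure R).
Local Notation Li f := (mu.-integrable setT (EFin \o f)).
Implicit Types (u v z : R -> C).

Lemma sqN1 : (- 1) ^+ 2 = 1 :> R.
Proof. by rewrite sqrrN expr1n. Qed.

Lemma sq1 : 1 ^+ 2 = 1 :> R.
Proof. by rewrite expr1n. Qed.

Lemma fourierP u : L2 u -> is_fourier (- 1) u (fourier u).
Proof.
by move=> Lu; have := fourier_exists sqN1 Lu; exact: xgetPex.
Qed.

Lemma inv_fourierP u : L2 u -> is_fourier 1 u (inv_fourier u).
Proof.
by move=> Lu; have := fourier_exists sq1 Lu; exact: xgetPex.
Qed.

Lemma L2_fourier u : L2 u -> L2 (fourier u).
Proof. by move=> /fourierP[]. Qed.

Lemma L2_inv_fourier u : L2 (inv_fourier u).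
Proof.
have [Lu|nLu] := pselect (L2 u); first by case: (inv_fourierP Lu).
rewrite /inv_fourier xgetPN; first exact: L2_0.
by move=> v [].
Qed.

Lemma inversion u : L2 u -> is_fourier 1 (fourier u) u.
Proof.
by move=> Lu; have := fourier_inv sqN1 (fourierP Lu); rewrite opprK.
Qed.

Lemma wderivP u : (exists v, is_weak_derivative u v) ->
  is_weak_derivative u (wderiv u).
Proof. by move=> h; exact: xgetPex h. Qed.

Lemma weak_derivative_meas u v : is_weak_derivative u v -> cmeas v.
Proof. by move=> [[_ [m1 _ _] _] [_ [m2 _ _] _]]; split. Qed.

(** Both derivatives have the transform i xi u^, and the transform is injective. *)
Lemma weak_derivative_unique u v v' : L2 u -> L2 v -> L2 v' ->
  is_weak_derivative u v -> is_weak_derivative u v' ->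
  {ae mu, forall x, v x = v' x}.
Proof.
move=> Lu Lv Lv' w w'.
have h := weak_fourier w Lu Lv (fourierP Lu) (fourierP Lv).
have h' := weak_fourier w' Lu Lv' (fourierP Lu) (fourierP Lv').
apply: (fourier_ae sq1 (inversion Lv) (inversion Lv')).
by apply: (ae_mono (ae_and h h')) => x [-> ->].
Qed.

Lemma test_meas (phi : R -> R) : test_function phi ->
  measurable_fun setT phi /\ measurable_fun setT (derive1 phi).
Proof.
move=> [d _]; split; apply: continuous_measurable_fun => x;
  apply/differentiable_continuous/derivable1_diffP.
  exact: (d 0%N x).
exact: (d 1%N x).
Qed.

Lemma weak_derivative_ae u u' v : is_weak_derivative u v -> cmeas u ->
  locally_integrable setT (fun x => Re (u' x)) ->
  locally_integrable setT (fun x => Im (u' x)) ->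
  {ae mu, forall x, u x = u' x} -> is_weak_derivative u' v.
Proof.
move=> [[a1 a2 a3] [b1 b2 b3]] [m1 m2] l1 l2 uu'.
have [k1 _ _] := l1; have [k2 _ _] := l2.
split; split => // phi tphi; have [mp mdp] := test_meas tphi.
  rewrite -a3//; apply: ae_eq_Rint; try exact: measurable_funM.
  by apply: (ae_mono uu') => x ->.
rewrite -b3//; apply: ae_eq_Rint; try exact: measurable_funM.
by apply: (ae_mono uu') => x ->.
Qed.

(** The variable in which functions of order two are parametrized: the transform of
    u - u''. *)
Definition weighted_fourier u : R -> C := fun xi => (1 + xi ^+ 2)%:C * fourier u xi.

Lemma cmeas_sq1 : cmeas (fun xi : R => (1 + xi ^+ 2)%:C : C).
Proof.
apply: cmeas_real; apply: measurable_funD; first exact: measurable_cst.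
by apply: measurable_funX; exact: measurable_id.
Qed.

Lemma second_fourier u v z : L2 u -> L2 v -> L2 z ->
  is_weak_derivative u v -> is_weak_derivative v z ->
  {ae mu, forall xi, weighted_fourier u xi = fourier u xi - fourier z xi}.
Proof.
move=> Lu Lv Lz wu wv.
have h1 := weak_fourier wu Lu Lv (fourierP Lu) (fourierP Lv).
have h2 := weak_fourier wv Lv Lz (fourierP Lv) (fourierP Lz).
apply: (ae_mono (ae_and h1 h2)) => xi [e1 e2]; rewrite e2 e1 /weighted_fourier.
by case: (fourier u xi) => a b; apply: complex_ext; rewrite /=; ring.
Qed.

Lemma L2_weighted_fourier u : sobolev 2 u -> L2 u /\ L2 (weighted_fourier u).
Proof.
move=> [Lu [v wu [Lv [z wv Lz]]]]; split => //.
have h := second_fourier Lu Lv Lz wu wv.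
apply: (L2_ae (u := fun xi => fourier u xi - fourier z xi)).
- by apply: cmeasM; [exact: cmeas_sq1|exact/L2_meas/L2_fourier].
- by apply: L2B; exact: L2_fourier.
- by apply: (ae_mono h) => x ->.
Qed.

Lemma sobolev_norm_le k u (M : \bar R) (j : 'I_k.+1) :
  (sobolev_norm k u <= M)%E -> (L2norm (iter j wderiv u) <= M)%E.
Proof.
apply: le_trans; rewrite /sobolev_norm (bigD1 j)//=.
have n0 i : (0 <= L2norm (iter i wderiv u))%E by exact: Lnorm_ge0.
rewrite -[X in (X <= _)%E]gee0_abs ?n0// -sqrte_sqr.
have s0 : (0 <= \sum_(i < k.+1 | i != j) L2norm (iter i wderiv u) ^+ 2)%E.
  by apply: sume_ge0 => i _; exact: (mule_ge0 (n0 _) (n0 _)).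
rewrite lee_sqrt; first by rewrite leeDl.
by apply: adde_ge0 => //; exact: (mule_ge0 (n0 _) (n0 _)).
Qed.

(** The norm is at most that of u plus that of u''. *)
Lemma weighted_fourier_le u (M : R) : sobolev 2 u -> (sobolev_norm 2 u <= M%:E)%E ->
  nr (weighted_fourier u) <= 2 * M.
Proof.
move=> su hM; have [Lu [v wu [Lv [z wv Lz]]]] := su.
have n0 := sobolev_norm_le (ord0 : 'I_3) hM.
have n1 := sobolev_norm_le (Ordinal (isT : (1 < 3)%N)) hM.
have n2 := sobolev_norm_le (Ordinal (isT : (2 < 3)%N)) hM.
rewrite /= in n0 n1 n2.
have w1 : is_weak_derivative u (wderiv u) by apply: wderivP; exists v.
have L1 : L2 (wderiv u).
  apply: L2norm_lty; first exact: weak_derivative_meas w1.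
  by apply: le_lt_trans n1 _; rewrite ltry.
have vw := weak_derivative_unique Lu Lv L1 wu w1.
have w1z : is_weak_derivative (wderiv u) z.
  apply: (weak_derivative_ae wv (L2_meas Lv)) => //.
  - by case: w1 => -[].
  - by case: w1 => _ [].
have w2 : is_weak_derivative (wderiv u) (wderiv (wderiv u)).
  by apply: wderivP; exists z.
have L2' : L2 (wderiv (wderiv u)).
  apply: L2norm_lty; first exact: weak_derivative_meas w2.
  by apply: le_lt_trans n2 _; rewrite ltry.
have h := second_fourier Lu L1 L2' w1 w2.
have [_ Lw] := L2_weighted_fourier su.
have Ld : L2 (fun xi => fourier u xi - fourier (wderiv (wderiv u)) xi).
  by apply: L2B; exact: L2_fourier.
rewrite (nr_ae (L2_meas Lw) (L2_meas Ld) h).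
apply: (le_trans (nrB (L2_fourier Lu) (L2_fourier L2'))).
rewrite [nr (fourier u)](fourier_norm sqN1 (fourierP Lu)).
rewrite [nr (fourier _)](fourier_norm sqN1 (fourierP L2')).
rewrite (L2normE Lu) lee_fin in n0; rewrite (L2normE L2') lee_fin in n2.
by rewrite mulrDl mul1r lerD.
Qed.

(** Multiplying [weighted_fourier] by this symbol and by the next one gives the
    transforms of u and of its half-Laplacian; both symbols are square integrable. *)
Definition value_symbol (xi : R) : C := (1 + xi ^+ 2)^-1%:C.
Definition half_symbol (xi : R) : C := (`|xi| / (1 + xi ^+ 2))%:C.

Lemma L2_symbols : L2 value_symbol /\ L2 half_symbol.
Proof.
have mj := cmeas_real (@meas_oneDsqrV R).
have ma : cmeas half_symbol.
  apply: cmeas_real; apply: measurable_funM; last exact: meas_oneDsqrV.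
  by apply: continuous_measurable_fun; exact: norm_continuous.
have p x : 0 < 1 + x ^+ 2 :> R by rewrite ltr_pwDl// sqr_ge0.
split; apply/L2P; split => //; apply: (Li_le _ Li_oneDsqrV).
- by apply: measurable_funX; exact: meas_normc.
- move=> x; rewrite ger0_norm ?sqr_ge0// /value_symbol normc_real.
  rewrite ger0_norm ?oneDsqrV_ge0// expr2 ler_piMl ?oneDsqrV_ge0//.
  exact: oneDsqrV_le.
- by apply: measurable_funX; exact: meas_normc.
- move=> x; rewrite ger0_norm ?sqr_ge0// /half_symbol normc_real.
  rewrite real_normK ?num_real// exprMn real_normK ?num_real//.
  rewrite [X in _ * X]expr2 mulrA ler_piMl ?oneDsqrV_ge0//.
  by rewrite ler_pdivrMr// mul1r lerDr.
Qed.

Lemma weighted_fourierK u xi : value_symbol xi * weighted_fourier u xi = fourier u xi /\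
  half_symbol xi * weighted_fourier u xi = `|xi|%:C * fourier u xi.
Proof.
have p : 1 + xi ^+ 2 != 0 :> R by rewrite gt_eqF// ltr_pwDl// sqr_ge0.
rewrite /value_symbol /half_symbol /weighted_fourier; split.
  by rewrite mulrA -realcM mulVf// mul1r.
by rewrite mulrA -realcM divfK.
Qed.

(** Products of two square integrable functions are integrable; in particular u is
    given by an absolutely convergent inversion integral. *)
Lemma fourier_integrable u : L2 (weighted_fourier u) -> cintegrable (fourier u) /\
  cintegrable (fun xi => `|xi|%:C * fourier u xi).
Proof.
move=> Lw; have [Lj La] := L2_symbols; split.
  have := L2_cintegrable Lj Lw.
  by rewrite (_ : (fun x => _) = fourier u)//; apply/funext => xi;
    case: (weighted_fourierK u xi).
have := L2_cintegrable La Lw.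
rewrite (_ : (fun x => _) = (fun xi => `|xi|%:C * fourier u xi))//.
by apply/funext => xi; case: (weighted_fourierK u xi).
Qed.

Lemma L2_abs_fourier u : L2 (weighted_fourier u) -> cmeas (fourier u) ->
  L2 (fun xi => `|xi|%:C * fourier u xi).
Proof.
move=> Lw mf; apply: (L2_le _ Lw).
  have mn : measurable_fun setT (fun x : R => `|x|).
    by apply: continuous_measurable_fun; exact: norm_continuous.
  exact: cmeasM (cmeas_real mn) mf.
move=> xi; rewrite /weighted_fourier !normcM ler_wpM2r ?normc_ge0// !normc_real normr_id.
rewrite [leRHS]ger0_norm; last by rewrite addr_ge0// sqr_ge0.
rewrite -(real_normK (num_real xi)).
have := normr_ge0 xi; move: `|xi| => a a0; have := sqr_ge0 (a - 2^-1); nra.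
Qed.

Lemma value_formula u : sobolev 2 u ->
  {ae mu, forall x, u x = kap%:C * cint (fun eta =>
    (expi (1 * eta * x) * value_symbol eta) * weighted_fourier u eta)}.
Proof.
move=> su; have [Lu Lw] := L2_weighted_fourier su.
have [i1 _] := fourier_integrable Lw.
have h := fourier_L1 sq1 (inversion Lu) i1.
apply: (ae_mono h) => x ->; rewrite /ft; congr (_ * _); apply: eq_cint => eta.
by have [<- _] := weighted_fourierK u eta; rewrite mulrA.
Qed.

Lemma half_laplacianP u : L2 u -> L2 (weighted_fourier u) ->
  is_fourier 1 (fun xi => `|xi|%:C * fourier u xi) (half_laplacian u).
Proof.
move=> Lu Lw; apply: inv_fourierP; apply: L2_abs_fourier => //.
exact/L2_meas/L2_fourier.
Qed.

Lemma half_laplacian_formula u : sobolev 2 u ->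
  {ae mu, forall x, half_laplacian u x = kap%:C * cint (fun eta =>
    (expi (1 * eta * x) * half_symbol eta) * weighted_fourier u eta)}.
Proof.
move=> su; have [Lu Lw] := L2_weighted_fourier su.
have [_ i1] := fourier_integrable Lw.
have h := fourier_L1 sq1 (half_laplacianP Lu Lw) i1.
apply: (ae_mono h) => x ->; rewrite /ft; congr (_ * _); apply: eq_cint => eta.
by have [_ <-] := weighted_fourierK u eta; rewrite mulrA.
Qed.

End SobolevTwo.

(** * Difference quotients, translations and modulations *)

Section DifferenceQuotients.
Context {R : realType}.
Local Notation C := R[i].
Local Notation mu := (@lebesgue_measure R).
Local Notation Li f := (mu.-integrable setT (EFin \o f)).
Implicit Types (u v w : R -> C).

Lemma lipschitz (f df : R -> R) (K a b : R) :
  (forall x, is_derive x (1 : R) f (df x)) -> (forall x, `|df x| <= K) ->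
  `|f b - f a| <= K * `|b - a|.
Proof.
move=> hd hK.
have cf : continuous f.
  move=> x; apply/differentiable_continuous/derivable1_diffP.
  by have [] := hd x.
have K1 (c d : R) : c <= d -> `|f d - f c| <= K * `|d - c|.
  move=> cd; have [y _ ->] := MVT_segment cd (fun x _ => hd x) (continuous_subspaceT cf).
  by rewrite normrM ler_wpM2r.
have [ab|/ltW ba] := leP a b; first exact: K1.
by rewrite distrC (distrC b); exact: K1.
Qed.

(** The steps of the difference quotients: a sequence rather than a continuous
    parameter, for use with dominated convergence. *)
Definition mesh (j : nat) : R := j.+1%:R^-1.

Lemma mesh_gt0 j : 0 < mesh j. Proof. by rewrite invr_gt0. Qed.

Lemma mesh_cvg : mesh j @[j --> \oo] --> (0 : R).
Proof. exact: cvg_harmonic. Qed.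

Lemma quotient_cvg (f : R -> R) (x d : R) : is_derive x (1 : R) f d ->
  (mesh j)^-1 * (f (x + mesh j) - f x) @[j --> \oo] --> d.
Proof.
move=> [df <-].
have m0 : (forall n, mesh n != 0) /\ mesh n @[n --> \oo] --> (0 : R).
  by split; [move=> n; rewrite gt_eqF// mesh_gt0|exact: mesh_cvg].
have h := (@cvgr_dnbhsP R _ _ _).1 df mesh m0.
apply: (cvg_trans _ h); apply: near_eq_cvg; apply: nearW => n.
have -> : (f \o shift x) (mesh n)%:A = f (x + mesh n).
  by congr f; rewrite addrC; congr (_ + _); exact: mulr1.
by [].
Qed.

Lemma sin_lipschitz (a b : R) : `|sin b - sin a| <= `|b - a|.
Proof.
rewrite -[leRHS]mul1r; apply: (@lipschitz _ cos) => x.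
by rewrite ler_norml cos_geN1 cos_le1.
Qed.

Lemma cos_lipschitz (a b : R) : `|cos b - cos a| <= `|b - a|.
Proof.
rewrite -[leRHS]mul1r; apply: (@lipschitz _ (fun x => - sin x)) => x.
by rewrite normrN ler_norml sin_geN1 sin_le1.
Qed.

(** The quadratic error of the linearization, which is also at most linear: the
    factor min(2, |b - a|) is bounded and tends to 0. *)
Lemma sin_taylor (a b : R) :
  `|sin b - sin a - cos a * (b - a)| <= Num.min 2 `|b - a| * `|b - a|.
Proof.
(* The mean value theorem, for both orders of the end points. *)
have [c cab ->] : exists2 c, `|c - a| <= `|b - a| &
    sin b - sin a = cos c * (b - a).
  have cs (A : set R) : {within A, continuous (@sin R)}.
    exact/continuous_subspaceT/continuous_sin.
  have [ab|/ltW ba] := leP a b.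
    have [c] := MVT_segment ab (fun x _ => is_derive_sin x) (cs _).
    rewrite in_itv /= => /andP[ac cb] h; exists c => //.
    by rewrite !ger0_norm ?subr_ge0// lerD2r.
  have [c] := MVT_segment ba (fun x _ => is_derive_sin x) (cs _).
  rewrite in_itv /= => /andP[ac cb] h; exists c.
    by rewrite distrC (distrC b) !ger0_norm ?subr_ge0// lerD2l lerN2.
  by rewrite -[LHS]opprB h -mulrN opprB.
rewrite -mulrBl normrM ler_wpM2r// le_min (le_trans (cos_lipschitz _ _) cab).
rewrite andbT (le_trans (ler_normB _ _))// -[leRHS](_ : 1 + 1 = _)//.
by rewrite lerD// ler_norml cos_geN1 cos_le1.
Qed.

Lemma expi_lipschitz (t : R) : normc (expi t - 1) <= 2 * `|t|.
Proof.
have h : normc (expi t - 1) <= `|cos t - 1| + `|sin t - 0| := normc_le_ReIm _.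
apply: (le_trans h); have h1 := cos_lipschitz 0 t; have h2 := sin_lipschitz 0 t.
rewrite cos0 [t - 0]subr0 in h1; rewrite sin0 [t - 0]subr0 in h2.
by rewrite mulr_natl mulr2n; exact: lerD.
Qed.

(** Multiplying u by a character translates its transform; written with xi - eta, as
    it occurs in convolutions. *)
Lemma fourier_reflect s xi u v : s ^+ 2 = 1 -> is_fourier s u v ->
  is_fourier (- s) (fun x => expi (s * x * xi) * u x) (fun eta => v (xi - eta)).
Proof.
move=> s1 /(is_fourierP _ _ s1)[Lu Lv h]; have s1' : (- s) ^+ 2 = 1 by rewrite sqrrN.
have me : cmeas (fun x : R => expi (s * x * xi)) by exact: cmeas_kernel1.
apply/(is_fourierP _ _ s1'); split.
- by apply: (L2M_bounded (K := 1) me Lu) => x; rewrite normc_expi.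
- by case: (L2_reflect xi Lv).
have E n eta : ft (- s) (cutoff n (fun x => expi (s * x * xi) * u x)) eta =
    ft s (cutoff n u) (xi - eta).
  rewrite /ft; congr (_ * _); apply: eq_cint => x.
  have -> : s * x * (xi - eta) = - s * x * eta + s * x * xi by ring.
  rewrite expiD -[RHS]mulrA; congr (_ * _).
  by rewrite !cutoffE; case: (_ && _); rewrite ?mulr0.
have e n : nr (fun eta => ft (- s) (cutoff n (fun x => expi (s * x * xi) * u x)) eta
     - v (xi - eta)) = nr (fun eta => ft s (cutoff n u) eta - v eta).
  have [_ <-] := L2_reflect xi (L2B (L2_ft_cutoff n s1 Lu) Lv).
  by congr nr; apply/funext => eta; rewrite E.
by rewrite (funext e).
Qed.

Lemma fourier_modulate s h u v : s ^+ 2 = 1 -> is_fourier s u v ->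
  is_fourier s (fun x => expi (s * x * h) * u x) (fun eta => v (eta + h)).
Proof.
move=> s1 F; have s1' : (- s) ^+ 2 = 1 by rewrite sqrrN.
have := fourier_reflect 0 s1' (fourier_reflect h s1 F); rewrite opprK.
rewrite (_ : (fun x => _) = (fun x => expi (s * x * h) * u x)); last first.
  by apply/funext => x; rewrite mulr0 expi0 mul1r.
rewrite (_ : (fun eta => v (h - _)) = (fun eta => v (eta + h)))//.
by apply/funext => eta; rewrite sub0r opprK addrC.
Qed.

Lemma fourier_translate s h u v : s ^+ 2 = 1 -> is_fourier s u v ->
  is_fourier s (fun x => u (x + h)) (fun xi => expi (- s * xi * h) * v xi).
Proof.
move=> s1 F; have s1' : (- s) ^+ 2 = 1 by rewrite sqrrN.
have := fourier_inv s1' (fourier_modulate h s1' (fourier_inv s1 F)).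
by rewrite opprK.
Qed.

End DifferenceQuotients.

(** * Difference quotients on the Fourier side *)

Section BoundedPrimitive.
Context {R : realType}.
Local Notation C := R[i].
Local Notation mu := (@lebesgue_measure R).
Local Notation Li f := (mu.-integrable setT (EFin \o f)).
Implicit Types (u v w : R -> C).

(** The inverse is the pointwise limit of x / (x^2 + 1/(n+1)), also at 0, where the
    inverse is 0 by convention. *)
Lemma meas_inv : measurable_fun setT (fun x : R => x^-1).
Proof.
have mf n : measurable_fun setT (fun x : R => x * (x ^+ 2 + mesh n)^-1).
  apply: measurable_funM => //; apply: continuous_measurable_fun => x.
  apply: cvgV; first by rewrite gt_eqF// ltr_wpDl ?sqr_ge0// mesh_gt0.
  by apply: cvgD; [exact: exprn_continuous|exact: cvg_cst].
apply: (measurable_fun_cvg mf) => x _.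
have [->|x0] := eqVneq x 0.
  by under eq_fun do rewrite mul0r; rewrite invr0; exact: cvg_cst.
have -> : x^-1 = x * (x ^+ 2 + 0)^-1 by rewrite addr0; field.
apply: cvgM; first exact: cvg_cst.
apply: cvgV; first by rewrite addr0 sqrf_eq0.
by apply: cvgD; [exact: cvg_cst|exact: mesh_cvg].
Qed.

Definition dquot (j : nat) u : R -> C :=
  fun x => (mesh j)^-1%:C * (u (x + mesh j) - u x).

(** The Fourier multiplier of the difference quotient. *)
Definition dmult (j : nat) : R -> C :=
  fun xi => (mesh j)^-1%:C * (expi (mesh j * xi) - 1).

Lemma dmult_le j xi : normc (dmult j xi) <= 2 * `|xi|.
Proof.
rewrite normcM normc_real; apply: le_trans (ler_wpM2l _ (expi_lipschitz _)) _ => //.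
have m0 := @mesh_gt0 R j.
rewrite normrM normfV !(ger0_norm (ltW m0)).
have E : (mesh j)^-1 * (2 * (mesh j * `|xi|)) = 2 * `|xi|.
  by field; rewrite gt_eqF.
by rewrite E.
Qed.

Lemma cmeas_dmult j : cmeas (dmult j).
Proof.
apply: cmeasZ; apply: cmeasB; last exact: cmeas_cst.
by apply: cmeas_expi; apply: measurable_funM => //; exact: measurable_cst.
Qed.

Lemma dmult_cvg xi : ccvg (fun j => dmult j xi) (0 +i* xi).
Proof.
have hc := is_derive_affine (is_derive_cos (xi * 0 + 0)).
have hs := is_derive_affine (is_derive_sin (xi * 0 + 0)).
have := quotient_cvg hs; have := quotient_cvg hc.
rewrite mulr0 addr0 sin0 cos0 oppr0 mulr0 mulr1 => c0 s0.
have E (j : nat) : xi * (0 + mesh j) + 0 = mesh j * xi by ring.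
apply/ccvgP; split.
  apply: (cvg_trans _ c0); apply: near_eq_cvg; apply: nearW => j.
  by rewrite E /dmult ReME ReDE ReNE /= mul0r subr0.
apply: (cvg_trans _ s0); apply: near_eq_cvg; apply: nearW => j.
by rewrite E addr0 /dmult ImME ImDE ImNE /= mul0r addr0 subr0.
Qed.

Lemma L2_dquot j u : L2 u -> L2 (dquot j u).
Proof. by move=> Lu; apply: L2Z; apply: L2B => //; exact: (proj1 (L2_shift _ Lu)). Qed.

Lemma fourier_dquot j u U : is_fourier (- 1) u U ->
  is_fourier (- 1) (dquot j u) (fun xi => dmult j xi * U xi).
Proof.
move=> F; have F1 := fourier_lin (- 1) (@sqN1 R) F (fourier_translate (mesh j) (@sqN1 R) F).
(* Linearity with equal arguments and the coefficient k - 1 gives the multiple by k. *)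
have := fourier_lin ((mesh j)^-1%:C - 1) (@sqN1 R) F1 F1.
congr (is_fourier _ _ _); apply/funext => x; first by rewrite /dquot; ring.
have -> : - -1 * x * mesh j = mesh j * x by ring.
by rewrite /dmult; ring.
Qed.

(** The ratio of [dmult] to i xi, minus one; at xi = 0, where both multipliers
    vanish, its value is -1. *)
Definition dcorr (j : nat) : R -> C :=
  fun xi => dmult j xi * (0 +i* - xi^-1) - 1.

(** This uniform bound, with the pointwise convergence to 0, allows dominated
    convergence against the transform of the derivative only. *)
Lemma dcorr_le j xi : normc (dcorr j xi) <= 3.
Proof.
apply: le_trans (normcD _ _) _; rewrite normcN normc1 normcM.
have -> : normc (0 +i* - xi^-1 : C) = `|xi^-1|.
  by rewrite /= expr0n add0r sqrtr_sqr normrN.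
have -> : 3 = 2 + 1 :> R by ring.
rewrite lerD2r (le_trans (ler_wpM2r _ (dmult_le _ _)))//.
rewrite -mulrA -normrM; have [->|x0] := eqVneq xi 0.
  by rewrite mul0r normr0 mulr0.
by rewrite divff// normr1 mulr1.
Qed.

Lemma cmeas_dcorr j : cmeas (dcorr j).
Proof.
apply: cmeasB; last exact: cmeas_cst.
apply: cmeasM; first exact: cmeas_dmult.
split; first exact: measurable_cst.
by apply: measurableT_comp => //; exact: meas_inv.
Qed.

Lemma dcorrE j xi (U V : C) : V = (0 +i* xi) * U ->
  dmult j xi * U - V = dcorr j xi * V.
Proof.
move=> ->; rewrite /dcorr; have [->|x0] := eqVneq xi 0.
  have -> : (0 +i* 0) = 0 :> C by [].
  by rewrite mul0r mulr0 subr0 /dmult mulr0 expi0 subrr mulr0 mul0r.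
set W := (0 +i* - xi^-1); set Z := (0 +i* xi).
have WZ : W * Z = 1.
  by apply: complex_ext; rewrite ?ReME ?ImME /W /Z /=; field.
by rewrite mulrBl mul1r -!mulrA [W * _]mulrA WZ mul1r.
Qed.

Lemma dcorr_cvg xi : xi != 0 -> ccvg (fun j => dcorr j xi) 0.
Proof.
move=> x0; have := ccvgD (ccvgZ (0 +i* - xi^-1) (dmult_cvg xi)) (ccvg_cst (-1)).
have -> : (0 +i* - xi^-1) * (0 +i* xi) + -1 = 0 :> C.
  by apply: complex_ext; rewrite ?ReDE ?ImDE ?ReME ?ImME /=; field.
by congr ccvg; apply/funext => j; rewrite /dcorr mulrC.
Qed.

Lemma dcorr_L2_cvg V : L2 V -> nr (fun xi => dcorr j xi * V xi) @[j --> \oo] --> (0 : R).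
Proof.
move=> LV; apply: (@L2_dct0 _ _ (fun x => 3 * normc (V x))).
- by move=> n; apply: cmeasM; [exact: cmeas_dcorr|exact: L2_meas].
- under [X in mu.-integrable _ (_ \o X)]eq_fun do rewrite exprMn.
  exact: LiZ (L2_sq LV).
- apply: ae_all => x n; rewrite normcM ler_wpM2r ?normc_ge0//; exact: dcorr_le.
- have n0 : {ae mu, forall x : R, x != 0}.
    exists [set 0]; split; [by []|exact: lebesgue_measure_set1|].
    by move=> x /= /negP; rewrite negbK => /eqP.
  apply: (ae_mono n0) => x x0.
  have := ccvgZ (V x) (dcorr_cvg x0); rewrite mulr0.
  by congr ccvg; apply/funext => j; rewrite mulrC.
Qed.

(** The error of the difference quotient is controlled by the transform of the
    derivative alone. *)
Lemma nr_dquot u v U V j : is_fourier (- 1) u U -> is_fourier (- 1) v V ->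
  {ae mu, forall xi, V xi = (0 +i* xi) * U xi} ->
  nr (fun x => dquot j u x - v x) = nr (fun xi => dcorr j xi * V xi).
Proof.
move=> FU FV h; have FD := fourier_dquot j FU.
have := fourier_lin (- 1) (@sqN1 R) FV FD => /(fourier_norm (@sqN1 R)).
have [Lv LV _] := FV; have [Ld LU _] := FD.
have -> : (fun x => -1 * v x + dquot j u x) = (fun x => dquot j u x - v x).
  by apply/funext => x; rewrite mulN1r addrC.
move=> <-; apply: nr_ae.
- by apply: cmeasD; [apply: cmeasZ|]; exact: L2_meas.
- by apply: cmeasM; [exact: cmeas_dcorr|exact: L2_meas].
- by apply: (ae_mono h) => xi /(dcorrE j) <-; rewrite mulN1r addrC.
Qed.

End BoundedPrimitive.

(** * Smooth truncation of bounded functions *)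

Section BoundedQuotient.
Context {R : realType}.
Local Notation C := R[i].
Local Notation mu := (@lebesgue_measure R).
Local Notation Li f := (mu.-integrable setT (EFin \o f)).
Implicit Types (u v w : R -> C).

Lemma dchi_ccvg0 (x : R) (w : C) : ccvg (fun n => (dchi n x)%:C * w) 0.
Proof.
have h := @cvgMc0 R _ (expR 2 * 2 * normc w) (@cvg_harmonic R).
apply: (cvg0_le _ _ h) => n; first exact: normc_ge0.
rewrite subr0 normcM normc_real mulrA ler_wpM2r ?normc_ge0//.
exact: dchi_le.
Qed.

(** A square integrable majorant of the derivatives of the cut-offs, uniform in n:
    on the support of the n-th one, 1/(n+1) is at most 2 / sqrt(1 + x^2). *)
Lemma dchi_decay n (x : R) :
  `|dchi n x| <= expR 2 * 4 * Num.sqrt ((1 + x ^+ 2)^-1).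
Proof.
have p : 0 < 1 + x ^+ 2 by rewrite ltr_pwDl// sqr_ge0.
have [h|h] := ltP n.+1%:R `|x|.
  by rewrite dchi_out// normr0 mulr_ge0// ?sqrtr_ge0// mulr_ge0// expR_ge0.
apply: le_trans (dchi_le n x) _.
have -> : n.+1%:R^-1 * (expR 2 * 2) = expR 2 * 4 * (n.+1%:R^-1 / 2) :> R by field.
rewrite ler_wpM2l// ?mulr_ge0// ?expR_ge0//.
have q0 : 0 <= n.+1%:R^-1 / 2 :> R by rewrite divr_ge0.
rewrite -[leLHS](ger0_norm q0) -sqrtr_sqr ler_sqrt ?invr_ge0 ?(ltW p)//.
rewrite expr_div_n exprVn -invfM lef_pV2 ?posrE ?mulr_gt0 ?exprn_gt0//.
rewrite -(real_normK (num_real x)).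
have n1 : 1 <= n.+1%:R :> R by rewrite ler1n.
have := normr_ge0 x; move: `|x| n.+1%:R n1 h => a b; nra.
Qed.

Lemma dchi_bounded_cvg0 u (K : R) : cmeas u -> (forall x, normc (u x) <= K) ->
  nr (fun x => (dchi n x)%:C * u x) @[n --> \oo] --> (0 : R).
Proof.
move=> mu_ uK; have K0 : 0 <= K by apply: le_trans (uK 0); exact: normc_ge0.
apply: (@L2_dct0 _ _ (fun x => expR 2 * 4 * K * Num.sqrt ((1 + x ^+ 2)^-1))).
- by move=> n; apply: cmeasM => //; exact: cmeas_real (meas_dchi n).
- have E (x : R) : (expR 2 * 4 * K * Num.sqrt ((1 + x ^+ 2)^-1)) ^+ 2 =
      (expR 2 * 4 * K) ^+ 2 * (1 + x ^+ 2)^-1.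
    by rewrite exprMn sqr_sqrtr// oneDsqrV_ge0.
  by rewrite (funext E); exact: LiZ (@Li_oneDsqrV R).
- apply: ae_all => x n; rewrite normcM normc_real mulrAC.
  by apply: ler_pM => //; [exact: normc_ge0|exact: dchi_decay].
- by apply: ae_all => x; exact: dchi_ccvg0.
Qed.

Lemma L2_box_bounded n u (K : R) : cmeas u -> (forall x, normc (u x) <= K) ->
  L2 (fun x => box n x * u x).
Proof.
move=> mu_ uK; have := L2M_bounded mu_ (L2_box n) uK.
by congr L2; apply/funext => x; rewrite mulrC.
Qed.

Lemma L2_box_mul n u : L2 u -> L2 (fun x => box n x * u x).
Proof.
move=> Lw; apply: (L2M_bounded (K := 1) (L2_meas (L2_box n)) Lw) => x.
by rewrite (le_trans (normc_cutoff_le _ _ _))// normc1.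
Qed.

(** A bounded function need not be square integrable, but its truncations are, with
    derivative chi v + chi' u. *)
Lemma truncated_pair u v (K : R) n : cmeas u -> (forall x, normc (u x) <= K) ->
  L2 v -> is_weak_derivative u v ->
  let f := fun x => (chi n x)%:C * u x in
  let g := fun x => (chi n x)%:C * v x + (dchi n x)%:C * u x in
  [/\ is_fourier (- 1) f (ft (- 1) f), is_fourier (- 1) g (ft (- 1) g) &
   forall xi, ft (- 1) g xi = (0 +i* xi) * ft (- 1) f xi].
Proof.
move=> mu_ uK Lv w f g; have [Lf Ld] := L2_chi_bounded n mu_ uK.
have Lc := L2_chiM n Lv; have Lg : L2 g by exact: L2D.
have sf : supp n.+1 f by exact: supp_chiM.
have sg : supp n.+1 g.
  by move=> x hx; rewrite /g chi_out// dchi_out// !mul0r addr0.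
have fp (p : R -> C) : L2 p -> supp n.+1 p -> is_fourier (- 1) p (ft (- 1) p).
  move=> Lp sp; have ip := supp_integrable sp Lp.
  have [P FP] := fourier_exists (@sqN1 R) Lp.
  have h := fourier_L1 (@sqN1 R) FP ip.
  apply: (is_fourier_ae (@sqN1 R) FP (L2_meas Lp)) => //.
    exact: cmeas_ft.
  exact: ae_all.
split; [exact: fp|exact: fp|] => xi.
have := weak_ft xi w (L2_box_bounded n.+1 mu_ uK) (L2_box_mul n.+1 Lv).
have ic : cintegrable (fun x => (chi n x)%:C * v x).
  by apply: (supp_integrable _ Lc); exact: supp_chiM.
have id_ : cintegrable (fun x => (dchi n x)%:C * u x).
  by apply: (supp_integrable _ Ld); exact: supp_dchiM.
by rewrite /g (ftD _ ic id_) => ->; rewrite subrK.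
Qed.

(** The derivatives of the truncations tend to v in the mean. *)
Lemma truncated_cvg u v (K : R) : cmeas u -> (forall x, normc (u x) <= K) ->
  L2 v ->
  nr (fun x => ((chi n x)%:C * v x + (dchi n x)%:C * u x) - v x)
    @[n --> \oo] --> (0 : R).
Proof.
move=> mu_ uK Lv.
have h := cvg0D (chiM_cvg Lv) (dchi_bounded_cvg0 mu_ uK).
apply: (cvg0_le _ _ h) => n; first exact: nr_ge0.
have [_ Ld] := L2_chi_bounded n mu_ uK.
have := nrD (L2B (L2_chiM n Lv) Lv) Ld.
by congr (nr _ <= _); apply/funext => x; rewrite addrAC.
Qed.

End BoundedQuotient.

(** * The chain rule for the sine *)

Section SineChainRule.
Context {R : realType}.
Local Notation C := R[i].
Local Notation mu := (@lebesgue_measure R).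
Local Notation Li f := (mu.-integrable setT (EFin \o f)).
Implicit Types (u v w : R -> C).

Lemma L2_normc u : L2 u -> L2 (fun x => (normc (u x))%:C) /\
  nr (fun x => (normc (u x))%:C) = nr u.
Proof.
move=> Lu; have E x : normc (normc (u x))%:C = normc (u x).
  by rewrite normc_real ger0_norm// normc_ge0.
split; first apply: (L2_le _ Lu).
- by apply: cmeas_real; apply: meas_normc; exact: L2_meas.
- by move=> x; rewrite E.
- by congr Num.sqrt; apply: eqRint => x; rewrite E.
Qed.

Lemma nr_le_lin (a b : R) u v w : 0 <= a -> 0 <= b -> L2 u -> L2 v -> L2 w ->
  (forall x, normc (u x) <= a * normc (v x) + b * normc (w x)) ->
  nr u <= a * nr v + b * nr w.
Proof.
move=> a0 b0 Lu Lv Lw h; have [Lv' <-] := L2_normc Lv; have [Lw' <-] := L2_normc Lw.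
have na (c : R) : 0 <= c -> normc c%:C = c by move=> c0; rewrite normc_real ger0_norm.
rewrite -{1}(na a a0) -{1}(na b b0) -(nrZ _ Lv') -(nrZ _ Lw').
apply: le_trans (nrD (L2Z _ Lv') (L2Z _ Lw')).
apply: nr_le => //; first by apply: L2D; exact: L2Z.
move=> x; have p0 : 0 <= a * normc (v x) + b * normc (w x).
  by rewrite addr_ge0// mulr_ge0// normc_ge0.
have E : (a * normc (v x) + b * normc (w x))%:C =
    a%:C * (normc (v x))%:C + b%:C * (normc (w x))%:C by rewrite rmorphD !rmorphM.
by rewrite -E na.
Qed.

(** That v is the derivative of u can be read on the Fourier side or from the
    difference quotients; the second form passes through nonlinear functions. *)
Lemma fourier_pair_cvg u v : L2 u -> L2 v ->
  {ae mu, forall xi, fourier v xi = (0 +i* xi) * fourier u xi} <->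
  (nr (fun x => dquot j u x - v x) @[j --> \oo] --> (0 : R)).
Proof.
move=> Lu Lv; have LV := L2_fourier Lv; split=> [h|h].
  have E j := nr_dquot j (fourierP Lu) (fourierP Lv) h.
  by rewrite (funext E); exact: dcorr_L2_cvg.
have FD j := fourier_dquot j (fourierP Lu).
have LD j : L2 (fun xi => dmult j xi * fourier u xi) by case: (FD j).
apply: (L2_lim_ae LD LV).
  have E j : nr (fun xi => dmult j xi * fourier u xi - fourier v xi) =
      nr (fun x => dquot j u x - v x).
    have := fourier_norm (@sqN1 R) (fourier_lin (- 1) (@sqN1 R) (fourierP Lv) (FD j)).
    by congr (nr _ = nr _); apply/funext => x; rewrite mulN1r addrC.
  by rewrite (funext E).
apply: ae_all => xi; have := ccvgZ (fourier u xi) (dmult_cvg xi).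
by rewrite mulrC; congr ccvg; apply/funext => j; rewrite mulrC.
Qed.

Definition csin (f : R -> R) : R -> C := cplx (fun x => sin (f x)).
Definition ccos (f : R -> R) : R -> C := cplx (fun x => cos (f x)).

Lemma cmeas_cplx (f : R -> R) : continuous f -> cmeas (cplx f).
Proof. by move=> cf; apply: cmeas_real; exact: continuous_measurable_fun. Qed.

Lemma cmeas_csin (f : R -> R) : continuous f -> cmeas (csin f).
Proof.
move=> cf; apply: cmeas_cplx => x; apply: continuous_comp; first exact: cf.
exact: continuous_sin.
Qed.

Lemma cmeas_ccos (f : R -> R) : continuous f -> cmeas (ccos f).
Proof.
move=> cf; apply: cmeas_cplx => x; apply: continuous_comp; first exact: cf.
exact: continuous_cos.
Qed.

Lemma csin_le1 (f : R -> R) x : normc (csin f x) <= 1.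
Proof. by rewrite normc_real ler_norml sin_geN1 sin_le1. Qed.

Lemma ccos_le1 (f : R -> R) x : normc (ccos f x) <= 1.
Proof. by rewrite normc_real ler_norml cos_geN1 cos_le1. Qed.

(** The difference quotient of sin f is cos f times that of f, up to an error
    bounded by min(2, |f(x+h) - f(x)|) times the difference quotient of f, and this
    product tends to 0 in the mean because f is continuous. *)
Lemma sin_chain_rule (f : R -> R) p : continuous f -> L2 (cplx f) -> L2 p ->
  {ae mu, forall xi, fourier p xi = (0 +i* xi) * fourier (cplx f) xi} ->
  [/\ L2 (csin f), L2 (fun x => ccos f x * p x) &
   {ae mu, forall xi, fourier (fun x => ccos f x * p x) xi =
                      (0 +i* xi) * fourier (csin f) xi}].
Proof.
move=> cf Lf Lp fp.
have Ls : L2 (csin f).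
  apply: (L2_le (cmeas_csin cf) Lf) => x; rewrite !normc_real.
  by have := sin_lipschitz 0 (f x); rewrite sin0 !subr0.
have Lc : L2 (fun x => ccos f x * p x).
  exact: (L2M_bounded (cmeas_ccos cf) Lp (ccos_le1 f)).
split; [exact: Ls|exact: Lc|apply: (fourier_pair_cvg Ls Lc).2].
have d0 := (fourier_pair_cvg Lf Lp).1 fp.
pose m j x : C := (Num.min 2 `|f (x + mesh j) - f x|)%:C.
have m2 j x : normc (m j x) <= 2.
  by rewrite normc_real ger0_norm ?ge_min ?lexx// le_min normr_ge0 andbT.
have mm j : cmeas (m j).
  apply: cmeas_real; apply: measurable_minr; first exact: measurable_cst.
  apply: measurableT_comp => //; apply: measurable_funB.
    apply: (measurableT_comp (continuous_measurable_fun cf)).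
    exact: measurable_funD.
  exact: continuous_measurable_fun.
have LM j : L2 (fun x => m j x * p x) := L2M_bounded (mm j) Lp (m2 j).
have M0 : nr (fun x => m j x * p x) @[j --> \oo] --> (0 : R).
  apply: (@L2_dct0 _ _ (fun x => 2 * normc (p x))).
  - by move=> n; exact: L2_meas (LM n).
  - under [X in mu.-integrable _ (_ \o X)]eq_fun do rewrite exprMn.
    exact: LiZ (L2_sq Lp).
  - by apply: ae_all => x n; rewrite normcM ler_wpM2r ?normc_ge0.
  - apply: ae_all => x.
    have h : `|f (x + mesh j) - f x| @[j --> \oo] --> (0 : R).
      have h0 : x + mesh j @[j --> \oo] --> x.
        by rewrite -[X in _ --> X]addr0; apply: cvgD; [exact: cvg_cst|exact: mesh_cvg].
      have h1 : f (x + mesh j) @[j --> \oo] --> f x := cvg_comp _ _ h0 (cf x).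
      exact: (cvg_dist0 _ _).1 h1.
    apply: (cvg0_le _ _ (cvg0Z (normc (p x)) h)) => n; first exact: normc_ge0.
    rewrite subr0 normcM mulrC ler_wpM2l ?normc_ge0//.
    by rewrite normc_real ger0_norm ?ge_min ?lexx ?orbT// le_min normr_ge0 andbT.
have LD j := L2B (L2_dquot j Lf) Lp.
apply: (cvg0_le _ _ (cvg0D (cvg0Z 3 d0) M0)) => j; first exact: nr_ge0.
rewrite -[X in _ + X]mul1r; apply: nr_le_lin => //.
  by apply: L2B => //; exact: L2_dquot.
move=> x; rewrite mul1r; set a := f x; set b := f (x + mesh j).
pose t : C := ((mesh j)^-1 * (sin b - sin a - cos a * (b - a)))%:C.
have -> : dquot j (csin f) x - ccos f x * p x =
    ccos f x * (dquot j (cplx f) x - p x) + t.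
  rewrite /t /dquot /csin /ccos /cplx -/a -/b.
  by rewrite !(rmorphB, rmorphM) /=; ring.
have tm : normc t <= normc (m j x) * normc (dquot j (cplx f) x).
  have me := @mesh_gt0 R j.
  rewrite /t /m /dquot !normcM !normc_real /cplx -/a -/b -rmorphB normc_real.
  rewrite normrM mulrCA ler_wpM2l// (le_trans (sin_taylor a b))//.
  by rewrite ler_wpM2r// ler_norm.
apply: (le_trans (normcD _ _)); rewrite normcM normcM.
set d := dquot j (cplx f) x in tm *.
have dd : normc d <= normc (d - p x) + normc (p x).
  by rewrite -{1}(subrK (p x) d) normcD.
apply: (le_trans (lerD (ler_wpM2r (normc_ge0 _) (ccos_le1 f x)) tm)).
have -> : 3 = 1 + 2 :> R by ring.
rewrite mul1r [(1 + 2) * _]mulrDl mul1r -addrA lerD2l.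
apply: (le_trans (ler_wpM2l (normc_ge0 _) dd)); rewrite mulrDr lerD2r.
by rewrite ler_wpM2r ?normc_ge0.
Qed.

End SineChainRule.

(** * The commutator with a square integrable multiplier *)

Section Commutator.
Context {R : realType}.
Local Notation C := R[i].
Local Notation mu := (@lebesgue_measure R).
Local Notation Li f := (mu.-integrable setT (EFin \o f)).
Implicit Types (u v w a b : R -> C).

(** The quotient (|xi| - |eta|) / (i (xi - eta)); its modulus is at most 1. *)
Definition quotient_symbol (xi eta : R) : C :=
  0 +i* - ((`|xi| - `|eta|) * (xi - eta)^-1).

Lemma quotient_symbol_le xi eta : normc (quotient_symbol xi eta) <= 1.
Proof.
have -> : normc (quotient_symbol xi eta) = `|(`|xi| - `|eta|) * (xi - eta)^-1|.
  by rewrite /quotient_symbol /= expr0n add0r sqrtr_sqr normrN.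
rewrite normrM normfV; have [->|x0] := eqVneq (xi - eta) 0.
  by rewrite normr0 invr0 mulr0.
by rewrite ler_pdivrMr ?normr_gt0// mul1r ler_dist_dist.
Qed.

(** On the diagonal both sides vanish. *)
Lemma quotient_symbolE xi eta (z : C) :
  quotient_symbol xi eta * ((0 +i* (xi - eta)) * z) = (`|xi| - `|eta|)%:C * z.
Proof.
rewrite mulrA; congr (_ * _); have [x0|x0] := eqVneq (xi - eta) 0.
  have -> : xi = eta by apply/eqP; rewrite -subr_eq0 x0.
  by apply: complex_ext; rewrite ?ReME ?ImME /= !subrr; ring.
by apply: complex_ext; rewrite ?ReME ?ImME /=; field.
Qed.

Lemma cmeas_quotient_symbol xi : cmeas (quotient_symbol xi).
Proof.
split; first exact: measurable_cst.
apply: measurableT_comp => //; apply: measurable_funM.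
  apply: measurable_funB; first exact: measurable_cst.
  by apply: continuous_measurable_fun; exact: norm_continuous.
by apply: (measurableT_comp (@meas_inv R)); exact: measurable_funB.
Qed.

Lemma ae_reflect (xi : R) u v : cmeas u -> cmeas v ->
  {ae mu, forall x, u x = v x} -> {ae mu, forall eta, u (xi - eta) = v (xi - eta)}.
Proof.
move=> mu_ mv uv; have md := cmeasB mu_ mv.
have d0 : {ae mu, forall x, 0 = u x - v x}.
  by apply: (ae_mono uv) => x ->; rewrite subrr.
have Ld := L2_ae md (@L2_0 R) d0.
have [Lr nE] := L2_reflect xi Ld.
have n0 : nr (fun x => u x - v x) = 0.
  have zz : {ae mu, forall x, u x - v x = 0} by apply: (ae_mono d0) => x <-.
  rewrite (nr_ae md (L2_meas (@L2_0 R)) zz) /nr.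
  rewrite (eqRint (g := fun=> 0)) ?Rintegral_cst ?mul0r ?sqrtr0//.
  by move=> x; rewrite normc0 expr0n.
rewrite n0 in nE; have := nr_eq0 Lr nE.
by move=> h; apply: (ae_mono h) => x /eqP; rewrite subr_eq0 => /eqP.
Qed.

(** The transform of a product is a convolution; this is the multiplication formula
    applied to u and to a times a character. *)
Lemma ft_product a u U xi : L2 a -> L2 u -> is_fourier 1 U u ->
  ft (- 1) (fun x => a x * u x) xi =
  kap%:C * cint (fun eta => U eta * fourier a (xi - eta)).
Proof.
move=> La Lu F; have := fourier_reflect xi (@sqN1 R) (fourierP La).
rewrite opprK => Fr; rewrite -(fourier_mult (@sq1 R) F Fr) /ft.
by congr (_ * _); apply: eq_cint => x; rewrite mulrA.
Qed.

(** Both terms are convolutions with the transform of a, and the difference of the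
    symbols |xi| and |eta| is divided by i (xi - eta), which turns the transform of a
    into that of its derivative b. *)
Lemma commutator_truncated a b u xi : L2 a -> L2 b ->
  {ae mu, forall z, fourier b z = (0 +i* z) * fourier a z} ->
  L2 u -> L2 (weighted_fourier u) ->
  `|xi|%:C * ft (- 1) (fun x => a x * u x) xi -
    ft (- 1) (fun x => a x * half_laplacian u x) xi =
  kap%:C * cint (fun eta =>
    (quotient_symbol xi eta * fourier b (xi - eta)) * fourier u eta).
Proof.
move=> La Lb ab Lu Lw.
have Fu := inversion Lu; have FL := half_laplacianP Lu Lw.
have [LH LL _] := FL.
rewrite (ft_product xi La Lu Fu) (ft_product xi La LL FL).
have LA := proj1 (L2_reflect xi (L2_fourier La)).
have LU := L2_fourier Lu; have LB := L2_fourier Lb.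
have i1 := L2_cintegrable LU LA; have i2 := L2_cintegrable LH LA.
rewrite mulrCA -mulrBr -(cintZ _ i1) -(cintB (cintegrableZ _ i1) i2).
congr (_ * _).
have mz : cmeas (fun z : R => (0 +i* z : C)).
  by split; [exact: measurable_cst|exact: measurable_id].
have h := ae_reflect xi (L2_meas LB) (cmeasM mz (L2_meas (L2_fourier La))) ab.
apply: ae_eq_cint.
- by apply: cmeasB; apply: cintegrable_meas => //; exact: cintegrableZ.
- apply: cmeasM; last exact: L2_meas.
  apply: cmeasM; first exact: cmeas_quotient_symbol.
  exact: L2_meas (proj1 (L2_reflect xi LB)).
- apply: (ae_mono h) => eta ->; rewrite quotient_symbolE rmorphB /=; ring.
Qed.

End Commutator.

(** * The commutator with the sine of a bounded phase *)

Section CommutatorFormula.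
Context {R : realType}.
Local Notation C := R[i].
Local Notation mu := (@lebesgue_measure R).
Local Notation Li f := (mu.-integrable setT (EFin \o f)).
Implicit Types (u v w a b : R -> C).

Lemma fourier_ft s u : s ^+ 2 = 1 -> L2 u -> cintegrable u ->
  is_fourier s u (ft s u).
Proof.
move=> s1 Lu iu; have [P FP] := fourier_exists s1 Lu.
apply: (is_fourier_ae s1 FP (L2_meas Lu) (cmeas_ft s iu)); first exact: ae_all.
exact: fourier_L1 s1 FP iu.
Qed.

Lemma fourier_dist s u v U V : s ^+ 2 = 1 -> is_fourier s u U ->
  is_fourier s v V ->
  nr (fun xi => U xi - V xi) = nr (fun x => u x - v x).
Proof.
move=> s1 Fu Fv; have := fourier_norm s1 (fourier_lin (- 1) s1 Fv Fu).
by congr (nr _ = nr _); apply/funext => x; rewrite mulN1r addrC.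
Qed.

Variables (theta : R -> R) (K : R) (omega : R -> C).
Hypothesis cth : continuous theta.
Hypothesis thK : forall x, `|theta x| <= K.
Hypothesis Lom : L2 omega.
Hypothesis wth : is_weak_derivative (cplx theta) omega.

Let f n (x : R) : R := chi n x * theta x.
Let p n x : C := (chi n x)%:C * omega x + (dchi n x)%:C * (theta x)%:C.

Let cf n : continuous (f n).
Proof.
by move=> x; apply: cvgM; [exact: (Cn_continuous (Cn_chi 1 n))|exact: cth].
Qed.

Let mth : cmeas (cplx theta). Proof. exact: cmeas_cplx. Qed.

Let thKc x : normc (cplx theta x) <= K. Proof. by rewrite normc_real. Qed.

Let fE n : cplx (f n) = (fun x => (chi n x)%:C * cplx theta x).
Proof. by apply/funext => x; rewrite /cplx /f rmorphM. Qed.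

Let pair n : [/\ L2 (csin (f n)), L2 (fun x => ccos (f n) x * p n x) &
   {ae mu, forall xi, fourier (fun x => ccos (f n) x * p n x) xi =
                      (0 +i* xi) * fourier (csin (f n)) xi}].
Proof.
have [Ff Fp hp] := truncated_pair n mth thKc Lom wth.
rewrite -fE in Ff hp; have [Lf _ _] := Ff; have [Lp _ _] := Fp.
apply: (@sin_chain_rule R (f n) (p n) (@cf n) Lf Lp).
have h1 := fourier_unique (@sqN1 R) (fourierP Lf) Ff.
have h2 := fourier_unique (@sqN1 R) (fourierP Lp) Fp.
by apply: (ae_mono (ae_and h1 h2)) => xi [-> ->]; exact: hp.
Qed.

Let f_cvg x : f n x @[n --> \oo] --> theta x.
Proof.
rewrite -[X in _ --> X]mul1r; apply: cvgM; first exact: chi_cvg.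
exact: cvg_cst.
Qed.

Let sin_cvg x (w : C) : ccvg (fun n => csin (f n) x * w) (csin theta x * w).
Proof.
apply/cvg0_le; last first.
- apply: (cvg0Z (normc w)); apply: ((cvg_dist0 _ _).1 (@f_cvg x)).
- move=> n; rewrite -mulrBl normcM mulrC ler_wpM2l ?normc_ge0//.
  by rewrite /csin /cplx -rmorphB normc_real sin_lipschitz.
- by move=> n; exact: normc_ge0.
Qed.

Let cos_cvg x (w : C) : ccvg (fun n => ccos (f n) x * w) (ccos theta x * w).
Proof.
apply/cvg0_le; last first.
- apply: (cvg0Z (normc w)); apply: ((cvg_dist0 _ _).1 (@f_cvg x)).
- move=> n; rewrite -mulrBl normcM mulrC ler_wpM2l ?normc_ge0//.
  by rewrite /ccos /cplx -rmorphB normc_real cos_lipschitz.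
- by move=> n; exact: normc_ge0.
Qed.

Let bounded_mult_cvg (m : nat -> R -> C) (m0 : R -> C) v : L2 v ->
  (forall n, cmeas (m n)) -> cmeas m0 ->
  (forall n x, normc (m n x) <= 1) -> (forall x, normc (m0 x) <= 1) ->
  (forall x, ccvg (fun n => m n x * v x) (m0 x * v x)) ->
  nr (fun x => m n x * v x - m0 x * v x) @[n --> \oo] --> (0 : R).
Proof.
move=> Lv mm mm0 m1 m01 h.
apply: (@L2_dct0 _ _ (fun x => 2 * normc (v x))).
- by move=> n; apply: cmeasB; apply: cmeasM => //; exact: L2_meas.
- under [X in mu.-integrable _ (_ \o X)]eq_fun do rewrite exprMn.
  exact: LiZ (L2_sq Lv).
- apply: ae_all => x n; apply: (le_trans (normcD _ _)).
  rewrite normcN !normcM mulr_natl mulr2n.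
  by apply: lerD; rewrite ler_piMl ?normc_ge0.
- apply: ae_all => x; have := ccvgD (h x) (ccvg_cst (- (m0 x * v x))).
  by rewrite subrr.
Qed.

Lemma L2_grad : L2 (fun x => ccos theta x * omega x).
Proof. exact: (L2M_bounded (cmeas_ccos cth) Lom (ccos_le1 theta)). Qed.

Let grad_cvg : nr (fun x => ccos (f n) x * p n x - ccos theta x * omega x)
  @[n --> \oo] --> (0 : R).
Proof.
have h1 := truncated_cvg mth thKc Lom.
have h2 := bounded_mult_cvg Lom (fun n => cmeas_ccos (@cf n)) (cmeas_ccos cth)
  (fun n => ccos_le1 (f n)) (ccos_le1 theta) (fun x => cos_cvg x (omega x)).
have Lc n (v : R -> C) : L2 v -> L2 (fun x => ccos (f n) x * v x).
  by move=> Lv; exact: (L2M_bounded (cmeas_ccos (@cf n)) Lv (ccos_le1 _)).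
apply: (cvg0_le _ _ (cvg0D h1 h2)) => n; first exact: nr_ge0.
have Lp : L2 (p n).
  by apply: L2D; [exact: L2_chiM|case: (L2_chi_bounded n mth thKc)].
have LB := L2B Lp Lom.
have E x : ccos (f n) x * p n x - ccos theta x * omega x =
    ccos (f n) x * (p n x - omega x) +
    (ccos (f n) x * omega x - ccos theta x * omega x) by ring.
rewrite (funext E); apply: (le_trans (nrD (Lc n _ LB) (L2B (Lc n _ Lom) L2_grad))).
rewrite lerD2r.
have := nrM_bounded (cmeas_ccos (@cf n)) LB (ccos_le1 _).
by rewrite mul1r.
Qed.

(** The transform of [Lambda, s] u, written so that it makes sense before s u is known
    to be in the domain of the half-Laplacian. *)
Definition fourier_commutator (s : R -> C) u : R -> C := fun xi =>
  `|xi|%:C * fourier (fun x => s x * u x) xi -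
  fourier (fun x => s x * half_laplacian u x) xi.

Lemma cmeas_norm : cmeas (fun xi : R => `|xi|%:C : C).
Proof.
apply: cmeas_real; apply: continuous_measurable_fun; exact: norm_continuous.
Qed.

Let q (xi : R) : C := (1 + `|xi|)^-1%:C.

Let mq : cmeas q.
Proof.
apply: cmeas_real; apply: (measurableT_comp (@meas_inv R)).
apply: measurable_funD; first exact: measurable_cst.
apply: continuous_measurable_fun; exact: norm_continuous.
Qed.

Let q1 xi : normc (q xi) <= 1.
Proof.
by rewrite normc_real ger0_norm ?invr_ge0 ?addr_ge0// invf_le1 ?lerDl// ltr_pwDl.
Qed.

Let q2 xi : normc (q xi * `|xi|%:C) <= 1.
Proof.
have p0 : 0 < 1 + `|xi| by rewrite ltr_pwDl.
rewrite normcM !normc_real normr_id ger0_norm ?invr_ge0 ?(ltW p0)//.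
by rewrite mulrC ler_pdivrMr// mul1r lerDr.
Qed.

(** Let n tend to infinity in [commutator_truncated].  The right hand side converges
    at every xi, because the derivatives converge in the mean; the left hand side
    converges in the mean after multiplication by 1 / (1 + |xi|), which makes |xi|
    bounded. *)
Lemma commutator_formula u : L2 u -> L2 (weighted_fourier u) ->
  {ae mu, forall xi, fourier_commutator (csin theta) u xi = kap%:C * cint (fun eta =>
    (quotient_symbol xi eta * fourier (fun x => ccos theta x * omega x) (xi - eta)) *
    fourier u eta)}.
Proof.
move=> Lu Lw; have [_ LL _] := half_laplacianP Lu Lw.
set g := fun x => ccos theta x * omega x.
have ms n : cmeas (csin (f n)) := cmeas_csin (@cf n).
have Ls n v : L2 v -> L2 (fun x => csin (f n) x * v x).
  by move=> Lv; exact: (L2M_bounded (ms n) Lv (csin_le1 _)).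
have Ls0 v : L2 v -> L2 (fun x => csin theta x * v x).
  by move=> Lv; exact: (L2M_bounded (cmeas_csin cth) Lv (csin_le1 _)).
have Fn n v : L2 v -> is_fourier (- 1) (fun x => csin (f n) x * v x)
    (ft (- 1) (fun x => csin (f n) x * v x)).
  move=> Lv; apply: (fourier_ft (@sqN1 R) (Ls n v Lv)).
  by apply: L2_cintegrable => //; case: (pair n).
have D0 v : L2 v -> nr (fun xi => ft (- 1) (fun x => csin (f n) x * v x) xi -
    fourier (fun x => csin theta x * v x) xi) @[n --> \oo] --> (0 : R).
  move=> Lv.
  have E n := fourier_dist (@sqN1 R) (Fn n v Lv) (fourierP (Ls0 v Lv)).
  rewrite (funext E); apply: (bounded_mult_cvg Lv ms (cmeas_csin cth)) => //.
  - by move=> n x; exact: csin_le1.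
  - by move=> x; exact: csin_le1.
have LF n v : L2 v -> L2 (ft (- 1) (fun x => csin (f n) x * v x)).
  by move=> Lv; case: (Fn n v Lv).
have LF0 v : L2 v -> L2 (fourier (fun x => csin theta x * v x)).
  by move=> Lv; exact/L2_fourier/Ls0.
have mq2 : cmeas (fun xi => q xi * `|xi|%:C) := cmeasM mq cmeas_norm.
pose Y n xi := q xi * `|xi|%:C * ft (- 1) (fun x => csin (f n) x * u x) xi -
  q xi * ft (- 1) (fun x => csin (f n) x * half_laplacian u x) xi.
pose X xi := q xi * `|xi|%:C * fourier (fun x => csin theta x * u x) xi -
  q xi * fourier (fun x => csin theta x * half_laplacian u x) xi.
have LY n : L2 (Y n).
  by apply: L2B; [exact: (L2M_bounded mq2 (LF n u Lu) q2)
    |exact: (L2M_bounded mq (LF n _ LL) q1)].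
have LX : L2 X.
  by apply: L2B; [exact: (L2M_bounded mq2 (LF0 u Lu) q2)
    |exact: (L2M_bounded mq (LF0 _ LL) q1)].
have YX : nr (fun xi => Y n xi - X xi) @[n --> \oo] --> (0 : R).
  apply: (cvg0_le _ _ (cvg0D (D0 u Lu) (D0 _ LL))) => n; first exact: nr_ge0.
  have L1 := L2B (LF n u Lu) (LF0 u Lu); have L2' := L2B (LF n _ LL) (LF0 _ LL).
  have M1 := nrM_bounded mq2 L1 q2; have M2 := nrM_bounded mq L2' q1.
  rewrite mul1r in M1; rewrite mul1r in M2; apply: le_trans (lerD M1 M2).
  apply: le_trans (nrB (L2M_bounded mq2 L1 q2) (L2M_bounded mq L2' q1)).
  rewrite le_eqVlt; apply/orP; left; apply/eqP; congr nr; apply/funext => xi.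
  have alg (a b c d e f' : C) :
    (a * c - b * d) - (a * e - b * f') = a * (c - e) - b * (d - f') by ring.
  exact: alg.
have Gc xi : ccvg (fun n => Y n xi) (q xi * (kap%:C * cint (fun eta =>
    (quotient_symbol xi eta * fourier g (xi - eta)) * fourier u eta))).
  have E n : Y n xi = q xi * (kap%:C * cint (fun eta => (quotient_symbol xi eta *
      fourier (fun x => ccos (f n) x * p n x) (xi - eta)) * fourier u eta)).
    have [La Lb ab] := pair n.
    by rewrite -(commutator_truncated xi La Lb ab Lu Lw) mulrBr mulrA.
  rewrite (funext E); apply: ccvgZ; apply: ccvgZ.
  have Lb n : L2 (fun x => ccos (f n) x * p n x) by case: (pair n).
  have LR (v : R -> C) : L2 v -> L2 (fun eta => quotient_symbol xi eta * v (xi - eta)).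
    move=> Lv; apply: (L2M_bounded (cmeas_quotient_symbol xi) _ (quotient_symbol_le xi)).
    exact: (proj1 (L2_reflect xi Lv)).
  apply: cint_L2_cvg.
  - by move=> n; apply: LR; exact: L2_fourier.
  - by move=> n; exact: L2_fourier.
  - by apply: LR; apply: L2_fourier; exact: L2_grad.
  - exact: L2_fourier.
  - apply: (cvg0_le _ _ grad_cvg) => n; first exact: nr_ge0.
    have LD := L2B (L2_fourier (Lb n)) (L2_fourier L2_grad).
    rewrite -(fourier_dist (@sqN1 R) (fourierP (Lb n)) (fourierP L2_grad)).
    have [LR' <-] := L2_reflect xi LD.
    have := nrM_bounded (cmeas_quotient_symbol xi) LR' (quotient_symbol_le xi); rewrite mul1r.
    by congr (nr _ <= _); apply/funext => eta; rewrite -mulrBr.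
  - rewrite (_ : (fun n => nr _) = fun=> 0); first exact: cvg_cst.
    apply/funext => n; rewrite /nr (eqRint (g := fun=> 0)) ?Rintegral_cst ?mul0r ?sqrtr0//.
    by move=> x; rewrite subrr normc0 expr0n.
have := L2_lim_ae LY LX YX (ae_all Gc).
move=> h; apply: (ae_mono h) => xi hx.
have alg (a b c d : C) : a * b * c - a * d = a * (b * c - d) by ring.
have {}hx : q xi * fourier_commutator (csin theta) u xi = q xi * (kap%:C * cint (fun eta =>
    (quotient_symbol xi eta * fourier g (xi - eta)) * fourier u eta)).
  by rewrite -hx; exact: esym (alg _ _ _ _).
have qV : (1 + `|xi|)%:C * q xi = 1.
  by rewrite /q -rmorphM divff// gt_eqF// ltr_pwDl.
by rewrite -[LHS]mul1r -[RHS]mul1r -qV -!mulrA hx.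
Qed.

End CommutatorFormula.

(** * Diagonal extraction *)

Section Diagonal.
Context {R : realType}.
Local Notation C := R[i].
Local Notation mu := (@lebesgue_measure R).
Local Notation Li f := (mu.-integrable setT (EFin \o f)).

Definition extraction (k : nat -> nat) := {homo k : m n / (m < n)%N}.

Lemma extraction_succ (k : nat -> nat) : (forall n, (k n < k n.+1)%N) ->
  extraction k.
Proof. by move=> h; exact: homo_ltn ltn_trans h. Qed.

(** A cluster point in the compact interval is approached within [mesh n] by
    terms of increasing index. *)
Lemma bolzano_weierstrass (a : nat -> R) (B : R) : (forall n, `|a n| <= B) ->
  exists2 k, extraction k & cvgn (fun n => a (k n)).
Proof.
move=> aB; have cB := @segment_compact R (- B) B.
have FB : (a @ \oo) `[- B, B]%classic.
  by apply: (filterS _ (nbhs_infty_ge 0)) => n _; rewrite /= in_itv /= -ler_norml.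
have [p [_ cp]] := cB (a @ \oo) _ FB.
have freq (N j : nat) : exists n, (N <= n)%N /\ `|a n - p| < @mesh R j.
  have AN : (a @ \oo) [set y | exists2 n, (N <= n)%N & y = a n].
    by apply: (filterS _ (nbhs_infty_ge N)) => n Nn /=; exists n.
  have Bp : nbhs p (ball p (@mesh R j)) by apply: nbhsx_ballx; exact: mesh_gt0.
  have [y [[n Nn ->] yb]] := cp _ _ AN Bp; exists n; split => //.
  by rewrite distrC.
have [c hc] := choice (fun z : nat * nat => freq z.1 z.2).
pose k := fix k n := if n is m.+1 then c ((k m).+1, m.+1) else c (0%N, 0%N).
exists k; first by apply: extraction_succ => n; case: (hc ((k n).+1, n.+1)).
have hk n : `|a (k n) - p| <= mesh n.
  by case: n => [|n]; apply: ltW; [case: (hc (0%N, 0%N))|case: (hc ((k n).+1, n.+1))].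
apply/cvg_ex; exists p; apply/cvg_dist0.
by apply: (cvg0_le _ hk); [move=> n|exact: mesh_cvg].
Qed.

(** The i-th extraction is taken from the previous one, and the diagonal sequence is
    eventually a subsequence of each. *)
Lemma diagonal_nat (z : nat -> nat -> R) (B : nat -> R) :
  (forall i n, `|z i n| <= B i) ->
  exists2 k, extraction k & forall i, cvgn (fun n => z i (k n)).
Proof.
move=> zB.
have ex_t (y : nat * (nat -> nat)) : exists t,
    extraction t /\ cvgn (fun n => z y.1 (y.2 (t n))).
  have [k ek ck] := bolzano_weierstrass (fun n => zB y.1 (y.2 n)).
  by exists k.
have [t ht] := choice ex_t.
(* The i-th extraction, along which the first i sequences converge. *)
pose s := fix s i := if i is j.+1 then s j \o t (j.+1, s j) else t (0%N, id).
have es i : extraction (s i).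
  elim: i => [|i IH]; first by case: (ht (0%N, id)).
  by move=> m n mn; apply: IH; case: (ht (i.+1, s i)) => e _; exact: e.
have cs i : cvgn (fun n => z i (s i n)).
  by case: i => [|i]; [case: (ht (0%N, id))|case: (ht (i.+1, s i))].
have tge y n : (n <= t y n)%N by apply: homo_geq_id; case: (ht y).
have later i d n : exists2 m, (n <= m)%N & s (i + d)%N n = s i m.
  elim: d n => [|d IH] n; first by exists n; rewrite ?addn0.
  rewrite addnS /=; have [m nm ->] := IH (t ((i + d).+1, s (i + d)%N) n).
  by exists m => //; apply: leq_trans nm.
exists (fun n => s n n).
  apply: extraction_succ => n /=; apply: es.
  by apply: leq_trans (tge _ _).
move=> i; have /cvg_ex[l /cvgrPdist_lt hl] := cs i.
apply/cvg_ex; exists l; apply/cvgrPdist_lt => e e0.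
have [N _ hN] := hl e e0.
exists (maxn N i) => // n; rewrite /= geq_max => /andP[Nn /subnKC <-].
have [m nm ->] := later i (n - i)%N (i + (n - i))%N.
apply: hN => /=; apply: leq_trans nm; apply: (leq_trans Nn).
by rewrite -leq_subLR.
Qed.

(** The real and imaginary parts are handled together, as a family indexed by
    I * bool. *)
Lemma diagonal (I : countType) (z : I -> nat -> C) (B : I -> R) :
  (forall i n, normc (z i n) <= B i) ->
  exists2 k, extraction k & forall i, ccauchy (fun n => z i (k n)).
Proof.
move=> zB.
pose y (j n : nat) : R := if (unpickle j : option (I * bool)) is Some (i, b)
  then (if b then Re (z i n) else Im (z i n)) else 0.
pose B' (j : nat) : R := if (unpickle j : option (I * bool)) is Some (i, _)
  then B i else 0.
have yB j n : `|y j n| <= B' j.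
  rewrite /y /B'; case: unpickle => [[i []]|]; last by rewrite normr0.
    exact: le_trans (normRe_le _) (zB i n).
  exact: le_trans (normIm_le _) (zB i n).
have [k ek hk] := diagonal_nat yB.
exists k => // i.
have hR := hk (pickle (i, true)); have hI := hk (pickle (i, false)).
rewrite /y !pickleK in hR hI.
have /cvg_ex[a ha] := hR; have /cvg_ex[b hb] := hI.
apply: (@ccvg_cauchy _ _ (a +i* b)); apply/ccvgP; split; [exact: ha|exact: hb].
Qed.

Lemma rat_sequence (x : R) : exists r : nat -> rat,
  ratr (r n) @[n --> \oo] --> x.
Proof.
have h n : exists q : rat, `|ratr q - x| <= mesh n.
  have xm : x < x + mesh n by rewrite ltrDl mesh_gt0.
  have [q] := rat_in_itvoo xm; rewrite in_itv /= => /andP[q1 q2].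
  exists q; rewrite ger0_norm ?subr_ge0 ?(ltW q1)//.
  by rewrite lerBlDl ltW.
have [r hr] := choice h; exists r; apply/cvg_dist0.
by apply: (cvg0_le _ hr); [move=> n|exact: mesh_cvg].
Qed.

(** Extract along rational points only; since each family is continuous in the mean
    and the sequence w is bounded, the pairings converge at all real points. *)
Lemma weak_subsequence (I : countType) (K : I -> R -> R -> C)
    (w : nat -> R -> C) (M : R) :
  (forall i x, L2 (K i x)) ->
  (forall i (t : nat -> R) x, t n @[n --> \oo] --> x ->
     nr (fun eta => K i (t n) eta - K i x eta) @[n --> \oo] --> (0 : R)) ->
  (forall n, L2 (w n)) -> (forall n, nr (w n) <= M) ->
  exists2 k, extraction k & forall i x,
    ccauchy (fun n => cint (fun eta => K i x eta * w (k n) eta)).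
Proof.
move=> LK cK Lw wM; have M0 : 0 <= M by apply: le_trans (wM 0%N); exact: nr_ge0.
pose z (j : I * rat) n := cint (fun eta => K j.1 (ratr j.2) eta * w n eta).
have zB j n : normc (z j n) <= nr (K j.1 (ratr j.2)) * M.
  apply: (le_trans (normc_cint_L2 (LK _ _) (Lw n))).
  by rewrite ler_wpM2l ?nr_ge0.
have [k ek hk] := diagonal zB; exists k => // i x e e0.
have [r hr] := rat_sequence x.
(* M + 1 is positive even for M = 0. *)
pose d := e / (3 * (M + 1)).
have M1 : 0 < M + 1 by rewrite ltr_wpDl.
have d0 : 0 < d by rewrite divr_gt0// mulr_gt0.
have [N hN] := (cvg0P (fun n => nr_ge0 _)).1 (cK i _ x hr) d d0.
have hr' := hN N (leqnn N).
have e3 : 0 < e / 3 by rewrite divr_gt0.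
have [N' hN'] := hk (i, r N) _ e3.
have diff n : normc (cint (fun eta => K i x eta * w (k n) eta) - z (i, r N) (k n))
    <= e / 3.
  have E eta : K i x eta * w (k n) eta - K i (ratr (r N)) eta * w (k n) eta =
    (K i x eta - K i (ratr (r N)) eta) * w (k n) eta by rewrite mulrBl.
  have := cintB (L2_cintegrable (LK i x) (Lw (k n)))
    (L2_cintegrable (LK i (ratr (r N))) (Lw (k n))).
  rewrite (eq_cint E) /z => <-.
  apply: (le_trans (normc_cint_L2 (L2B (LK i x) (LK i _)) (Lw _))).
  rewrite nr_subC; have -> : e / 3 = d * (M + 1).
    by rewrite /d; field; rewrite gt_eqF.
  apply: ler_pM; [exact: nr_ge0|exact: nr_ge0|exact: ltW|].
  by rewrite (le_trans (wM _))// lerDl.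
exists N' => m n hm hn; have h := hN' m n hm hn.
have dm := diff m; have dn := diff n; rewrite normcBC in dn.
apply: le_lt_trans (normc_triangle _ _ (z (i, r N) (k m))) _.
have -> : e = e / 3 + (e / 3 + e / 3) by field.
apply: ler_ltD => //; apply: le_lt_trans (normc_triangle _ _ (z (i, r N) (k n))) _.
exact: ltr_leD.
Qed.

End Diagonal.

(** * Operators of Hilbert-Schmidt type *)

Section Kernels.
Context {R : realType}.
Local Notation C := R[i].
Local Notation mu := (@lebesgue_measure R).
Local Notation Li f := (mu.-integrable setT (EFin \o f)).
Implicit Types (u v w g G : R -> C).

Lemma kernel_bound (A m w : R -> C) (K : R -> R -> C) (b : R -> R) (M : R) :
  cmeas A -> Li (fun x => b x ^+ 2) -> (forall x, L2 (K x)) ->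
  (forall x, normc (m x) * nr (K x) <= b x) -> L2 w -> nr w <= M ->
  {ae mu, forall x, A x = m x * cint (fun eta => K x eta * w eta)} ->
  {ae mu, forall x, normc (A x) <= M * b x}.
Proof.
move=> mA ib LK mK Lw wM h; have M0 : 0 <= M by apply: le_trans wM; exact: nr_ge0.
apply: (ae_mono h) => x ->; rewrite normcM.
have := normc_cint_L2 (LK x) Lw => h1.
apply: (le_trans (ler_wpM2l (normc_ge0 _) h1)).
rewrite mulrA mulrC; apply: ler_pM => //; first exact: nr_ge0.
by rewrite mulr_ge0// ?normc_ge0// nr_ge0.
Qed.

Lemma Li_scaled_sq (M : R) (b : R -> R) : Li (fun x => b x ^+ 2) ->
  Li (fun x => (M * b x) ^+ 2).
Proof.
by move=> ib; under [X in mu.-integrable _ (_ \o X)]eq_fun do rewrite exprMn;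
  exact: LiZ.
Qed.

(** Cauchy-Schwarz at each x. *)
Lemma kernel_operator_bound (A m w : R -> C) (K : R -> R -> C) (b : R -> R) (M : R) :
  cmeas A -> Li (fun x => b x ^+ 2) -> (forall x, L2 (K x)) ->
  (forall x, normc (m x) * nr (K x) <= b x) -> L2 w -> nr w <= M ->
  {ae mu, forall x, A x = m x * cint (fun eta => K x eta * w eta)} ->
  L2 A /\ nr A <= M * Num.sqrt (\int[mu]_x (b x ^+ 2)).
Proof.
move=> mA ib LK mK Lw wM h; have M0 : 0 <= M by apply: le_trans wM; exact: nr_ge0.
have hb := kernel_bound mA ib LK mK Lw wM h.
have [LA nA] := L2_le_ae mA (Li_scaled_sq M ib) hb; split; first exact: LA.
apply: (le_trans nA).
rewrite (eqRint (fun x => exprMn 2 M (b x))) RintegralZl//.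
by rewrite sqrtrM ?sqr_ge0// sqrtr_sqr ger0_norm.
Qed.

(** The values converge at almost every x and are dominated by M b(x). *)
Lemma kernel_operator_compact (A w : nat -> R -> C) (m : R -> C)
    (K : R -> R -> C) (b : R -> R) (M : R) :
  (forall n, cmeas (A n)) -> Li (fun x => b x ^+ 2) -> (forall x, L2 (K x)) ->
  (forall x, normc (m x) * nr (K x) <= b x) ->
  (forall n, L2 (w n)) -> (forall n, nr (w n) <= M) ->
  (forall n, {ae mu, forall x,
     A n x = m x * cint (fun eta => K x eta * w n eta)}) ->
  (forall x, ccauchy (fun n => cint (fun eta => K x eta * w n eta))) ->
  exists2 v, L2 v & nr (fun x => A n x - v x) @[n --> \oo] --> (0 : R).
Proof.
move=> mA ib LK mK Lw wM h hc.
have ha : {ae mu, forall x, forall n,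
    A n x = m x * cint (fun eta => K x eta * w n eta)} by exact/ae_foralln.
apply: (@L2_dct _ _ (fun x => M * b x) mA (Li_scaled_sq M ib)).
  apply/ae_foralln => n.
  exact: (kernel_bound (mA n) ib LK mK (Lw n) (wM n) (h n)).
apply: (ae_mono ha) => x hx; have := ccvgZ (m x) (ccauchy_cvg (hc x)).
by move=> /ccvg_cauchy; congr ccauchy; apply/funext => n; rewrite hx.
Qed.

Lemma expi_dist (a b : R) : normc (expi a - expi b) <= 2 * `|a - b|.
Proof.
have -> : expi a - expi b = expi b * (expi (a - b) - 1).
  by rewrite mulrBr mulr1 -expiD [b + _]addrC subrK.
by rewrite normcM normc_expi mul1r expi_lipschitz.
Qed.

Lemma modulation_cvg (s : R) v (t : nat -> R) x : L2 v ->
  t n @[n --> \oo] --> x ->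
  nr (fun eta => expi (s * eta * t n) * v eta - expi (s * eta * x) * v eta)
    @[n --> \oo] --> (0 : R).
Proof.
move=> Lv tx; apply: (@L2_dct0 _ _ (fun eta => 2 * normc (v eta))).
- have mk (y : R) : cmeas (fun eta => expi (s * eta * y) * v eta).
    apply: cmeasM; last exact: L2_meas.
    exact: cmeas_kernel1.
  by move=> n; exact: cmeasB.
- under [X in mu.-integrable _ (_ \o X)]eq_fun do rewrite exprMn.
  exact: LiZ (L2_sq Lv).
- apply: ae_all => eta n; apply: (le_trans (normcD _ _)).
  by rewrite normcN !normcM !normc_expi !mul1r mulr_natl mulr2n.
- apply: ae_all => eta.
  have h := cvg0Z (2 * `|s * eta| * normc (v eta)) ((cvg_dist0 _ _).1 tx).
  apply: (cvg0_le _ _ h) => n; first exact: normc_ge0.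
  rewrite subr0 -mulrBl normcM [leRHS]mulrAC ler_wpM2r ?normc_ge0//.
  apply: (le_trans (expi_dist _ _)); rewrite -[leRHS]mulrA ler_wpM2l//.
  by rewrite -mulrBr normrM.
Qed.

(** The kernel of the transformed commutator with respect to [weighted_fourier];
    G is the transform of the derivative of the multiplier. *)
Definition commutator_kernel G (xi eta : R) : C := quotient_symbol xi eta * G (xi - eta) * value_symbol eta.

Lemma value_symbol_le1 eta : normc (@value_symbol R eta) <= 1.
Proof.
by rewrite /value_symbol normc_real ger0_norm ?oneDsqrV_ge0// oneDsqrV_le.
Qed.

Lemma L2_commutator_kernel G xi : L2 G -> L2 (commutator_kernel G xi).
Proof.
move=> LG; have [Lj _] := @L2_symbols R.
have L1 := L2M_bounded (cmeas_quotient_symbol xi) (proj1 (L2_reflect xi LG)) (quotient_symbol_le xi).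
have := L2M_bounded (L2_meas Lj) L1 value_symbol_le1.
by congr L2; apply/funext => eta; rewrite mulrC.
Qed.

Lemma quotient_symbol_cvg (t : nat -> R) (x eta : R) : eta != x ->
  t n @[n --> \oo] --> x -> ccvg (fun n => quotient_symbol (t n) eta) (quotient_symbol x eta).
Proof.
move=> ex tx; apply/ccvgP; split; first exact: cvg_cst.
apply: cvgN; apply: cvgM.
  by apply: cvgB; [exact: cvg_norm|exact: cvg_cst].
apply: cvgV; first by rewrite subr_eq0 eq_sym.
by apply: cvgB => //; exact: cvg_cst.
Qed.

(** Translations of G are continuous in the mean, since they are transforms of
    modulations; the symbol converges off the diagonal and is bounded. *)
Lemma commutator_kernel_cvg g (t : nat -> R) (x : R) : L2 g -> t n @[n --> \oo] --> x ->
  nr (fun eta => commutator_kernel (fourier g) (t n) eta - commutator_kernel (fourier g) x eta)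
    @[n --> \oo] --> (0 : R).
Proof.
move=> Lg tx; set G := fourier g; have LG : L2 G := L2_fourier Lg.
have [Lj _] := @L2_symbols R; have mj := L2_meas Lj.
have LR xi := proj1 (L2_reflect xi LG).
have h1 : nr (fun eta => G (t n - eta) - G (x - eta)) @[n --> \oo] --> (0 : R).
  have E n := fourier_dist (@sq1 R)
    (let F := fourier_reflect (t n) (@sqN1 R) (fourierP Lg) in
     eq_rect _ (fun s => is_fourier s _ _) F _ (opprK 1))
    (let F := fourier_reflect x (@sqN1 R) (fourierP Lg) in
     eq_rect _ (fun s => is_fourier s _ _) F _ (opprK 1)).
  by rewrite (funext E); exact: modulation_cvg.
have h2 : nr (fun eta => (quotient_symbol (t n) eta - quotient_symbol x eta) * (value_symbol eta * G (x - eta)))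
    @[n --> \oo] --> (0 : R).
  apply: (@L2_dct0 _ _ (fun eta => 2 * normc (G (x - eta)))).
  - move=> n; apply: cmeasM; first by apply: cmeasB; exact: cmeas_quotient_symbol.
    by apply: cmeasM => //; exact: L2_meas (LR x).
  - under [X in mu.-integrable _ (_ \o X)]eq_fun do rewrite exprMn.
    exact: LiZ (L2_sq (LR x)).
  - apply: ae_all => eta n; rewrite !normcM; apply: ler_pM.
    + exact: normc_ge0.
    + by rewrite mulr_ge0// normc_ge0.
    + apply: (le_trans (normcD _ _)); rewrite normcN -[leRHS](_ : 1 + 1 = _)//.
      by apply: lerD; exact: quotient_symbol_le.
    + by rewrite ler_piMl ?normc_ge0// value_symbol_le1.
  - have n0 : {ae mu, forall eta : R, eta != x}.
      exists [set x]; split; [by []|exact: lebesgue_measure_set1|].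
      by move=> eta /= /negP; rewrite negbK => /eqP.
    apply: (ae_mono n0) => eta ex.
    have := ccvgZ (value_symbol eta * G (x - eta))
      (ccvgD (quotient_symbol_cvg ex tx) (ccvg_cst (- quotient_symbol x eta))).
    by rewrite subrr mulr0; congr ccvg; apply/funext => n; rewrite mulrC.
apply: (cvg0_le _ _ (cvg0D h1 h2)) => n; first exact: nr_ge0.
have LD := L2B (LR (t n)) (LR x).
have mk : cmeas (fun eta => quotient_symbol (t n) eta * value_symbol eta).
  by apply: cmeasM => //; exact: cmeas_quotient_symbol.
have k1 eta : normc (quotient_symbol (t n) eta * value_symbol eta) <= 1.
  by rewrite normcM mulr_ile1 ?normc_ge0// ?quotient_symbol_le// value_symbol_le1.
have E eta : commutator_kernel G (t n) eta - commutator_kernel G x eta =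
    (quotient_symbol (t n) eta * value_symbol eta) * (G (t n - eta) - G (x - eta)) +
    (quotient_symbol (t n) eta - quotient_symbol x eta) * (value_symbol eta * G (x - eta)).
  by rewrite /commutator_kernel; ring.
have L2' : L2 (fun eta => (quotient_symbol (t n) eta - quotient_symbol x eta) * (value_symbol eta * G (x - eta))).
  have := L2B (L2M_bounded (cmeas_quotient_symbol (t n)) (L2M_bounded mj (LR x) value_symbol_le1) (quotient_symbol_le _))
   (L2M_bounded (cmeas_quotient_symbol x) (L2M_bounded mj (LR x) value_symbol_le1) (quotient_symbol_le _)).
  by congr L2; apply/funext => eta; rewrite mulrBl.
rewrite (funext E); apply: (le_trans (nrD (L2M_bounded mk LD k1) L2')).
by rewrite lerD2r; have := nrM_bounded mk LD k1; rewrite mul1r.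
Qed.

(** An upper bound of the squared norm of [commutator_kernel] in its second
    variable. *)
Definition commutator_majorant G (xi : R) : R :=
  \int[mu]_eta (normc (G (xi - eta)) ^+ 2 * (1 + eta ^+ 2)^-1).

(** Integrating in xi first gives ||G||^2 times the integral of 1 / (1 + eta^2). *)
Lemma commutator_majorant_integrable G : L2 G ->
  (forall xi, Li (fun eta => normc (G (xi - eta)) ^+ 2 * (1 + eta ^+ 2)^-1)) /\
  Li (commutator_majorant G).
Proof.
move=> LG.
have i1 xi : Li (fun eta => normc (G (xi - eta)) ^+ 2 * (1 + eta ^+ 2)^-1).
  have Lr := proj1 (L2_reflect xi LG).
  apply: (Li_le _ (L2_sq Lr)).
    apply: measurable_funM; last exact: meas_oneDsqrV.
    by apply: measurable_funX; apply: meas_normc; exact: L2_meas Lr.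
  move=> eta; rewrite ger0_norm; last first.
    exact: (mulr_ge0 (sqr_ge0 _) (oneDsqrV_ge0 _)).
  by rewrite ler_piMr ?sqr_ge0// oneDsqrV_le.
have Ls (y : R) := L2_shift (- y) LG.
have i2 (y : R) : Li (fun xi => normc (G (xi - y)) ^+ 2 * (1 + y ^+ 2)^-1).
  have := LiZ ((1 + y ^+ 2)^-1) (L2_sq (proj1 (Ls y))).
  by congr (mu.-integrable _ (_ \o _)); apply/funext => t; rewrite mulrC.
split; first exact: i1.
pose F (z : R * R) := normc (G (z.1 - z.2)) ^+ 2 * (1 + z.2 ^+ 2)^-1.
have mF : measurable_fun setT F.
  apply: measurable_funM.
    apply: measurable_funX; apply: meas_normc.
    by apply: (cmeas_comp _ (L2_meas LG)); exact: measurable_funB.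
  exact: (measurableT_comp (@meas_oneDsqrV R) measurable_snd).
have F0 z : 0 <= F z := mulr_ge0 (sqr_ge0 _) (oneDsqrV_ge0 _).
have mE : measurable_fun setT (EFin \o F) by exact/measurable_EFinP.
have fin : (\int[mu]_x \int[mu]_y (`|F (x, y)|)%:E < +oo)%E.
  have E : (\int[mu]_x \int[mu]_y (`|F (x, y)|)%:E =
            \int[mu]_x \int[mu]_y (F (x, y))%:E)%E.
    by apply: eq_integral => x _; apply: eq_integral => y _; rewrite ger0_norm.
  rewrite E.
  have F0' z : (0 <= (EFin \o F) z)%E by rewrite /= lee_fin.
  have := @fubini_tonelli _ _ _ _ _ mu mu (EFin \o F) mE F0'.
  rewrite /= => ->.
  have E2 : (\int[mu]_y \int[mu]_x (F (x, y))%:E =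
             \int[mu]_y ((nr G ^+ 2 * (1 + y ^+ 2)^-1)%:E))%E.
    apply: eq_integral => y _; rewrite -(Rint_EFin (i2 y)).
    congr EFin; rewrite /F /=.
    rewrite (RintegralZr _ measurableT (L2_sq (proj1 (Ls y)))).
    by rewrite -nr_sq (proj2 (Ls y)).
  rewrite E2 -(Rint_EFin (LiZ (nr G ^+ 2) (@Li_oneDsqrV R))) ltry.
  by [].
exact: (proj1 (Rfubini mF fin i1 i2)).
Qed.

Lemma commutator_kernel_norm_le G xi : L2 G ->
  nr (commutator_kernel G xi) <= Num.sqrt (commutator_majorant G xi).
Proof.
move=> LG; have [i1 _] := commutator_majorant_integrable LG.
rewrite ler_sqrt; last first.
  by apply: Rint_ge0 => eta; exact: (mulr_ge0 (sqr_ge0 _) (oneDsqrV_ge0 _)).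
apply: le_Rint; [exact: L2_sq (L2_commutator_kernel xi LG)|exact: i1|] => eta.
rewrite /commutator_kernel !normcM !exprMn; apply: ler_pM.
- by rewrite mulr_ge0 ?sqr_ge0.
- exact: sqr_ge0.
- by rewrite ler_piMl ?sqr_ge0// expr_le1// ?normc_ge0// quotient_symbol_le.
- rewrite /value_symbol normc_real ger0_norm ?oneDsqrV_ge0// expr2.
  by rewrite ler_piMl ?oneDsqrV_ge0// oneDsqrV_le.
Qed.

Lemma commutator_majorant_sq G : L2 G ->
  Li (fun xi => Num.sqrt (commutator_majorant G xi) ^+ 2).
Proof.
move=> LG; have [_ h] := commutator_majorant_integrable LG.
rewrite (_ : (fun xi => _) = commutator_majorant G)//; apply/funext => xi.
rewrite sqr_sqrtr//; apply: Rint_ge0 => eta.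
exact: (mulr_ge0 (sqr_ge0 _) (oneDsqrV_ge0 _)).
Qed.

End Kernels.

(** * Differences of functions of order two *)

Section SobolevDifference.
Context {R : realType}.
Local Notation C := R[i].
Local Notation mu := (@lebesgue_measure R).
Local Notation Li f := (mu.-integrable setT (EFin \o f)).
Implicit Types (u v w : R -> C).

Lemma L2_compact_support (f : R -> R) (M : R) : continuous f ->
  (forall x, M < `|x| -> f x = 0) -> L2 (cplx f).
Proof.
move=> cf fM; have mf := continuous_measurable_fun cf.
have ab : - `|M| <= `|M| :> R by rewrite ge0_cp.
have cn : continuous (fun x => `|f x|).
  by move=> x; exact: (cvg_norm (cf x)).
have [c _ hc] := EVT_max ab (continuous_subspaceT cn).
have fB x : `|f x| <= `|f c|.
  have [h|h] := leP `|x| `|M|; first by apply: hc; rewrite in_itv /= -ler_norml.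
  by rewrite fM ?normr0// (le_lt_trans (ler_norm M)).
apply/L2P; split; first exact: cmeas_real.
apply: (@compact_bounded_integrable _ _ M (`|f c| ^+ 2)).
- by apply: measurable_funX; apply: meas_normc; exact: cmeas_real.
- move=> x; rewrite ger0_norm ?sqr_ge0// normc_real ler_sqr ?nnegrE//.
- by move=> x h; rewrite normc_real fM// normr0 expr0n.
Qed.

(** The derivative of a test function vanishes off its support, where the function
    is locally constant. *)
Lemma L2_test (phi : R -> R) : test_function phi ->
  L2 (cplx phi) /\ L2 (cplx (derive1 phi)).
Proof.
move=> [d [M hM]]; have cphi n : continuous (derive1n n phi).
  by move=> x; apply/differentiable_continuous/derivable1_diffP; exact: d.
split; first exact: (L2_compact_support (cphi 0%N) hM).
apply: (L2_compact_support (M := M) (cphi 1%N)) => x hx.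
have near0 : \forall y \near x, cst 0 y = phi y.
  have cn : `|y| @[y --> x] --> `|x| by exact: norm_continuous.
  have xM : 0 < `|x| - M by rewrite subr_gt0.
  have h := (cvgrPdist_lt _ _).1 cn _ xM; near=> y; rewrite hM//.
  have hy : `| `|x| - `|y| | < `|x| - M by near: y; exact: h.
  by have := le_lt_trans (ler_norm _) hy; rewrite ltrD2l ltrN2.
rewrite /= derive1E -(near_eq_derive _ near0) ?oner_eq0// .
exact: derive_cst.
Unshelve. all: by end_near.
Qed.

(** Square integrability makes the products with test functions integrable, which
    is needed to split the integrals. *)
Lemma weak_real_sub (f g f' g' : R -> R) :
  L2 (cplx f) -> L2 (cplx g) -> L2 (cplx f') -> L2 (cplx g') ->
  is_weak_derivative_real f g -> is_weak_derivative_real f' g' ->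
  is_weak_derivative_real (fun x => f x - f' x) (fun x => g x - g' x).
Proof.
move=> Lf Lg Lf' Lg' [lf lg w] [lf' lg' w']; split.
- exact: locally_integrableB.
- exact: locally_integrableB.
move=> phi tphi; have [Lp Ld] := L2_test tphi.
rewrite (eqRint (fun x => mulrBl (derive1 phi x) (f x) (f' x))).
rewrite (eqRint (fun x => mulrBl (phi x) (g x) (g' x))).
rewrite RintegralB; [|by []|exact: Li_L2_mul|exact: Li_L2_mul].
rewrite RintegralB; [|by []|exact: Li_L2_mul|exact: Li_L2_mul].
by rewrite w// w'// opprB opprK addrC.
Qed.

Lemma weak_sub u v u' v' : L2 u -> L2 v -> L2 u' -> L2 v' ->
  is_weak_derivative u v -> is_weak_derivative u' v' ->
  is_weak_derivative (fun x => u x - u' x) (fun x => v x - v' x).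
Proof.
move=> Lu Lv Lu' Lv' [w1 w2] [w1' w2'].
have ER (a b : R -> C) : (fun x => Re (a x - b x)) = (fun x => Re (a x) - Re (b x)).
  by apply/funext => x; rewrite ReDE ReNE.
have EI (a b : R -> C) : (fun x => Im (a x - b x)) = (fun x => Im (a x) - Im (b x)).
  by apply/funext => x; rewrite ImDE ImNE.
split; rewrite ?ER ?EI.
  exact: (weak_real_sub (L2_Re Lu) (L2_Re Lv) (L2_Re Lu') (L2_Re Lv')).
exact: (weak_real_sub (L2_Im Lu) (L2_Im Lv) (L2_Im Lu') (L2_Im Lv')).
Qed.

Lemma sobolev_L2 k u : sobolev k u -> L2 u.
Proof. by case: k => [|k] // []. Qed.

Lemma sobolev_sub k u v : sobolev k u -> sobolev k v ->
  sobolev k (fun x => u x - v x).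
Proof.
elim: k u v => [|k IH] u v; first exact: L2B.
move=> [Lu [u' wu su]] [Lv [v' wv sv]]; split; first exact: L2B.
exists (fun x => u' x - v' x); last exact: IH.
exact: (weak_sub Lu (sobolev_L2 su) Lv (sobolev_L2 sv)).
Qed.

End SobolevDifference.

(** * The half-Laplacian as a multiplier *)

Section HalfLaplacian.
Context {R : realType}.
Local Notation C := R[i].
Local Notation mu := (@lebesgue_measure R).
Implicit Types (u v w : R -> C).

(** The domain of the half-Laplacian as an operator on L2; outside it
    [half_laplacian] takes a conventional value. *)
Definition half_dom u : Prop :=
  L2 u /\ L2 (fun xi => `|xi|%:C * fourier u xi).

Lemma half_domP u : half_dom u ->
  is_fourier 1 (fun xi => `|xi|%:C * fourier u xi) (half_laplacian u).
Proof. by move=> [_ h]; exact: inv_fourierP. Qed.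

Lemma half_laplacian_lin (a : C) u v : half_dom u -> half_dom v ->
  {ae mu, forall x, half_laplacian (fun y => a * u y + v y) x =
                    a * half_laplacian u x + half_laplacian v x}.
Proof.
move=> du dv; have [Lu Au] := du; have [Lv Av] := dv.
have Luv := L2_lin a Lu Lv.
have E := fourier_unique (@sqN1 R) (fourierP Luv)
  (fourier_lin a (@sqN1 R) (fourierP Lu) (fourierP Lv)).
have E2 : {ae mu, forall xi : R, `|xi|%:C * fourier (fun y => a * u y + v y) xi =
    a * (`|xi|%:C * fourier u xi) + `|xi|%:C * fourier v xi}.
  by apply: (ae_mono E) => xi ->; rewrite mulrDr [_ * (a * _)]mulrCA.
have LA : L2 (fun xi => `|xi|%:C * fourier (fun y => a * u y + v y) xi).
  apply: (L2_ae _ (L2_lin a Au Av)).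
    by apply: cmeasM; [exact: cmeas_norm|exact/L2_meas/L2_fourier].
  by apply: (ae_mono E2) => xi e; exact: esym e.
apply: (fourier_ae (@sq1 R) (inv_fourierP LA) _ E2).
exact: (fourier_lin a (@sq1 R) (half_domP du) (half_domP dv)).
Qed.

Lemma half_laplacian_ae u v : half_dom u -> half_dom v ->
  {ae mu, forall x, u x = v x} ->
  {ae mu, forall x, half_laplacian u x = half_laplacian v x}.
Proof.
move=> du dv uv; have [Lu Au] := du; have [Lv Av] := dv.
have E := fourier_ae (@sqN1 R) (fourierP Lu) (fourierP Lv) uv.
apply: (fourier_ae (@sq1 R) (half_domP du) (half_domP dv)).
by apply: (ae_mono E) => xi ->.
Qed.

Lemma sobolev_half_dom u : sobolev 2 u -> half_dom u.
Proof.
move=> su; have [Lu Lw] := L2_weighted_fourier su; split; first exact: Lu.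
by apply: (L2_abs_fourier Lw); exact/L2_meas/L2_fourier.
Qed.

End HalfLaplacian.

(** * Decomposition of the difference of the operators *)

Section Pieces.
Context {R : realType}.
Local Notation C := R[i].
Local Notation mu := (@lebesgue_measure R).
Local Notation Li f := (mu.-integrable setT (EFin \o f)).
Implicit Types (u v w : R -> C).

Variables (theta : R -> R) (B : R) (omega : R -> C).
Hypothesis cth : continuous theta.
Hypothesis thB : forall x, `|theta x| <= B.
Hypothesis Lom : L2 omega.
Hypothesis wth : is_weak_derivative (cplx theta) omega.
Hypothesis Lc : L2 (ccos theta).

Local Notation s := (csin theta).
Local Notation c := (ccos theta).

Let G : R -> C := fourier (fun x => c x * omega x).

Let LG : L2 G.
Proof. by apply: L2_fourier; exact: L2_grad. Qed.

(** The three terms of the decomposition are treated uniformly, as operators indexed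
    by [option bool]: [Some true] is multiplication, [Some false] involves the
    half-Laplacian, and [None] is the commutator on the Fourier side. *)
Definition piece_kernel (i : option bool) : R -> R -> C :=
  match i with
  | None => commutator_kernel G
  | Some true => fun x eta => expi (1 * eta * x) * value_symbol eta
  | Some false => fun x eta => expi (1 * eta * x) * half_symbol eta
  end.

Definition piece_coef (i : option bool) : R -> C :=
  match i with
  | None => fun=> 1
  | Some true => fun x => 2 * (c x * c x) + c x * half_laplacian c x
  | Some false => fun x => c x * c x
  end.

Definition piece (i : option bool) u : R -> C :=
  match i with
  | None => fourier_commutator s u
  | Some true => fun x => piece_coef (Some true) x * u x
  | Some false => fun x => piece_coef (Some false) x * half_laplacian u x
  end.

Definition piece_majorant (i : option bool) (x : R) : R :=
  match i with
  | None => kap * Num.sqrt (commutator_majorant G x)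
  | Some true => kap * nr (@value_symbol R) * normc (piece_coef (Some true) x)
  | Some false => kap * nr (@half_symbol R) * normc (piece_coef (Some false) x)
  end.

Let mc : cmeas c. Proof. exact: cmeas_ccos. Qed.

Let L2cc : L2 (fun x => c x * c x).
Proof. exact: (L2M_bounded mc Lc (ccos_le1 theta)). Qed.

Let L2coef (b : bool) : L2 (piece_coef (Some b)).
Proof.
case: b; last exact: L2cc.
apply: L2D; first exact: L2Z.
exact: (L2M_bounded mc (L2_inv_fourier _) (ccos_le1 theta)).
Qed.

Let L2_expi (x : R) v : L2 v -> L2 (fun eta => expi (1 * eta * x) * v eta) /\
  nr (fun eta => expi (1 * eta * x) * v eta) <= nr v.
Proof.
move=> Lv; have me : cmeas (fun eta : R => expi (1 * eta * x)) by exact: cmeas_kernel1.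
have e1 eta : normc (expi (1 * eta * x) : C) <= 1 by rewrite normc_expi.
split; first exact: (L2M_bounded me Lv e1).
by have := nrM_bounded me Lv e1; rewrite mul1r.
Qed.

Lemma L2_piece_kernel i x : L2 (piece_kernel i x).
Proof.
have [Lj La] := @L2_symbols R; case: i => [[]|] /=.
- exact: (proj1 (L2_expi x Lj)).
- exact: (proj1 (L2_expi x La)).
- exact: L2_commutator_kernel.
Qed.

Lemma piece_kernel_cvg i (t : nat -> R) x : t n @[n --> \oo] --> x ->
  nr (fun eta => piece_kernel i (t n) eta - piece_kernel i x eta) @[n --> \oo] --> (0 : R).
Proof.
have [Lj La] := @L2_symbols R; case: i => [[]|] tx.
- exact: (modulation_cvg 1 Lj tx).
- exact: (modulation_cvg 1 La tx).
- exact: (commutator_kernel_cvg (L2_grad cth Lom) tx).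
Qed.

Lemma piece_majorant_sq i : Li (fun x => piece_majorant i x ^+ 2).
Proof.
case: i => [b|]; last exact: (Li_scaled_sq kap (commutator_majorant_sq LG)).
have h k : Li (fun x => (k * normc (piece_coef (Some b) x)) ^+ 2).
  exact: (Li_scaled_sq k (L2_sq (L2coef b))).
by case: b h => h; exact: h.
Qed.

Lemma piece_majorant_le i x :
  normc (kap%:C * piece_coef i x) * nr (piece_kernel i x) <= piece_majorant i x.
Proof.
have k0 : `|kap| = kap :> R by rewrite gtr0_norm// kap_gt0.
have [Lj La] := @L2_symbols R; rewrite normcM normc_real k0.
case: i => [[]|].
- rewrite mulrAC -mulrA [leRHS]mulrAC -[leRHS]mulrA ler_wpM2l ?(ltW (@kap_gt0 R))//.
  by rewrite mulrC ler_wpM2l ?normc_ge0//; exact: (proj2 (L2_expi x Lj)).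
- rewrite mulrAC -mulrA [leRHS]mulrAC -[leRHS]mulrA ler_wpM2l ?(ltW (@kap_gt0 R))//.
  by rewrite mulrC ler_wpM2l ?normc_ge0//; exact: (proj2 (L2_expi x La)).
- by rewrite normc1 mulr1 ler_wpM2l ?(ltW (@kap_gt0 R))//; exact: commutator_kernel_norm_le.
Qed.

Let Lsu v : L2 v -> L2 (fun x => s x * v x).
Proof. by move=> Lv; exact: (L2M_bounded (cmeas_csin cth) Lv (csin_le1 theta)). Qed.

Lemma L2_half u : sobolev 2 u -> L2 (half_laplacian u).
Proof. by move=> su; have [_ h _] := half_domP (sobolev_half_dom su). Qed.

Lemma piece_formula i u : sobolev 2 u -> cmeas (piece i u) /\
  {ae mu, forall x, piece i u x = kap%:C * piece_coef i x *
     cint (fun eta => piece_kernel i x eta * weighted_fourier u eta)}.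
Proof.
move=> su; have [Lu Lw] := L2_weighted_fourier su; have LL := L2_half su.
case: i => [[]|]; split.
- by apply: cmeasM; apply: L2_meas => //; exact: L2coef.
- apply: (ae_mono (value_formula su)) => x h.
  by rewrite /piece h mulrCA mulrA.
- by apply: cmeasM; apply: L2_meas => //; exact: L2coef.
- apply: (ae_mono (half_laplacian_formula su)) => x h.
  by rewrite /piece h mulrCA mulrA.
- apply: cmeasB; last exact/L2_meas/L2_fourier/Lsu.
  by apply: cmeasM; [exact: cmeas_norm|exact/L2_meas/L2_fourier/Lsu].
- have h := commutator_formula cth thB Lom wth Lu Lw.
  apply: (ae_mono h) => x hx; rewrite /piece hx mulr1; congr (_ * _).
  apply: eq_cint => eta; rewrite /piece_kernel /commutator_kernel -[RHS]mulrA.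
  by rewrite (proj1 (weighted_fourierK u eta)).
Qed.

Lemma piece_bound i u (M : R) : sobolev 2 u -> nr (weighted_fourier u) <= M ->
  L2 (piece i u) /\ nr (piece i u) <= M * Num.sqrt (\int[mu]_x (piece_majorant i x ^+ 2)).
Proof.
move=> su wM; have [Lu Lw] := L2_weighted_fourier su; have [mp fp] := piece_formula i su.
exact: (kernel_operator_bound mp (piece_majorant_sq i) (L2_piece_kernel i) (piece_majorant_le i) Lw wM fp).
Qed.

Lemma L2_piece i u : sobolev 2 u -> L2 (piece i u).
Proof. by move=> su; case: (piece_bound i su (lexx _)). Qed.

Definition sin_commutator u : R -> C := fun x =>
  half_laplacian (fun y => s y * u y) x - s x * half_laplacian u x.

(** The transform of s u times |xi| is the sum of two square integrable functions:
    the commutator and the transform of s Lambda u. *)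
Lemma sin_half_dom u : sobolev 2 u -> half_dom (fun x => s x * u x).
Proof.
move=> su; have [Lu _] := L2_weighted_fourier su; split; first exact: Lsu.
have := L2D (L2_piece None su) (L2_fourier (Lsu (L2_half su))).
by congr L2; apply/funext => xi; rewrite /piece /fourier_commutator subrK.
Qed.

Lemma sin_commutator_fourier u : sobolev 2 u -> is_fourier 1 (fourier_commutator s u) (sin_commutator u).
Proof.
move=> su; have F1 := half_domP (sin_half_dom su).
have F2 := inversion (Lsu (L2_half su)).
have := fourier_lin (- 1) (@sq1 R) F2 F1.
by congr (is_fourier _ _ _); apply/funext => x; rewrite mulN1r addrC.
Qed.

Lemma L2_sin_commutator u : sobolev 2 u -> L2 (sin_commutator u).
Proof. by move=> /sin_commutator_fourier[]. Qed.

Definition diffop u : R -> C := fun x => calL_infty u x - calL theta u x.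

(** The second derivatives cancel pointwise, and one factor s^2 of each term
    involving the half-Laplacian is replaced by 1 - c^2. *)
Lemma diffopE u x : diffop u x =
  piece (Some true) u x + piece (Some false) u x - s x * sin_commutator u x.
Proof.
have sc : s x * s x = 1 - c x * c x.
  have e := cos2Dsin2 (theta x); rewrite !expr2 in e.
  by apply: complex_ext; rewrite /csin /ccos /cplx /=; move: e; lra.
rewrite /diffop /calL_infty /calL /sin_commutator /one_plus_half_laplacian /c_coef.
have -> : (fun y => u y * sin_phase theta y) = (fun y => s y * u y).
  by apply/funext => y; rewrite mulrC.
have alg (a b y z d h k : C) : a * a = 1 - b * b ->
    (- d + (y + h)) - (- d + a * (y * a + z) - b * (b + k) * y) =
    (2 * (b * b) + b * k) * y + b * b * h - a * (z - a * h).
  move=> ab; have -> : a * (y * a + z) = a * a * y + a * z by ring.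
  have -> : a * (z - a * h) = a * z - a * a * h by ring.
  by rewrite ab; ring.
exact: alg sc.
Qed.

Lemma sin_mult_le v : L2 v -> nr (fun x => s x * v x) <= nr v.
Proof.
move=> Lv; have := nrM_bounded (cmeas_csin cth) Lv (csin_le1 theta).
by rewrite mul1r.
Qed.

Lemma L2_diffop u : sobolev 2 u -> L2 (diffop u).
Proof.
move=> su; rewrite (funext (diffopE u)).
apply: L2B; last exact: Lsu (L2_sin_commutator su).
by apply: L2D; exact: L2_piece.
Qed.

Lemma diffop_bound : exists2 K : R, 0 <= K &
  forall u (M : R), sobolev 2 u -> nr (weighted_fourier u) <= M -> nr (diffop u) <= K * M.
Proof.
pose k i := Num.sqrt (\int[mu]_x (piece_majorant i x ^+ 2)).
have k0 i : 0 <= k i by exact: sqrtr_ge0.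
exists (k (Some true) + k (Some false) + k None).
  by rewrite addr_ge0// addr_ge0.
move=> u M su wM.
have [L1 b1] := piece_bound (Some true) su wM.
have [L2' b2] := piece_bound (Some false) su wM.
have [_ b3] := piece_bound None su wM.
have LN := L2_sin_commutator su; have Ls := Lsu LN.
rewrite (funext (diffopE u)).
apply: (le_trans (nrB (L2D L1 L2') Ls)).
rewrite !mulrDl !(mulrC _ M); apply: lerD; last first.
  apply: (le_trans (sin_mult_le LN)).
  by rewrite (fourier_norm (@sq1 R) (sin_commutator_fourier su)).
exact: (le_trans (nrD L1 L2') (lerD b1 b2)).
Qed.

Lemma half_laplacian_sin_lin (a : C) u v : sobolev 2 u -> sobolev 2 v ->
  {ae mu, forall x,
    half_laplacian (fun y => s y * (a * u y + v y)) x =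
    a * half_laplacian (fun y => s y * u y) x +
    half_laplacian (fun y => s y * v y) x}.
Proof.
move=> su sv; have := half_laplacian_lin a (sin_half_dom su) (sin_half_dom sv).
rewrite (_ : (fun y => a * (s y * u y) + s y * v y) =
             (fun y => s y * (a * u y + v y)))//.
by apply/funext => y; rewrite mulrDr mulrCA.
Qed.

Lemma diffop_lin (a : C) u v : sobolev 2 u -> sobolev 2 v ->
  {ae mu, forall x, diffop (fun y => a * u y + v y) x =
                    a * diffop u x + diffop v x}.
Proof.
move=> su sv.
have h1 := half_laplacian_lin a (sobolev_half_dom su) (sobolev_half_dom sv).
have h2 := half_laplacian_sin_lin a su sv.
apply: (ae_mono (ae_and h1 h2)) => x [e1 e2].
rewrite !diffopE /piece /sin_commutator e1 e2.
have alg (m n t y z p q p' q' : C) :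
    m * (a * y + z) + n * (a * p + q) - t * (a * p' + q' - t * (a * p + q)) =
    a * (m * y + n * p - t * (p' - t * p)) + (m * z + n * q - t * (q' - t * q)).
  by ring.
exact: alg.
Qed.

Lemma diffop_ae u v : sobolev 2 u -> sobolev 2 v ->
  {ae mu, forall x, u x = v x} -> {ae mu, forall x, diffop u x = diffop v x}.
Proof.
move=> su sv uv.
have h1 := half_laplacian_ae (sobolev_half_dom su) (sobolev_half_dom sv) uv.
have suv : {ae mu, forall x, s x * u x = s x * v x}.
  by apply: (ae_mono uv) => x ->.
have h2 := half_laplacian_ae (sin_half_dom su) (sin_half_dom sv) suv.
apply: (ae_mono (ae_and uv (ae_and h1 h2))) => x [e0 [e1 e2]].
by rewrite !diffopE /piece /sin_commutator e0 e1 e2.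
Qed.

Lemma diffop_linear : linear_operator (sobolev 2) L2 diffop.
Proof.
split; first exact: L2_diffop.
  move=> u v su sv uv.
  have uv' : {ae mu, forall x, u x = v x}.
    by apply: (ae_mono uv) => x h; exact: h.
  by apply: (ae_mono (diffop_ae su sv uv')) => x h _; exact: h.
move=> a u v su sv.
by apply: (ae_mono (diffop_lin a su sv)) => x h _; exact: h.
Qed.

(** By linearity and the bound, applied to the difference, which is again of order
    two. *)
Lemma diffop_continuous :
  continuous_operator (sobolev 2) (sobolev_norm 2) L2norm diffop.
Proof.
have [K K0 hK] := diffop_bound; move=> u su e e0.
have K2 : 0 < 2 * K + 1 by rewrite ltr_wpDl// mulr_ge0.
exists (e / (2 * K + 1)); first by rewrite divr_gt0.
move=> v sv; set d := e / _ => hd.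
have sw := sobolev_sub sv su.
have hw := weighted_fourier_le sw (ltW hd); have hT := hK _ _ sw hw.
have E := diffop_lin (- 1) su sv.
have uvE : (fun y => - 1 * u y + v y) = (fun y => v y - u y).
  by apply/funext => y; rewrite mulN1r addrC.
rewrite uvE in E.
have LD : L2 (fun x => diffop v x - diffop u x) := L2B (L2_diffop sv) (L2_diffop su).
rewrite (L2normE LD) lte_fin.
have -> : nr (fun x => diffop v x - diffop u x) = nr (diffop (fun y => v y - u y)).
  apply: nr_ae; [exact: L2_meas|exact: L2_meas (L2_diffop sw)|].
  by apply: (ae_mono E) => x ->; rewrite mulN1r addrC.
apply: (le_lt_trans hT); rewrite mulrA.
have -> : e = d * (2 * K + 1) by rewrite /d divfK// gt_eqF.
have d0 : 0 < d by rewrite /d divr_gt0.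
by rewrite [K * 2]mulrC [_ * d]mulrC mulrDr mulr1 ltrDl.
Qed.

(** The three pieces converge along a common extraction; the commutator converges on
    the Fourier side, hence also after inversion. *)
Lemma diffop_compact :
  compact_operator (sobolev 2) L2 (sobolev_norm 2) L2norm diffop.
Proof.
move=> u M hu; have su n : sobolev 2 (u n) by case: (hu n).
pose w n := weighted_fourier (u n).
have Lw n : L2 (w n) by case: (L2_weighted_fourier (su n)).
have wM n : nr (w n) <= 2 * M by apply: weighted_fourier_le => //; case: (hu n).
have [k ek hk] := weak_subsequence L2_piece_kernel piece_kernel_cvg Lw wM.
have lim i : exists2 v, L2 v &
    nr (fun x => piece i (u (k n)) x - v x) @[n --> \oo] --> (0 : R).
  apply: (@kernel_operator_compact _ (fun n => piece i (u (k n)))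
    (fun n => w (k n)) (fun x => kap%:C * piece_coef i x) (piece_kernel i) (piece_majorant i) (2 * M)).
  - by move=> n; case: (piece_formula i (su (k n))).
  - exact: piece_majorant_sq.
  - exact: L2_piece_kernel.
  - exact: piece_majorant_le.
  - by move=> n; exact: Lw.
  - by move=> n; exact: wM.
  - by move=> n; case: (piece_formula i (su (k n))).
  - exact: hk.
have [v1 Lv1 h1] := lim (Some true); have [v2 Lv2 h2] := lim (Some false).
have [p Lp h3] := lim None.
have Fp := inv_fourierP Lp; have [_ Lq _] := Fp.
pose v x := v1 x + v2 x - s x * inv_fourier p x.
have Lv : L2 v by apply: L2B; [exact: L2D|exact: Lsu].
exists k, v; split; [exact: ek|exact: Lv|].
apply/L2norm_cvg0.
  by move=> n; apply: L2B => //; exact: L2_diffop.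
apply: (cvg0_le _ _ (cvg0D (cvg0D h1 h2) h3)) => n; first exact: nr_ge0.
have Q1 := L2B (L2_piece (Some true) (su (k n))) Lv1.
have Q2 := L2B (L2_piece (Some false) (su (k n))) Lv2.
have Q3 := L2B (L2_sin_commutator (su (k n))) Lq.
rewrite -(fourier_dist (@sq1 R) (sin_commutator_fourier (su (k n))) Fp).
apply: le_trans (lerD (lexx _) (sin_mult_le Q3)).
apply: le_trans (lerD (nrD Q1 Q2) (lexx _)).
apply: le_trans (nrB (L2D Q1 Q2) (Lsu Q3)).
rewrite le_eqVlt; apply/orP; left; apply/eqP; congr nr; apply/funext => x.
rewrite diffopE /v.
have alg (a b c0 d e f t : C) :
  a + b - t * c0 - (d + e - t * f) = a - d + (b - e) - t * (c0 - f) by ring.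
exact: alg.
Qed.

End Pieces.

(** * Continuity and compactness *)

Theorem theorem4p3 (R : realType) (theta : R -> R)
    (theta_neel : neel_wall_phase theta) :
  let T := fun (u : R -> complex R) (x : R) =>
    (calL_infty u x - calL theta u x)%R in
  [/\ linear_operator (sobolev 2) L2 T,
      continuous_operator (sobolev 2) (sobolev_norm 2) L2norm T &
      compact_operator (sobolev 2) L2 (sobolev_norm 2) L2norm T].
Proof.
move=> T.
have [[[cth hth _ _] [[omega w Lom] Lc]] _ _] := theta_neel.
have thB x : `|theta x| <= pi / 2.
  by rewrite ler_norml; have /andP[h1 h2] := hth x; rewrite !ltW.
split; [exact: (diffop_linear cth thB Lom w Lc)
  |exact: (diffop_continuous cth thB Lom w Lc)
  |exact: (diffop_compact cth thB Lom w Lc)].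
Qed.
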